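(* Let $\mathbb{F}_3=\mathbb{V}\times\wedge^2\mathbb{V}$ be the free two-step Carnot group with three generators, with its left-invariant subRiemannian distance. Then the cut locus of the origin is $$\mathrm{Cut}_0=\{(x,t)\in\mathbb{V}\times\wedge^2\mathbb{V}:\ t\neq 0 \text{ and } x\perp\operatorname{supp} t\}.$$
   Context: $\mathbb{V}$ is a three-dimensional real vector space with inner product $\langle\cdot,\cdot\rangle$. $\mathbb{F}_3=\mathbb{V}\times\wedge^2\mathbb{V}$ has the Lie group law $(x,t)\cdot(\xi,\tau)=(x+\xi,\,t+\tau+\frac12 x\wedge\xi)$. Since $\dim\mathbb{V}=3$, every $t\in\wedge^2\mathbb{V}$ can be written $t=y\wedge y'$ with $y,y'\in\mathbb{V}$; for $t\ne0$ the support is $\operatorname{supp}t=\operatorname{span}\{y,y'\}$, which does not depend on the choice of $y,y'$. A curve $\gamma=(x,t)\in W^{1,2}((0,T),\mathbb{F}_3)$ is horizontal with control $u\in L^2((0,T),\mathbb{V})$ if $\dot x=u$ and $\dot t=\frac12 x\wedge u$ almost everywhere. Its length is $\int_0^T|u(s)|\,ds$. The subRiemannian distance $d$ between two points is the infimum (which is attained) of the lengths of horizontal curves joining them. Constant-speed length-minimizers starting from the origin $(0,0)$ are extremal curves, i.e. horizontal curves with control $u(s)=a\cos(\lambda s)+b\sin(\lambda s)+z$, where $\lambda\ge0$ and $a,b,z\in\mathbb{V}$ are pairwise orthogonal with $|a|=|b|>0$. The cut time of an extremal curve $\gamma:[0,\infty)\to\mathbb{F}_3$ with $\gamma(0)=(0,0)$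 is $t_{\mathrm{cut}}=\sup\{\bar s>0:\gamma \text{ is a length-minimizer on }[0,\bar s]\}\in(0,+\infty]$, and the cut locus $\mathrm{Cut}_0$ of the origin is the set of all points $\gamma(t_{\mathrm{cut}})$, where $\gamma$ is an extremal curve starting from the origin with $t_{\mathrm{cut}}<\infty$. *)

(* Defs.v *)
From mathcomp Require Import all_boot all_order all_algebra.
From mathcomp Require Import all_classical all_reals all_analysis.
From mathcomp Require Export sesquilinear.

Set Implicit Arguments.
Unset Strict Implicit.
Unset Printing Implicit Defensive.

Import Order.TTheory GRing.Theory Num.Theory numFieldNormedType.Exports.
Local Open Scope classical_set_scope.
Local Open Scope ring_scope.

(* [(W, w)] is the exterior square of [V], through its universal property:
   every alternating bilinear map on [V] factors uniquely through [w]. *)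
Definition is_exterior_square (R : realType) (V W : vectType R)
    (w : {bilinear V -> V -> W}) : Prop :=
  (forall x, w x x = 0) /\
  forall (U : vectType R) (B : {bilinear V -> V -> U}),
    (forall x, B x x = 0) ->
    exists! f : 'Hom(W, U), forall x y, B x y = f (w x y).

Definition f3_mul (R : realType) (V W : vectType R)
    (w : {bilinear V -> V -> W}) (p q : V * W) : V * W :=
  (p.1 + q.1, p.2 + q.2 + 2^-1 *: w p.1 q.1).

Definition horizontal_field (R : realType) (V W : vectType R)
    (w : {bilinear V -> V -> W}) (v : V) (p : V * W) : V * W :=
  (v, 2^-1 *: w p.1 v).

(* [horizontal_field w v] is the left-invariant vector field with value
   [(v, 0)] at the origin. *)
Lemma horizontal_field_left_invariant (R : realType) (V W : vectType R)
    (w : {bilinear V -> V -> W}) (v : V) (p : V * W) (h : R) :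
  f3_mul w p (h *: v, 0) = p + h *: horizontal_field w v p.
Proof.
case: p => x t; rewrite /f3_mul /horizontal_field /= addr0.
by rewrite linearZr_LR /= scalerA mulrC -scalerA.
Qed.

(* A finite-dimensional space carries no canonical norm in the library, so the
   analytic notions for curves in [U] are read through the linear functionals
   on [U]; this amounts to working in the coordinates of any basis. *)

Definition L2 (R : realType) (U : vectType R) (T : R) (u : R -> U) : Prop :=
  forall phi : 'Hom(U, R^o),
    measurable_fun `[0, T] (fun s => phi (u s) : R) /\
    (\int[lebesgue_measure]_(s in `[0%R, T]) ((phi (u s) : R) ^+ 2)%:E
       < +oo)%E.

(* The continuous representatives on [[0, T]] of the elements of
   W^{1,2}((0, T), U), i.e. the absolutely continuous curves with derivative in
   L^2, given as the primitives of L^2 functions. *)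
Definition W12 (R : realType) (U : vectType R) (T : R) (f : R -> U) : Prop :=
  exists2 g : R -> U, L2 T g &
    forall (phi : 'Hom(U, R^o)) (s : R), 0 <= s <= T ->
      phi (f s) =
      phi (f 0) + \int[lebesgue_measure]_(r in `[0, s]) (phi (g r) : R) :> R.

Definition has_velocity (R : realType) (U : vectType R)
    (f : R -> U) (s : R) (v : U) : Prop :=
  forall phi : 'Hom(U, R^o), is_derive s (1 : R) (fun r => phi (f r)) (phi v).

Definition horizontal (R : realType) (V W : vectType R)
    (w : {bilinear V -> V -> W}) (T : R) (gamma : R -> V * W) (u : R -> V)
    : Prop :=
  [/\ L2 T u, W12 T gamma &
      {ae lebesgue_measure, forall s : R, 0 < s < T ->
         has_velocity gamma s (horizontal_field w (u s) (gamma s))}].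

Definition vnorm (R : realType) (V : vectType R) (ip : {dot V for idfun})
    (v : V) : R :=
  Num.sqrt (ip v v).

Definition length (R : realType) (V : vectType R) (ip : {dot V for idfun})
    (T : R) (u : R -> V) : \bar R :=
  (\int[lebesgue_measure]_(s in `[0%R, T]) (vnorm ip (u s))%:E)%E.

Definition dist (R : realType) (V W : vectType R) (ip : {dot V for idfun})
    (w : {bilinear V -> V -> W}) (p q : V * W) : \bar R :=
  ereal_inf [set l | exists T gamma u,
    [/\ 0 < T, horizontal w T gamma u, gamma 0 = p, gamma T = q &
        l = length ip T u]].

Definition minimizer (R : realType) (V W : vectType R) (ip : {dot V for idfun})
    (w : {bilinear V -> V -> W}) (T : R) (gamma : R -> V * W) : Prop :=
  exists2 u, horizontal w T gamma u &
    length ip T u = dist ip w (gamma 0) (gamma T).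

(* Curves on [[0, +oo)]; the values of [gamma] at negative times are
   irrelevant. *)
Definition extremal (R : realType) (V W : vectType R) (ip : {dot V for idfun})
    (w : {bilinear V -> V -> W}) (gamma : R -> V * W) : Prop :=
  exists (lambda : R) (a b z : V),
    [/\ 0 <= lambda,
        [/\ ip a b = 0, ip a z = 0 & ip b z = 0],
        vnorm ip a = vnorm ip b, 0 < vnorm ip a &
        forall T : R, 0 < T ->
          horizontal w T gamma (fun s =>
            cos (lambda * s) *: a + sin (lambda * s) *: b + z)].

Definition cut_time (R : realType) (V W : vectType R) (ip : {dot V for idfun})
    (w : {bilinear V -> V -> W}) (gamma : R -> V * W) : \bar R :=
  ereal_sup [set s%:E | s in [set s : R | 0 < s /\ minimizer ip w s gamma]].

Definition cut_locus (R : realType) (V W : vectType R) (ip : {dot V for idfun})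
    (w : {bilinear V -> V -> W}) : set (V * W) :=
  [set p | exists (gamma : R -> V * W) (T : R),
    [/\ extremal ip w gamma, gamma 0 = 0, cut_time ip w gamma = T%:E &
        gamma T = p]].

(* The span of [y, y'] for a chosen decomposition [t = w y y'], which exists
   when [V] has dimension 3. *)
Definition supp (R : realType) (V W : vectType R) (w : {bilinear V -> V -> W})
    (t : W) : {vspace V} :=
  let y := xget (0, 0) [set y : V * V | t = w y.1 y.2] in
  <<[:: y.1; y.2]>>%VS.

(* Main.v *)
Require Import Defs.
From HB Require Import structures.
From mathcomp Require Import all_boot all_order all_algebra.
From mathcomp Require Import all_classical all_reals all_analysis.
From mathcomp Require Import measurable_realfun.
From mathcomp Require Import ring lra.
Set Implicit Arguments.
Unset Strict Implicit.
Unset Printing Implicit Defensive.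
Import Order.TTheory GRing.Theory Num.Theory numFieldNormedType.Exports.
Local Open Scope classical_set_scope.
Local Open Scope ring_scope.

(** A curve from the origin to [(x, t)] with [x] orthogonal to [supp t] is
    written in an orthonormal frame [(e, f, n)], where [n] is normal to [supp t]
    and [f] is chosen orthogonal to the chord of the projected curve between one
    third and two thirds of its length.  Given the [f]-component [y], with mean
    [m] and variance [v] with respect to arc length, the constraints on the other
    two components are linear, so the squared length is at least
    |x|^2 + (|t|^2 + |x|^2 m^2) / v + (Dirichlet energy of y).  Since
    y(1/3) = y(2/3), the energy is bounded below by comparison with the symmetric
    profiles [cos (2 th (r - 1/2)) - cos th], where [th] runs from [pi] to the
    first zero of [sin th - th cos th] after [pi].  Minimizing the resulting
    function of [m], [v] and [th] gives exactly the length of the extremals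
    that satisfy [x] orthogonal to [supp t] for the first time, so these are
    minimizers up to that time.

    Beyond it an extremal is not minimizing: a half-turn about [n] of its
    initial part reaches the same point with the same length but another
    velocity, and the resulting corner can be shortened without moving the
    endpoint.  Every extremal with [lam > 0] has such a time, and every [(x, t)]
    with [t <> 0] and [x] orthogonal to [supp t] is reached in this way, both by
    the intermediate value theorem in [th]; straight lines have no cut time. *)

(** The thirds and the bound [3 / 2 * pi] belong together. On [0, 1] the comparison profiles have
    frequency [lam = 2 th] above 2 pi, where the odd function sin (2 pi r), with mean zero and
    energy 4 pi^2 times its variance, would violate the comparison. The condition y(1/3) = y(2/3)
    excludes it, and it can be imposed because the frame may still turn about n. The symmetric
    profile also takes equal values at 1/3 and 2/3, so one amplitude matches it to y at both points.
    The comparison then splits into three intervals at whose ends y minus profile vanishes, and a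
    Riccati argument works on each as long as lam / 3 < pi, that is th < 3 pi / 2. Competitors are
    only absolutely continuous. The inequality is therefore certified by an explicit function of r
    whose increments are nonnegative up to quadratic errors; the multipliers of the area constraints
    stay free in it and are optimized afterwards. The half-turn about n fixes the cut point because
    x is a multiple of n, while the two vectors spanning supp t are both reversed, which leaves
    their wedge unchanged. *)

Section Calculus.
Context {R : realType}.
Implicit Types (f : R -> R) (a b : R).

Lemma is_derive_continuous f (x d : R) : is_derive x 1 f d -> {for x, continuous f}.
Proof. by move=> [df _]; apply/differentiable_continuous/derivable1_diffP. Qed.

Lemma is_derive_within_continuous f (f' : R -> R) a b :
  (forall x, a <= x <= b -> is_derive x 1 f (f' x)) ->
  {within `[a, b], continuous f}.
Proof.
move=> df; apply: derivable_within_continuous => x.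
by rewrite in_itv /= => /df [].
Qed.

Lemma nondecreasing_derive f (f' : R -> R) a b :
  (forall x, a <= x <= b -> is_derive x 1 f (f' x)) ->
  (forall x, a < x < b -> 0 <= f' x) -> a <= b -> f a <= f b.
Proof.
move=> df f'0; rewrite le_eqVlt => /predU1P[-> //|ab].
have [|c cab E] := @MVT _ f f' a b ab _ (is_derive_within_continuous df).
  by move=> x /subset_itv_oo_cc; rewrite in_itv; exact: df.
rewrite -subr_ge0 E mulr_ge0 ?subr_ge0 ?(ltW ab)// f'0 //.
Qed.

Lemma nonincreasing_derive f (f' : R -> R) a b :
  (forall x, a <= x <= b -> is_derive x 1 f (f' x)) ->
  (forall x, a < x < b -> f' x <= 0) -> a <= b -> f b <= f a.
Proof.
move=> df f'0 ab; rewrite -lerN2.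
apply: (@nondecreasing_derive (- f) (fun x => - f' x)) => // x xab.
  by have := df _ xab => ?; exact: is_deriveN.
by rewrite oppr_ge0 f'0.
Qed.

Lemma zero_of_sign_change f (f' : R -> R) a b : a <= b ->
  (forall x, a <= x <= b -> is_derive x 1 f (f' x)) ->
  0 <= f a -> f b <= 0 -> exists2 c, a <= c <= b & f c = 0.
Proof.
move=> ab df fa fb.
have [||c cab fc] := @IVT _ f a b 0 ab.
- exact: is_derive_within_continuous df.
- by rewrite ge_min le_max fa fb orbT.
by exists c => //; move: cab; rewrite in_itv.
Qed.

End Calculus.

(** * The cut angle *)

Section CutFunctions.
Context {R : realType}.
Implicit Types th : R.

(* With [th = lam * s / 2], the extremal at time [s] is, up to a rotation of
   [a] and [b], x = s ((sin th / th) a + z) and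
   t = s^2 / (4 th^2) (cutp th a + 2 cutM th z) /\ b. *)
Definition cutM th : R := sin th - th * cos th.
Definition cutp th : R := th - sin th * cos th.
Definition cutV th : R := th ^+ 2 + th * sin th * cos th - 2 * sin th ^+ 2.

(** Up to sign, [cutV th / th] is the determinant of the system giving x / s and the vector
    [cutp th a + 2 cutM th z] in terms of a and z. Its positivity lets a and z be recovered from an
    endpoint. *)
Lemma cutVE th : cutV th = th * cutp th - 2 * cutM th * sin th.
Proof. rewrite /cutV /cutp /cutM; ring. Qed.

Global Instance is_derive_cutM th : is_derive th 1 (@cutM) (th * sin th).
Proof. rewrite /cutM; apply: is_derive_eq; rewrite /GRing.scale /=; ring. Qed.

Global Instance is_derive_cutp th : is_derive th 1 (@cutp) (2 * sin th ^+ 2).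
Proof.
rewrite /cutp; apply: is_derive_eq; rewrite /GRing.scale /=.
have := cos2sin2 th; nra.
Qed.

Global Instance is_derive_cutV th :
  is_derive th 1 (@cutV) (3 * cutp th - 2 * th * sin th ^+ 2).
Proof.
rewrite /cutV /cutp; apply: is_derive_eq; rewrite /GRing.scale /=.
have := cos2sin2 th => E.
transitivity (2 * th + sin th * cos th + th * cos th ^+ 2 - th * sin th ^+ 2
  - 4 * sin th * cos th); first ring.
rewrite E; ring.
Qed.

Lemma sin_le0_cut th : pi <= th <= 3 / 2 * pi -> sin th <= 0.
Proof.
move=> /andP[h1 h2]; have := @sin_ge0_pi R (th - pi).
rewrite sinB sinpi cospi => H; suff : 0 <= sin th * -1 - cos th * 0 by lra.
by apply: H; have := pi_gt0 R; lra.
Qed.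

Lemma cos_le0_cut th : pi <= th <= 3 / 2 * pi -> cos th <= 0.
Proof.
move=> /andP[h1 h2]; have := @cos_ge0_pihalf R (th - pi).
rewrite cosB sinpi cospi => H; suff : 0 <= cos th * -1 + sin th * 0 by lra.
by apply: H; have := pi_gt0 R; lra.
Qed.

Lemma cut_bounds th : pi <= th <= 3 / 2 * pi ->
  [/\ 2 <= th, sin th <= 0, cos th <= 0, sin th ^+ 2 <= 1 &
      0 <= sin th * cos th <= 1 / 2].
Proof.
move=> h; have s0 := sin_le0_cut h; have c0 := cos_le0_cut h.
have E := cos2sin2 th.
split => //; first by have := pi_ge2 R; lra.
have := sqr_ge0 (sin th - cos th); rewrite sqrrB E => ?.
  by rewrite mulr_le0//=; lra.
Qed.

Lemma cutp_gt0 th : pi <= th <= 3 / 2 * pi -> 0 < cutp th.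
Proof. by move=> /cut_bounds[? _ _ _ /andP[_ ?]]; rewrite /cutp; lra. Qed.

Lemma cutV_gt0 th : pi <= th <= 3 / 2 * pi -> 0 < cutV th.
Proof.
move=> /cut_bounds[h2 s0 c0 s1 /andP[sc0 sc1]].
rewrite /cutV -mulrA.
have : 0 <= th * (sin th * cos th) by rewrite mulr_ge0//; lra.
have : 4 <= th ^+ 2 by nra.
lra.
Qed.

Lemma cutV'_ge0 th : pi <= th <= 3 / 2 * pi ->
  0 <= 3 * cutp th - 2 * th * sin th ^+ 2.
Proof.
move=> /cut_bounds[h2 s0 c0 s1 /andP[sc0 sc1]]; rewrite /cutp.
have : 0 <= th * (1 - sin th ^+ 2) by rewrite mulr_ge0//; lra.
lra.
Qed.

Lemma cutM_nonincreasing th1 th2 : pi <= th1 -> th1 <= th2 ->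
  th2 <= 3 / 2 * pi -> cutM th2 <= cutM th1.
Proof.
move=> h1 h12 h2.
apply: (@nonincreasing_derive _ _ (fun t => t * sin t)) => // t /andP[ta tb].
have /cut_bounds[? ? _ _ _] : pi <= t <= 3 / 2 * pi by lra.
by rewrite mulr_ge0_le0//; lra.
Qed.

(* The interval [pi, phi[, where phi is the first zero of [cutM] after pi. *)
Definition cut_range th := [&& pi <= th, th < 3 / 2 * pi & 0 < cutM th].

Lemma cut_rangeW th : cut_range th -> pi <= th <= 3 / 2 * pi.
Proof. by case/and3P=> h1 h2 _; lra. Qed.

Lemma cutM_pi : cutM pi = pi.
Proof. rewrite /cutM sinpi cospi; ring. Qed.

Lemma sin_3pi2 : sin (3 / 2 * pi) = -1 :> R.
Proof.
have -> : 3 / 2 * pi = pi / 2 + pi :> R by field.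
by rewrite sinDpi sin_pihalf.
Qed.

Lemma cos_3pi2 : cos (3 / 2 * pi) = 0 :> R.
Proof.
have -> : 3 / 2 * pi = pi / 2 + pi :> R by field.
by rewrite cosDpi cos_pihalf oppr0.
Qed.

(** [cutM] descends from pi at [pi] to -1 at [3 / 2 * pi], with derivative [th * sin th]. *)
Lemma cut_phi_exists : exists phi,
  [/\ pi < phi < 3 / 2 * pi, cutM phi = 0, sin phi < 0 &
      forall th, cut_range th = (pi <= th < phi)].
Proof.
have pi0 := pi_gt0 R.
have [|phi /andP[p1 p2] Mphi] := @zero_of_sign_change _ cutM (fun t => t * sin t)
    pi (3 / 2 * pi) ltac:(lra) (fun x _ => is_derive_cutM x)
    ltac:(rewrite cutM_pi; lra).
  by rewrite /cutM sin_3pi2 cos_3pi2; lra.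
have p1' : pi < phi.
  rewrite lt_neqAle p1 andbT; apply/negP => /eqP E.
  by move: Mphi; rewrite -E cutM_pi; lra.
have p2' : phi < 3 / 2 * pi.
  rewrite lt_neqAle p2 andbT; apply/negP => /eqP E.
  by move: Mphi; rewrite E /cutM sin_3pi2 cos_3pi2; lra.
have [h2 s0 c0 _ _] := @cut_bounds phi ltac:(lra).
have sphi : sin phi < 0.
  rewrite lt_neqAle s0 andbT; apply/negP => /eqP E.
  move: Mphi; rewrite /cutM E sub0r => /eqP; rewrite oppr_eq0 mulf_eq0.
  case/orP => /eqP E'; first by lra.
  by have := cos2sin2 phi; rewrite E E' => ?; lra.
exists phi; split => //; first by rewrite p1'.
move=> th; apply/idP/idP.
  case/and3P => h1 h3 hM; rewrite h1 /= ltNge; apply/negP => h4.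
  have := @cutM_nonincreasing phi th ltac:(lra) h4 ltac:(lra); lra.
case/andP => h1 h3; apply/and3P; split => //; first by lra.
(* Weak monotonicity would only give [0 <= cutM th]. The mean value point lies strictly beyond [pi],
   where [sin] is negative, and this excludes zero. *)
rewrite ltNge; apply/negP => h4.
have [|c] := @MVT _ cutM (fun t => t * sin t) th phi h3
    (fun x _ => is_derive_cutM x).
  by apply: (@is_derive_within_continuous _ _ (fun t => t * sin t)) => *; exact: is_derive_cutM.
rewrite in_itv /= => /andP[c1 c2] E.
have : 0 <= c * sin c * (phi - th) by rewrite -E Mphi; lra.
rewrite pmulr_lge0 ?subr_gt0// pmulr_rge0; last by lra.
suff : sin c < 0 by lra.
have -> : c = (c - pi) + pi by ring.
rewrite sinDpi oppr_lt0; apply: sin_gt0_pi; lra.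
Qed.

End CutFunctions.

(** * Minimization over mean, variance and angle *)

Section ReducedProblem.
Context {R : realType}.
Implicit Types th : R.

(* For the profile [y = cos (2 th (r - 1/2)) - cos th] on [0, 1], [cutg th] is
   the Dirichlet energy divided by the variance, [cutq th] the squared mean
   divided by the variance, and [cutB = - d (sqrt cutg) / d cutq]. *)
Definition cutg th : R := 4 * th ^+ 3 * cutp th / cutV th.
Definition cutq th : R := 2 * cutM th ^+ 2 / cutV th.
Definition cutB th : R :=
  - (2 * th ^+ 2 * sin th) / (cutM th * Num.sqrt (cutg th)).

Let cutV' th : R := 3 * cutp th - 2 * th * sin th ^+ 2.
(** Common factor of the derivatives of [cutg] and [cutq]. It cancels in their quotient, which is
    why the slope [cutB] has a short closed form. *)
Let cutE th : R := 2 * th * sin th * cutV th - cutM th * cutV' th.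

Lemma cutg_gt0 th : pi <= th <= 3 / 2 * pi -> 0 < cutg th.
Proof.
move=> h; have [h2 _ _ _ _] := cut_bounds h.
by rewrite /cutg divr_gt0 ?cutV_gt0// !mulr_gt0 ?exprn_gt0 ?cutp_gt0//; lra.
Qed.

Lemma is_derive_cutg th : pi <= th <= 3 / 2 * pi ->
  is_derive th 1 cutg (8 * th ^+ 2 * sin th * cutE th / cutV th ^+ 2).
Proof.
move=> h; have V0 : cutV th != 0 by rewrite gt_eqF// cutV_gt0.
rewrite /cutg; apply: is_derive_eq; rewrite /GRing.scale /= /cutE /cutV'.
move: V0; rewrite /cutV /cutp /cutM => V0; field.
exact: V0.
Qed.

Lemma is_derive_cutq th : pi <= th <= 3 / 2 * pi ->
  is_derive th 1 cutq (2 * cutM th * cutE th / cutV th ^+ 2).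
Proof.
move=> h; have V0 : cutV th != 0 by rewrite gt_eqF// cutV_gt0.
rewrite /cutq; apply: is_derive_eq; rewrite /GRing.scale /= /cutE -/(cutV' th).
by field.
Qed.

Lemma cutE_le0 th : pi <= th <= 3 / 2 * pi -> 0 <= cutM th -> cutE th <= 0.
Proof.
move=> h M0; have [h2 s0 _ _ _] := cut_bounds h.
rewrite /cutE subr_le0 (@le_trans _ _ 0)//; last first.
  by rewrite mulr_ge0// cutV'_ge0.
by rewrite mulr_le0_ge0 ?(ltW (cutV_gt0 h))// mulr_ge0_le0//; lra.
Qed.

Lemma cut_factor1_nondecreasing th1 th2 :
  pi <= th1 -> th1 <= th2 -> cut_range th2 ->
  sin th1 ^+ 2 / cutp th1 <= sin th2 ^+ 2 / cutp th2.
Proof.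
move=> h1 h12 r2; have /and3P[_ h3 M2] := r2.
apply: (@nondecreasing_derive _ (fun t => sin t ^+ 2 / cutp t)
  (fun t => - (2 * sin t * cutM t) / cutp t ^+ 2)) => // t /andP[ta tb].
  have h : pi <= t <= 3 / 2 * pi by lra.
  have p0 : cutp t != 0 by rewrite gt_eqF// cutp_gt0.
  apply: is_derive_eq; rewrite /GRing.scale /=.
  have -> : cutM t = sin t ^+ 3 - cos t * cutp t.
    by rewrite /cutM /cutp; have := cos2sin2 t => E; ring: E.
  by field.
have h : pi <= t <= 3 / 2 * pi by lra.
have [_ s0 _ _ _] := cut_bounds h.
rewrite divr_ge0 ?sqr_ge0// oppr_ge0 mulr_le0_ge0//; first by lra.
apply: (le_trans (ltW M2)); apply: cutM_nonincreasing => //; lra.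
Qed.

Lemma cut_factor2_nondecreasing th1 th2 :
  pi <= th1 -> th1 <= th2 -> th2 <= 3 / 2 * pi ->
  th1 * cutV th1 <= th2 * cutV th2.
Proof.
move=> h1 h12 h2.
apply: (@nondecreasing_derive _ (fun t => t * cutV t)
  (fun t => cutV t + t * cutV' t)) => // t /andP[ta tb].
  by apply: is_derive_eq; rewrite /GRing.scale /= /cutV'; ring.
have h : pi <= t <= 3 / 2 * pi by lra.
have [t2 _ _ _ _] := cut_bounds h.
by rewrite addr_ge0 ?(ltW (cutV_gt0 h))// mulr_ge0 ?cutV'_ge0//; lra.
Qed.

Lemma cutB_ge0 th : cut_range th -> 0 <= cutB th.
Proof.
move=> r; have h := cut_rangeW r; have /and3P[_ _ M0] := r.
have [_ s0 _ _ _] := cut_bounds h.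
rewrite /cutB mulNr oppr_ge0 mulr_le0_ge0 ?invr_ge0 ?mulr_ge0 ?sqrtr_ge0 ?(ltW M0)//.
by rewrite mulr_ge0_le0// mulr_ge0 ?sqr_ge0.
Qed.

(** Splits the square into three nonnegative factors, each nondecreasing for its own reason, so that
    monotonicity of [cutB] follows without differentiating it. *)
Lemma cutB_sqr th : cut_range th ->
  cutB th ^+ 2 = (sin th ^+ 2 / cutp th) * (th * cutV th) / cutM th ^+ 2.
Proof.
move=> r; have h := cut_rangeW r; have /and3P[_ _ M0] := r.
have [t2 _ _ _ _] := cut_bounds h.
rewrite /cutB expr_div_n exprMn sqr_sqrtr ?(ltW (cutg_gt0 h))// /cutg.
have := cutV_gt0 h; have := cutp_gt0 h => p0 V0; field.
by rewrite !gt_eqF//; lra.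
Qed.

Lemma cutB_nondecreasing th1 th2 :
  pi <= th1 -> th1 <= th2 -> cut_range th2 -> cutB th1 <= cutB th2.
Proof.
move=> h1 h12 r2; have /and3P[_ h3 M2] := r2.
have hh : pi <= th1 <= 3 / 2 * pi by lra.
have MM : cutM th2 <= cutM th1 by apply: cutM_nonincreasing => //; lra.
have r1 : cut_range th1 by apply/and3P; split => //; lra.
rewrite -(@ler_pXn2r _ 2) ?nnegrE ?cutB_ge0// !cutB_sqr//.
have [t2 _ _ _ _] := cut_bounds hh.
have M1 : 0 < cutM th1 by lra.
have V1 := cutV_gt0 hh; have p1 := cutp_gt0 hh.
apply: ler_pM.
- apply: mulr_ge0; first by rewrite divr_ge0 ?sqr_ge0// ltW.
  by rewrite mulr_ge0 ?(ltW V1)//; lra.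
- by rewrite invr_ge0 sqr_ge0.
- apply: ler_pM; first by rewrite divr_ge0 ?sqr_ge0// ltW.
  + by rewrite mulr_ge0 ?(ltW V1)//; lra.
  + exact: cut_factor1_nondecreasing.
  + by apply: cut_factor2_nondecreasing => //; lra.
- by rewrite lef_pV2 ?posrE ?exprn_gt0// ler_pXn2r ?nnegrE//; lra.
Qed.

Let G B th := Num.sqrt (cutg th) + B * cutq th.

Lemma is_derive_G B th : pi <= th <= 3 / 2 * pi ->
  is_derive th 1 (G B) (2 * cutE th / cutV th ^+ 2 *
    (2 * th ^+ 2 * sin th / Num.sqrt (cutg th) + B * cutM th)).
Proof.
move=> h; have g0 := cutg_gt0 h; have := is_derive_cutg h => dg.
have := is_derive_cutq h => dq; have := is_derive1_sqrt g0 => ds.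
have V0 := cutV_gt0 h; have sg0 : 0 < Num.sqrt (cutg th) by rewrite sqrtr_gt0.
rewrite /G; apply: is_derive_eq; rewrite /GRing.scale /=; field.
by rewrite !gt_eqF.
Qed.

Lemma cut_bracketE th : cut_range th ->
  2 * th ^+ 2 * sin th / Num.sqrt (cutg th) = - cutB th * cutM th.
Proof.
move=> r; have h := cut_rangeW r; have /and3P[_ _ M0] := r.
have sg0 : 0 < Num.sqrt (cutg th) by rewrite sqrtr_gt0 cutg_gt0.
by rewrite /cutB; field; rewrite !gt_eqF.
Qed.

Lemma cutG_min phi th0 th : phi <= 3 / 2 * pi ->
  (forall t, cut_range t = (pi <= t < phi)) ->
  cut_range th0 -> pi <= th <= phi -> G (cutB th0) th0 <= G (cutB th0) th.
Proof.
move=> phi2 rng r0 /andP[hth thphi].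
have h0 := cut_rangeW r0; have /and3P[_ _ M0] := r0.
have Vg t : pi <= t <= 3 / 2 * pi -> 0 <= (cutV t ^+ 2)^-1.
  by move=> ?; rewrite invr_ge0 sqr_ge0.
have Eg t : cut_range t -> 2 * cutE t / cutV t ^+ 2 <= 0.
  move=> rt; have /and3P[_ _ Mt] := rt; have ht := cut_rangeW rt.
  by rewrite mulr_le0_ge0 ?Vg// mulr_ge0_le0// cutE_le0// ltW.
have h0phi : th0 < phi by have := r0; rewrite rng => /andP[].
have [le|/ltW le] := leP th th0.
  apply: (nonincreasing_derive (f' := fun t => 2 * cutE t / cutV t ^+ 2 *
    (2 * t ^+ 2 * sin t / Num.sqrt (cutg t) + cutB th0 * cutM t))) => //.
    by move=> t tt; apply: is_derive_G; lra.
  move=> t /andP[ta tb].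
  have rt : cut_range t by rewrite rng; lra.
  have /and3P[_ _ Mt] := rt.
  rewrite mulr_le0_ge0 ?Eg// cut_bracketE// -mulrDl mulr_ge0//; last by lra.
  by rewrite addrC subr_ge0 cutB_nondecreasing//; lra.
apply: (nondecreasing_derive (f' := fun t => 2 * cutE t / cutV t ^+ 2 *
  (2 * t ^+ 2 * sin t / Num.sqrt (cutg t) + cutB th0 * cutM t))) => //.
  by move=> t tt; apply: is_derive_G; lra.
move=> t /andP[ta tb].
have rt : cut_range t by rewrite rng; lra.
have /and3P[_ _ Mt] := rt.
rewrite mulr_le0 ?Eg// cut_bracketE// -mulrDl mulr_le0_ge0//; last by lra.
by rewrite addrC subr_le0 cutB_nondecreasing//; lra.
Qed.

Lemma cut_range_pi : cut_range (pi : R).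
Proof. by have := pi_gt0 R => ?; rewrite /cut_range cutM_pi; lra. Qed.

Lemma cut_profile_pi : cutg pi = (2 * pi) ^+ 2 /\ cutq pi = 2.
Proof.
have := pi_gt0 R => p0.
have p1 : pi != 0 :> R by rewrite gt_eqF.
split; rewrite /cutg /cutq /cutp /cutV ?cutM_pi sinpi cospi; field.
all: by apply: (contraNneq _ p1) => E; have := pi_gt0 R; nra.
Qed.

(* [cutB] is increasing along the range, so that [sqrt cutg] is a convex function
   of [cutq]; [v] and [m] are eliminated by the arithmetic-geometric inequality
   and by choosing [th] with [cutq th = m^2 / v]. *)
Lemma reduced_min th0 (tau v m h X : R) : cut_range th0 -> 0 < v -> 0 <= tau ->
  h ^+ 2 = 2 * tau * cutB th0 ->
  (forall th, cut_range th -> h ^+ 2 + (tau ^+ 2 + h ^+ 2 * m ^+ 2) / v +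
     4 * th ^+ 2 * (v + sin th / cutM th * m ^+ 2) <= X) ->
  h ^+ 2 * (1 + cutq th0) + 2 * tau * Num.sqrt (cutg th0) <= X.
Proof.
move=> r0 v0 tau0 hB HX; set q := m ^+ 2 / v.
have pi0 := pi_gt0 R.
have q0 : 0 <= q by rewrite divr_ge0 ?sqr_ge0// ltW.
have B0 := cutB_ge0 r0.
have [phi [/andP[phi1 phi2] Mphi sphi rng]] := @cut_phi_exists R.
have amgm (r : R) : 0 <= r -> 2 * tau * r <= tau ^+ 2 / v + r ^+ 2 * v.
  move=> r1; rewrite -subr_ge0.
  have -> : tau ^+ 2 / v + r ^+ 2 * v - 2 * tau * r = (tau - r * v) ^+ 2 / v.
    by field; rewrite gt_eqF.
  by rewrite divr_ge0 ?sqr_ge0// ltW.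
have split_m r : (tau ^+ 2 + h ^+ 2 * m ^+ 2) / v + r =
   tau ^+ 2 / v + r + h ^+ 2 * q by rewrite /q; field; rewrite gt_eqF.
suff [th hth [r [r1 rX Gr]]] : exists2 th, pi <= th <= phi & exists r,
    [/\ 0 <= r, h ^+ 2 + 2 * tau * r + h ^+ 2 * q <= X
      & G (cutB th0) th <= r + cutB th0 * q].
  have := cutG_min (ltW phi2) rng r0 hth; rewrite /G => Gmin.
  apply: le_trans rX; rewrite mulrDr mulr1 -!addrA lerD2l.
  have -> : h ^+ 2 * cutq th0 + 2 * tau * Num.sqrt (cutg th0) =
     2 * tau * (Num.sqrt (cutg th0) + cutB th0 * cutq th0) by rewrite hB; ring.
  have -> : 2 * tau * r + h ^+ 2 * q = 2 * tau * (r + cutB th0 * q).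
    by rewrite hB; ring.
  apply: ler_wpM2l; first by lra.
  exact: (le_trans Gmin).
(* [cutq] runs from 2 at [pi] to 0 at [phi]. For [q] at least 2 the angle [pi] suffices: its
   [m ^+ 2] term vanishes with [sin pi], and the excess of [q] over 2 only helps. *)
have [q2|q2] := leP 2 q.
  exists pi; first by lra.
  have [gpi qpi] := cut_profile_pi.
  exists (2 * pi); split; first by lra.
    have := HX pi cut_range_pi; rewrite sinpi mul0r mul0r addr0.
    rewrite -addrA split_m; have := amgm (2 * pi) ltac:(lra); lra.
  rewrite /G gpi qpi sqrtr_sqr ger0_norm; last by lra.
  by rewrite lerD2l ler_wpM2l.
have qphi : cutq phi = 0 by rewrite /cutq Mphi expr0n mulr0 mul0r.
have hphi : pi <= phi <= 3 / 2 * pi by lra.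
have Vphi := cutV_gt0 hphi.
have [q1|q1] := leP q 0.
  have {q0 q1} q0 : q = 0 by apply/eqP; rewrite eq_le q1.
  have m0 : m ^+ 2 = 0 by move: q0; rewrite /q => /eqP; rewrite mulf_eq0 invr_eq0 (gt_eqF v0) orbF => /eqP.
  (* For [q = 0] the right angle is [phi], which [cut_range] excludes; its bound is the limit of
     those below it. If it failed, it would already fail at an angle halfway between the threshold
     [th] and [phi]. *)
  exists phi; first by lra.
  exists (2 * phi); split; first by lra.
    rewrite q0 mulr0 addr0 leNgt; apply/negP => XX.
    have tau1 : 0 < tau.
      rewrite lt_neqAle tau0 andbT; apply/negP => /eqP tE.
      have := HX pi cut_range_pi; rewrite m0 -tE in XX *.
      rewrite mulr0 expr0n /= mulr0 addr0 mul0r addr0 => ?.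
      have : 0 <= 4 * pi ^+ 2 * v by rewrite !mulr_ge0 ?sqr_ge0// ltW.
      lra.
    have key th : cut_range th -> h ^+ 2 + 4 * tau * th <= X.
      move=> rth; have /and3P[t1 _ _] := rth.
      have := HX th rth; rewrite m0 !mulr0 !addr0.
      have := amgm (2 * th) ltac:(lra); lra.
    pose th := Num.max pi ((X - h ^+ 2) / (4 * tau)).
    have hX : (X - h ^+ 2) / (4 * tau) < phi.
      by rewrite ltr_pdivrMr; lra.
    have thphi : th < phi by rewrite gt_max phi1.
    have th1 : pi <= th by rewrite le_max lexx.
    have th2 : (X - h ^+ 2) / (4 * tau) <= th by rewrite le_max lexx orbT.
    have := key ((th + phi) / 2); rewrite rng => /(_ ltac:(lra)) K.
    have : X - h ^+ 2 <= th * (4 * tau) by rewrite -ler_pdivrMr//; lra.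
    have : 0 < tau * (phi - th) by rewrite mulr_gt0//; lra.
    lra.
  rewrite /G qphi q0 !mulr0 !addr0 /cutg.
  have -> : 4 * phi ^+ 3 * cutp phi / cutV phi = (2 * phi) ^+ 2.
    have VE := cutVE phi; rewrite Mphi mulr0 mul0r subr0 in VE.
    have p0 := cutp_gt0 hphi.
    by rewrite VE; field; rewrite !gt_eqF//; lra.
  by rewrite sqrtr_sqr ger0_norm//; lra.
have [||||th /andP[th1 th2] Hth] := @zero_of_sign_change _ (fun t => cutq t - q)
  (fun t => 2 * cutM t * cutE t / cutV t ^+ 2) pi phi.
- by lra.
- move=> t tt; have := @is_derive_cutq t ltac:(lra) => ?.
  by apply: is_derive_eq; rewrite subr0.
- by rewrite cut_profile_pi.2; lra.
- by rewrite qphi; lra.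
have qE : cutq th = q by lra.
have thphi : th < phi.
  rewrite lt_neqAle th2 andbT; apply/negP => /eqP E.
  by move: qE; rewrite E qphi; lra.
have rth : cut_range th by rewrite rng th1.
have hth := cut_rangeW rth; have /and3P[_ _ Mth] := rth.
exists th; first by lra.
exists (Num.sqrt (cutg th)); split; rewrite ?sqrtr_ge0//; last first.
  by rewrite /G qE.
have := HX th rth; rewrite -addrA split_m => HXth.
apply: le_trans HXth; rewrite -!addrA lerD2l addrA lerD2r.
have := amgm _ (sqrtr_ge0 (cutg th)); rewrite sqr_sqrtr ?(ltW (cutg_gt0 hth))//.
suff -> : 4 * th ^+ 2 * (v + sin th / cutM th * m ^+ 2) = cutg th * v by [].
have -> : m ^+ 2 = cutq th * v by rewrite qE /q divfK// gt_eqF.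
have p0 := cutp_gt0 hth; have V0 := cutV_gt0 hth.
rewrite /cutg /cutq.
have -> : cutp th = (cutV th + 2 * cutM th * sin th) / th.
  by rewrite cutVE; field; rewrite gt_eqF//; lra.
by field; rewrite !gt_eqF//; lra.
Qed.
End ReducedProblem.

(** * First-order expansions and the lower bound *)

Section FirstOrder.
Context {R : realType}.
Implicit Types (al be : R) (f g : R -> R) (D E : R -> R -> R).

(* [D a b] is the increment of [f] from [a] to [b] up to an error which is
   quadratic in [b - a]; the other two bounds make the notion stable under
   products. *)
Definition expansion al be f D := exists C : R, forall a b,
  al <= a -> a <= b -> b <= be ->
  [/\ `|f b - f a - D a b| <= C * (b - a) ^+ 2,
      `|D a b| <= C * (b - a) & `|f a| <= C].

Lemma expansion_eq al be f D E : expansion al be f D ->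
  (forall a b, D a b = E a b) -> expansion al be f E.
Proof. by move=> [C H] DE; exists C => a b *; rewrite -DE; exact: H. Qed.

Lemma expansionS al be al' be' f D : al <= al' -> be' <= be ->
  expansion al be f D -> expansion al' be' f D.
Proof. by move=> h1 h2 [C H]; exists C => a b *; apply: H => //; lra. Qed.

Lemma expansion_cst al be (c : R) : expansion al be (fun=> c) (fun _ _ => 0).
Proof.
exists `|c| => a b ha ab hb; rewrite subrr subr0 normr0; split => //.
  by rewrite mulr_ge0 ?sqr_ge0.
by rewrite mulr_ge0// subr_ge0.
Qed.

Lemma expansionD al be f g D E : expansion al be f D -> expansion al be g E ->
  expansion al be (fun r => f r + g r) (fun a b => D a b + E a b).
Proof.
move=> [C H] [C' H']; exists (C + C') => a b ha ab hb.
have [h1 h2 h3] := H a b ha ab hb; have [k1 k2 k3] := H' a b ha ab hb.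
split; rewrite ?mulrDl; last first.
- exact: le_trans (ler_normD _ _) (lerD h3 k3).
- exact: le_trans (ler_normD _ _) (lerD h2 k2).
apply: le_trans (lerD h1 k1); apply: le_trans (ler_normD _ _).
by have -> : f b + g b - (f a + g a) - (D a b + E a b) =
  f b - f a - D a b + (g b - g a - E a b) by ring.
Qed.

(** An interval of length at most 1 lets quadratic errors be absorbed into linear ones, which bounds
    the cross term of the two increments. *)
Lemma expansionM al be f g D E : be - al <= 1 ->
  expansion al be f D -> expansion al be g E ->
  expansion al be (fun r => f r * g r)
    (fun a b => f a * E a b + g a * D a b).
Proof.
move=> h [C H] [C' H'].
pose K := Num.max C C'.
exists (2 * K ^+ 2 + (2 * K) ^+ 2) => a b ha ab hb.
have [h1 h2 h3] := H a b ha ab hb; have [k1 k2 k3] := H' a b ha ab hb.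
have CK : C <= K by rewrite le_max lexx.
have C'K : C' <= K by rewrite le_max lexx orbT.
have C0 : 0 <= C by apply: le_trans h3.
have K0 : 0 <= K by lra.
have d0 : 0 <= b - a by lra.
have d1 : b - a <= 1 by lra.
have d2 : (b - a) ^+ 2 <= b - a by rewrite expr2 ler_piMr.
have {}h1 : `|f b - f a - D a b| <= K * (b - a) ^+ 2.
  by apply: le_trans h1 _; rewrite ler_wpM2r ?sqr_ge0.
have {}k1 : `|g b - g a - E a b| <= K * (b - a) ^+ 2.
  by apply: le_trans k1 _; rewrite ler_wpM2r ?sqr_ge0.
have {}h2 : `|D a b| <= K * (b - a) by apply: le_trans h2 _; rewrite ler_wpM2r.
have {}k2 : `|E a b| <= K * (b - a) by apply: le_trans k2 _; rewrite ler_wpM2r.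
have {}h3 : `|f a| <= K by lra.
have {}k3 : `|g a| <= K by lra.
have lipf : `|f b - f a| <= 2 * K * (b - a).
  have -> : f b - f a = (f b - f a - D a b) + D a b by ring.
  apply: le_trans (ler_normD _ _) _.
  have : K * (b - a) ^+ 2 <= K * (b - a) by rewrite ler_wpM2l.
  lra.
have lipg : `|g b - g a| <= 2 * K * (b - a).
  have -> : g b - g a = (g b - g a - E a b) + E a b by ring.
  apply: le_trans (ler_normD _ _) _.
  have : K * (b - a) ^+ 2 <= K * (b - a) by rewrite ler_wpM2l.
  lra.
split.
- have -> : f b * g b - f a * g a - (f a * E a b + g a * D a b) =
    f a * (g b - g a - E a b) + g a * (f b - f a - D a b)
    + (f b - f a) * (g b - g a) by ring.
  have e1 : `|f a * (g b - g a - E a b)| <= K * (K * (b - a) ^+ 2).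
    by rewrite normrM ler_pM.
  have e2 : `|g a * (f b - f a - D a b)| <= K * (K * (b - a) ^+ 2).
    by rewrite normrM ler_pM.
  have e3 : `|(f b - f a) * (g b - g a)| <= 2 * K * (b - a) * (2 * K * (b - a)).
    by rewrite normrM ler_pM.
  apply: le_trans (ler_normD _ _) _; apply: le_trans (lerD (ler_normD _ _) (lexx _)) _.
  have -> : (2 * K ^+ 2 + (2 * K) ^+ 2) * (b - a) ^+ 2 =
    K * (K * (b - a) ^+ 2) + K * (K * (b - a) ^+ 2)
    + 2 * K * (b - a) * (2 * K * (b - a)) by ring.
  by rewrite lerD// lerD.
- have e1 : `|f a * E a b| <= K * (K * (b - a)) by rewrite normrM ler_pM.
  have e2 : `|g a * D a b| <= K * (K * (b - a)) by rewrite normrM ler_pM.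
  apply: le_trans (ler_normD _ _) _.
  have : 0 <= (2 * K) ^+ 2 * (b - a) by rewrite mulr_ge0 ?sqr_ge0.
  lra.
- rewrite normrM; apply: (@le_trans _ _ (K ^+ 2)).
    by rewrite expr2 ler_pM.
  have := sqr_ge0 K; have := sqr_ge0 (2 * K); lra.
Qed.

Lemma expansionZ al be f D (k : R) : expansion al be f D ->
  expansion al be (fun r => k * f r) (fun a b => k * D a b).
Proof.
move=> [C H]; exists (`|k| * C) => a b ha ab hb.
have [h1 h2 h3] := H a b ha ab hb.
rewrite -!mulrBr !normrM -!mulrA; split; exact: ler_wpM2l.
Qed.

Lemma expansionB al be f g D E : expansion al be f D -> expansion al be g E ->
  expansion al be (fun r => f r - g r) (fun a b => D a b - E a b).
Proof.
move=> hf /(expansionZ (-1)) hg.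
have [C H] := expansionD hf hg.
by exists C => a b; have := H a b; rewrite !mulN1r.
Qed.

Lemma expansion_derive al be f (f' f'' : R -> R) (K : R) : be - al <= 1 ->
  (forall r, al <= r <= be -> is_derive r 1 f (f' r)) ->
  (forall r, al <= r <= be -> is_derive r 1 f' (f'' r)) ->
  (forall r, al <= r <= be -> `|f'' r| <= K) ->
  expansion al be f (fun a b => f' a * (b - a)).
Proof.
move=> h df df' bf''.
have mvt (F F' : R -> R) a b : (forall r, al <= r <= be -> is_derive r 1 F (F' r)) ->
    al <= a -> a <= b -> b <= be ->
    exists2 c, a <= c <= b & F b - F a = F' c * (b - a).
  move=> dF ha ab hb; have [||c] := @MVT_segment _ F F' a b ab.
  - by move=> x; rewrite in_itv /= => /andP[? ?]; apply: dF; lra.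
  - by apply: is_derive_within_continuous => x /andP[? ?]; apply: dF; lra.
  by rewrite in_itv; exists c.
pose K1 := `|f' al| + K; pose K0 := `|f al| + K1.
exists (K + K1 + K0) => a b ha ab hb.
have K_ge0 : 0 <= K by apply: le_trans (bf'' a _) => //; lra.
have small r (F F' : R -> R) (k : R) : 0 <= k ->
    (forall r, al <= r <= be -> is_derive r 1 F (F' r)) ->
    (forall r, al <= r <= be -> `|F' r| <= k) -> al <= r <= be ->
    `|F r| <= `|F al| + k.
  move=> k0 dF bF /andP[r1 r2]; have [c /andP[c1 c2] E] := mvt _ _ al r dF (lexx _) r1 r2.
  have -> : F r = F al + F' c * (r - al) by lra.
  apply: le_trans (ler_normD _ _) _; rewrite lerD2l normrM.
  have bc : `|F' c| <= k by apply: bF; lra.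
  rewrite -[leRHS]mulr1 ler_pM// ger0_norm; lra.
have f'K r : al <= r <= be -> `|f' r| <= K1 by move=> ?; exact: small.
have K1_ge0 : 0 <= K1 by rewrite addr_ge0.
have fK r : al <= r <= be -> `|f r| <= K0 by move=> ?; exact: small.
have K0_ge0 : 0 <= K0 by rewrite addr_ge0.
have d0 : 0 <= b - a by lra.
split.
- have [c /andP[c1 c2] ->] := mvt _ _ a b df ha ab hb.
  have [e /andP[e1 e2] E] := mvt _ _ a c df' ha c1 ltac:(lra).
  rewrite -mulrBl E -mulrA normrM.
  apply: (@le_trans _ _ (K * (b - a) ^+ 2)); last by rewrite ler_wpM2r ?sqr_ge0//; lra.
  apply: ler_pM => //; first by apply: bf''; lra.
  rewrite normrM expr2 ger0_norm ?subr_ge0// ger0_norm// ler_wpM2r//; lra.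
- rewrite normrM (ger0_norm d0) ler_wpM2r//.
  by have := f'K a ltac:(lra); lra.
- by have := fK a ltac:(lra); lra.
Qed.

Lemma expansion_id al be : be - al <= 1 -> expansion al be id (fun a b => b - a).
Proof.
move=> h; apply: (@expansion_eq _ _ _ (fun a b => 1 * (b - a))).
  apply: (@expansion_derive _ _ _ (fun=> 1) (fun=> 0) 0) => // *.
  by rewrite normr0.
by move=> *; rewrite mul1r.
Qed.

(** Over n + 1 equal pieces the quadratic errors add up to O(1 / n). This takes the place of
    integrating an almost everywhere inequality between derivatives. *)
Lemma expansion_nondecreasing al be f D : al <= be -> expansion al be f D ->
  (forall a b, al <= a -> a <= b -> b <= be -> 0 <= D a b) -> f al <= f be.
Proof.
move=> ab [C H] D0.
have C0 : 0 <= C by have [_ _] := H al al (lexx _) (lexx _) ab; exact: le_trans.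
have step n (k : nat) : (k <= n.+1)%N ->
    f al - f (al + k%:R * ((be - al) / n.+1%:R)) <=
    k%:R * (C * ((be - al) / n.+1%:R) ^+ 2).
  set d := (be - al) / n.+1%:R.
  have d0 : 0 <= d by rewrite divr_ge0 ?subr_ge0.
  elim: k => [_|k IH kn]; first by rewrite !mul0r addr0 subrr.
  have kd : k%:R * d + d <= be - al.
    have -> : k%:R * d + d = k.+1%:R * d by rewrite -natr1; ring.
    have -> : be - al = n.+1%:R * d by rewrite /d mulrC divfK// pnatr_eq0.
    by rewrite ler_wpM2r// ler_nat.
  have k0 : 0 <= k%:R * d by rewrite mulr_ge0.
  have E : al + k.+1%:R * d = al + k%:R * d + d by rewrite -natr1; ring.
  have [h1 _ _] := H (al + k%:R * d) (al + k.+1%:R * d) ltac:(lra) ltac:(lra) ltac:(lra).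
  have h2 := D0 (al + k%:R * d) (al + k.+1%:R * d) ltac:(lra) ltac:(lra) ltac:(lra).
  move: h1; rewrite ler_norml => /andP[h1 _].
  have E2 : al + k.+1%:R * d - (al + k%:R * d) = d by rewrite E; ring.
  rewrite E2 in h1.
  have {}IH := IH (ltnW kn).
  rewrite -[k.+1%:R in leRHS]natr1 mulrDl mul1r; lra.
rewrite leNgt; apply/negP => lt.
pose M := C * (be - al) ^+ 2.
have key n : f al - f be <= M / n.+1%:R.
  have := step n n.+1 (leqnn _).
  have n0 : n.+1%:R != 0 :> R by rewrite pnatr_eq0.
  have -> : al + n.+1%:R * ((be - al) / n.+1%:R) = be by field.
  by have -> : n.+1%:R * (C * ((be - al) / n.+1%:R) ^+ 2) = M / n.+1%:R by rewrite /M; field.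
have [n nP] : exists n : nat, M / (f al - f be) < n.+1%:R.
  exists (Num.trunc (M / (f al - f be))); exact: truncnS_gt.
have : M < n.+1%:R * (f al - f be) by rewrite -ltr_pdivrMr; lra.
have := key n; rewrite ler_pdivlMr ?ltr0n//; lra.
Qed.

Lemma lipschitz_continuous f (k : R) :
  (forall x y, x <= y -> `|f y - f x| <= k * (y - x)) -> continuous f.
Proof.
move=> H x; apply/cvgrPdist_lt => e e0.
have H' y : `|f x - f y| <= k * `|x - y|.
  have [xy|/ltW xy] := leP x y.
    by rewrite distrC (distrC x) (ger0_norm (_ : 0 <= y - x)) ?subr_ge0//; exact: H.
  by rewrite (ger0_norm (_ : 0 <= x - y)) ?subr_ge0//; exact: H.
have k0 : 0 <= k by have := H 0 1 ler01; rewrite subr0 mulr1; exact: le_trans.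
exists (e / (k + 1)) => /=; first by rewrite divr_gt0//; lra.
move=> y /= xy; apply: le_lt_trans (H' y) _.
move: xy; rewrite ltr_pdivlMr; last by lra.
by have := normr_ge0 (x - y); lra.
Qed.

Lemma continuous_primitive (g : R -> R) : continuous g ->
  exists2 S : R -> R, S 0 = 0 & forall a b, 0 <= a -> a <= b ->
    exists2 c, a <= c <= b & S b - S a = g c * (b - a).
Proof.
move=> cg; pose S x := (\int[lebesgue_measure]_(t in `[0%R, x]) g t)%R.
have cw a b : {within `[a, b], continuous g} by apply: continuous_subspaceT.
have intg a b : lebesgue_measure.-integrable `[a, b] (EFin \o g).
  by apply: continuous_compact_integrable => //; exact: segment_compact.
exists S; first by rewrite /S set_itv1 Rintegral_set1.
move=> a b a0 ab.
have cS : {within `[0, b], continuous S}.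
  exact: parameterized_integral_continuous (le_trans a0 ab) (intg 0 b).
have [||c] := @MVT_segment _ S g a b ab.
- move=> x; rewrite in_itv /= => /andP[ax xb].
  have [dS S'] := @continuous_FTC1_closed _ g 0 x b xb (intg 0 b)
    (le_lt_trans a0 ax) (cg x).
  by rewrite -S' derive1E; exact: derivableP.
- apply: continuous_subspaceW cS => x /=; rewrite !in_itv /= => /andP[? ->].
  by rewrite andbT; lra.
by rewrite in_itv => ? ?; exists c.
Qed.

Lemma expansion_primitive f D : expansion 0 1 f D ->
  exists2 S : R -> R, S 0 = 0 & expansion 0 1 S (fun a b => f a * (b - a)).
Proof.
move=> [C H].
have C0 : 0 <= C by have [_ _] := H 0 0 (lexx _) (lexx _) ler01; exact: le_trans.
have lipf a b : 0 <= a -> a <= b -> b <= 1 -> `|f b - f a| <= 2 * C * (b - a).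
  move=> a0 ab b1; have [h1 h2 _] := H a b a0 ab b1.
  have -> : f b - f a = (f b - f a - D a b) + D a b by ring.
  apply: le_trans (ler_normD _ _) _.
  have : C * (b - a) ^+ 2 <= C * (b - a).
    by rewrite ler_wpM2l// expr2 ler_piMr//; lra.
  lra.
(* [f] is controlled on [0, 1] only; composing with the clamp extends it to a Lipschitz function on
   the whole line. *)
pose cl r : R := Num.max 0 (Num.min 1 r).
have cl0 r : 0 <= cl r by rewrite le_max lexx.
have cl1 r : cl r <= 1 by rewrite ge_max ler01 ge_min lexx.
have clE r : 0 <= r -> r <= 1 -> cl r = r by move=> *; rewrite /cl min_r// max_r.
have clL x y : x <= y -> 0 <= cl y - cl x <= y - x.
  by move=> xy; rewrite /cl /Num.max /Num.min; do ![case: ifP]; lra.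
pose g r := f (cl r).
have gL x y : x <= y -> `|g y - g x| <= 2 * C * (y - x).
  move=> /clL/andP[c1 c2]; apply: le_trans (lipf _ _ _ _ _) _ => //; first lra.
  by rewrite ler_wpM2l//; lra.
have [S S0 SE] := continuous_primitive (lipschitz_continuous gL).
exists S => //; exists (2 * C) => a b a0 ab b1.
have [c /andP[c1 c2] ->] := SE a b a0 ab.
have fa : `|f a| <= C by have [] := H a b a0 ab b1.
have gE r : 0 <= r -> r <= 1 -> g r = f r by move=> *; rewrite /g clE.
split.
- rewrite -mulrBl normrM (ger0_norm (_ : 0 <= b - a)); last by lra.
  rewrite expr2 mulrA ler_wpM2r//; first by lra.
  rewrite -(gE a)//; last by lra.
  by apply: le_trans (gL _ _ _) _ => //; rewrite ler_wpM2l//; lra.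
- rewrite normrM (ger0_norm (_ : 0 <= b - a)); last by lra.
  by rewrite ler_wpM2r//; lra.
- have [e /andP[e1 e2]] := SE 0 a (lexx _) a0; rewrite S0 !subr0 => ->.
  rewrite gE; [|lra|lra].
  have [_ _ fe] := H e b e1 ltac:(lra) b1.
  rewrite normrM (ger0_norm a0) -[leRHS]mulr1.
  by apply: ler_pM => //; lra.
Qed.
End FirstOrder.

(** * Lower bound for the length in a suitable frame *)

Section LowerBound.
Context {R : realType}.

(* [X] is the projection to R^3 of a curve in the group parametrized on [0, 1]
   with speed at most [L]; [T3] and [T1] are the coordinates of its second
   layer along [e1 /\ e2] and [e2 /\ e3]. *)
Record arc3 (L : R) (X1 X2 X3 T1 T3 : R -> R) : Prop := Arc3 {
  arc_speed : forall a b, 0 <= a -> a <= b -> b <= 1 ->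
    (X1 b - X1 a) ^+ 2 + (X2 b - X2 a) ^+ 2 + (X3 b - X3 a) ^+ 2
    <= L ^+ 2 * (b - a) ^+ 2;
  arc_area3 : exists C, forall a b, 0 <= a -> a <= b -> b <= 1 ->
    `|T3 b - T3 a - 2^-1 * (X1 a * (X2 b - X2 a) - X2 a * (X1 b - X1 a))|
    <= C * (b - a) ^+ 2;
  arc_area1 : exists C, forall a b, 0 <= a -> a <= b -> b <= 1 ->
    `|T1 b - T1 a - 2^-1 * (X2 a * (X3 b - X3 a) - X3 a * (X2 b - X2 a))|
    <= C * (b - a) ^+ 2;
  arc_X1 : X1 0 = 0; arc_X2 : X2 0 = 0; arc_X3 : X3 0 = 0;
  arc_T3 : T3 0 = 0; arc_T1 : T1 0 = 0 }.

Lemma expansion_lipschitz (f : R -> R) (L : R) : f 0 = 0 -> 0 <= L ->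
  (forall a b, 0 <= a -> a <= b -> b <= 1 -> `|f b - f a| <= L * (b - a)) ->
  expansion 0 1 f (fun a b => f b - f a).
Proof.
move=> f0 L0 H; exists L => a b a0 ab b1; rewrite subrr normr0; split.
- by rewrite mulr_ge0// sqr_ge0.
- exact: H.
- have := H 0 a (lexx _) a0 ltac:(lra); rewrite f0 !subr0 => /le_trans; apply.
  by rewrite -[leRHS]mulr1 ler_wpM2l//; lra.
Qed.

(** Expand |x - d B|^2 >= 0 and divide by [d]; for [d = 0] the hypothesis forces x = 0. The speed
    constraint becomes linear in the increments, for any field B. *)
Lemma speed_bound (L d x1 x2 x3 b1 b2 b3 : R) : 0 <= d ->
  x1 ^+ 2 + x2 ^+ 2 + x3 ^+ 2 <= L ^+ 2 * d ^+ 2 ->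
  0 <= L ^+ 2 * d + (b1 ^+ 2 + b2 ^+ 2 + b3 ^+ 2) * d
       - 2 * (b1 * x1 + b2 * x2 + b3 * x3).
Proof.
rewrite le_eqVlt => /predU1P[<-|d0] H.
  have := sqr_ge0 x1; have := sqr_ge0 x2; have := sqr_ge0 x3.
  move: H; rewrite expr0n /= mulr0 => H h3 h2 h1.
  have z (x : R) : x ^+ 2 = 0 -> x = 0 by move/eqP; rewrite sqrf_eq0 => /eqP.
  by rewrite (z x1) 1?(z x2) 1?(z x3); lra.
rewrite -(pmulr_rge0 _ d0).
have := sqr_ge0 (x1 - b1 * d); have := sqr_ge0 (x2 - b2 * d).
have := sqr_ge0 (x3 - b3 * d).
have -> : d * (L ^+ 2 * d + (b1 ^+ 2 + b2 ^+ 2 + b3 ^+ 2) * d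
   - 2 * (b1 * x1 + b2 * x2 + b3 * x3)) =
   (L ^+ 2 * d ^+ 2 - (x1 ^+ 2 + x2 ^+ 2 + x3 ^+ 2)) +
   (x1 - b1 * d) ^+ 2 + (x2 - b2 * d) ^+ 2 + (x3 - b3 * d) ^+ 2 by ring.
lra.
Qed.

(** The bound [3 / 2 * pi] on the range enters here: it puts [th / 3] below a right angle. *)
Lemma cos_third_gt (th r : R) : cut_range th -> `|r| <= th / 3 ->
  cos (th / 3) <= cos r /\ 0 < cos (th / 3).
Proof.
move=> /and3P[h1 h2 _] hr; have pi0 := pi_gt0 R.
have c0 : 0 < cos (th / 3) by apply: cos_gt0_pihalf; lra.
split => //; rewrite -(cos_norm r) leNgt; apply/negP.
rewrite ltr_cos ?in_itv /= ?normr_ge0 /=; lra.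
Qed.

(** Within 1/6 of [mid] the angle stays within [th / 3], so the tangent and its derivatives are
    bounded in terms of [cos (th / 3)]. *)
Lemma expansion_tan (th mid al be : R) : cut_range th -> be - al <= 1 ->
  mid - 1 / 6 <= al -> be <= mid + 1 / 6 ->
  expansion al be (fun r => - (2 * th) * tan (2 * th * (r - mid)))
    (fun a b => - (2 * th) ^+ 2 * (1 + tan (2 * th * (a - mid)) ^+ 2) * (b - a)).
Proof.
move=> rth h hal hbe; have [h2 _ _ _ _] := cut_bounds (cut_rangeW rth).
have cosr r : al <= r <= be ->
    cos (th / 3) <= cos (2 * th * (r - mid)) /\ 0 < cos (th / 3).
  move=> hr; apply: cos_third_gt => //.
  have -> : th / 3 = 2 * th * (1 / 6) by field.
  rewrite normrM (ger0_norm (_ : 0 <= 2 * th)); last by lra.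
  by rewrite ler_wpM2l ?ler_norml; lra.
set k := cos (th / 3) in cosr *.
pose T r : R := tan (2 * th * (r - mid)).
have dT r : al <= r <= be -> is_derive r 1 T (2 * th * (1 + T r ^+ 2)).
  move=> /cosr[c1 c2]; have c0 : cos (2 * th * (r - mid)) != 0 by rewrite gt_eqF//; lra.
  by rewrite /T -cos2_tan2//; apply: is_derive_eq; rewrite /GRing.scale /=; ring.
have bT r : al <= r <= be -> `|T r| <= k^-1.
  move=> /cosr[c1 c2]; have c0 : 0 < cos (2 * th * (r - mid)) by lra.
  rewrite /T /tan normrM -[leRHS]mul1r ler_pM//; first exact: sin_max.
  by rewrite ger0_norm ?invr_ge0 ?(ltW c0)// lef_pV2 ?posrE.
have dW r : al <= r <= be ->
    is_derive r 1 (fun r => - (2 * th) * T r) (- (2 * th) ^+ 2 * (1 + T r ^+ 2)).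
  by move=> /dT d; apply: is_derive_eq; rewrite /GRing.scale /=; ring.
have dW' r : al <= r <= be ->
    is_derive r 1 (fun r => - (2 * th) ^+ 2 * (1 + T r ^+ 2))
      (- (2 * th) ^+ 2 * (2 * T r * (2 * th * (1 + T r ^+ 2)))).
  by move=> /dT d; apply: is_derive_eq; rewrite /GRing.scale /=; ring.
apply: (expansion_derive h dW dW'
  (K := `|- (2 * th) ^+ 2| * (2 * k^-1 * (`|2 * th| * (1 + k^-1 ^+ 2))))) => r hr.
have b1 := bT r hr; rewrite normrM ler_wpM2l// normrM ler_pM//.
  by rewrite normrM (ger0_norm (_ : 0 <= 2))// ler_wpM2l.
rewrite normrM ler_wpM2l// (ger0_norm (_ : 0 <= 1 + _)) ?addr_ge0 ?sqr_ge0//.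
by rewrite lerD2l -(real_normK (num_real (T r))) ler_pXn2r ?nnegrE// (le_trans _ b1).
Qed.

(** Reads the increment of an expression off its syntax. Subterms free of the variable are tried as
    constants first, so that they get increment 0 instead of being decomposed. *)
Local Ltac expansion_tac hab :=
  lazymatch goal with
  | |- expansion _ _ (fun r => @?f r - @?g r) _ =>
      first [ exact (expansion_cst _ _ _) | eapply (@expansionB _ _ _ f g) ]
  | |- expansion _ _ (fun r => @?f r + @?g r) _ =>
      first [ exact (expansion_cst _ _ _) | eapply (@expansionD _ _ _ f g) ]
  | |- expansion _ _ (fun r => @?f r * @?g r) _ =>
      first [ exact (expansion_cst _ _ _)
            | eapply (@expansionM _ _ _ f g _ _ hab) ]
  | |- expansion _ _ (fun r => r) _ => exact (expansion_id hab)
  | H : expansion ?a ?b ?f _ |- expansion ?a ?b (fun r => ?f r) _ => exact H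
  | |- expansion ?a ?b ?f _ =>
      first [ exact (expansion_cst _ _ _)
            | match goal with H : expansion a b f _ |- _ => exact H end ]
  end.

(** [m] and [v] are the mean and the variance of [X2], while [kap] and [mu] are multipliers for the
    two areas. The bound is a concave quadratic in each multiplier, and they are left free so that
    [m] and [v] are fixed first. *)
Lemma arc_quadratic_bound (L h tau : R) X1 X2 X3 T1 T3 : 0 <= L ->
  arc3 L X1 X2 X3 T1 T3 ->
  X1 1 = 0 -> X2 1 = 0 -> X3 1 = h -> T3 1 = tau -> T1 1 = 0 ->
  X2 (1 / 3) = X2 (2 / 3) ->
  exists m v : R, forall th kap mu, cut_range th ->
    2 * kap * tau - kap ^+ 2 * v + (h ^+ 2 + 2 * mu * m * h - mu ^+ 2 * v)
    + 4 * th ^+ 2 * (v + sin th / cutM th * m ^+ 2) <= L ^+ 2.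
Proof.
move=> L0 A X11 X21 X31 T31 T11 Xthird.
have sq_le (x : R) d : 0 <= d -> x ^+ 2 <= L ^+ 2 * d ^+ 2 -> `|x| <= L * d.
  move=> d0; rewrite -exprMn -(real_normK (num_real x)).
  by rewrite ler_pXn2r ?nnegrE ?mulr_ge0.
have lip (f : R -> R) : f 0 = 0 -> (forall a b, 0 <= a -> a <= b -> b <= 1 ->
    (f b - f a) ^+ 2 <= L ^+ 2 * (b - a) ^+ 2) -> expansion 0 1 f (fun a b => f b - f a).
  by move=> f0 H; apply: (@expansion_lipschitz _ L) => // a b *; apply: sq_le; rewrite ?subr_ge0//; exact: H.
have eX1 : expansion 0 1 X1 (fun a b => X1 b - X1 a).
  apply: lip => [|a b a0 ab b1]; first exact: arc_X1 A.
  by have := arc_speed A a0 ab b1; have := sqr_ge0 (X2 b - X2 a); have := sqr_ge0 (X3 b - X3 a); lra.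
have eX2 : expansion 0 1 X2 (fun a b => X2 b - X2 a).
  apply: lip => [|a b a0 ab b1]; first exact: arc_X2 A.
  by have := arc_speed A a0 ab b1; have := sqr_ge0 (X1 b - X1 a); have := sqr_ge0 (X3 b - X3 a); lra.
have eX3 : expansion 0 1 X3 (fun a b => X3 b - X3 a).
  apply: lip => [|a b a0 ab b1]; first exact: arc_X3 A.
  by have := arc_speed A a0 ab b1; have := sqr_ge0 (X1 b - X1 a); have := sqr_ge0 (X2 b - X2 a); lra.
have area (F G T : R -> R) : T 0 = 0 ->
    expansion 0 1 F (fun a b => F b - F a) -> expansion 0 1 G (fun a b => G b - G a) ->
    (exists C, forall a b, 0 <= a -> a <= b -> b <= 1 ->
    `|T b - T a - 2^-1 * (F a * (G b - G a) - G a * (F b - F a))| <= C * (b - a) ^+ 2) ->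
    expansion 0 1 T (fun a b => 2^-1 * (F a * (G b - G a) - G a * (F b - F a))).
  move=> T0 [C1 H1] [C2 H2] [C H]; exists (C + C1 * C2).
  have C0 : 0 <= C.
    by have := H 0 1 (lexx _) ler01 (lexx _); rewrite subr0 expr1n mulr1; exact: le_trans.
  have C10 : 0 <= C1 by have [_ _] := H1 0 0 (lexx _) (lexx _) ler01; exact: le_trans.
  have C20 : 0 <= C2 by have [_ _] := H2 0 0 (lexx _) (lexx _) ler01; exact: le_trans.
  have bD a b : 0 <= a -> a <= b -> b <= 1 ->
      `|2^-1 * (F a * (G b - G a) - G a * (F b - F a))| <= C1 * C2 * (b - a).
    move=> a0 ab b1; have [_ f1 f2] := H1 a b a0 ab b1.
    have [_ g1 g2] := H2 a b a0 ab b1.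
    rewrite normrM ger0_norm ?invr_ge0// ler_pdivrMl//.
    apply: le_trans (ler_normB _ _) _.
    have e1 : `|F a * (G b - G a)| <= C1 * (C2 * (b - a)) by rewrite normrM ler_pM.
    have e2 : `|G a * (F b - F a)| <= C2 * (C1 * (b - a)) by rewrite normrM ler_pM.
    lra.
  have CC0 : 0 <= C1 * C2 by rewrite mulr_ge0.
  move=> a b a0 ab b1; have d0 : 0 <= b - a by lra.
  split.
  - apply: le_trans (H a b a0 ab b1) _; rewrite ler_wpM2r ?sqr_ge0//; lra.
  - apply: le_trans (bD a b a0 ab b1) _; rewrite ler_wpM2r//; lra.
  - have a1 : a <= 1 by lra.
    have := H 0 a (lexx _) a0 a1; have := bD 0 a (lexx _) a0 a1.
    set D := 2^-1 * _; rewrite T0 !subr0 => h1 h2.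
    have -> : T a = (T a - D) + D by ring.
    apply: le_trans (ler_normD _ _) _; apply: lerD.
      by apply: le_trans h2 _; rewrite -[leRHS]mulr1 ler_wpM2l// expr2 mulr_ile1.
    by apply: le_trans h1 _; rewrite -[leRHS]mulr1 ler_wpM2l.
have eT3 := area _ _ _ (arc_T3 A) eX1 eX2 (arc_area3 A).
have eT1 := area _ _ _ (arc_T1 A) eX2 eX3 (arc_area1 A).
have [S1 S10 eS1] := expansion_primitive eX2.
have h01 : 1 - 0 <= 1 :> R by rewrite subr0.
have [S2 S20 eS2] := expansion_primitive (expansionM h01 eX2 eX2).
exists (S1 1), (S2 1 - S1 1 ^+ 2) => th kap mu rth.
set m := S1 1; set v := S2 1 - m ^+ 2.
have /and3P[hpi h3pi M0] := rth.
have [h2 s0 c0 _ _] := cut_bounds (cut_rangeW rth).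
pose lam := 2 * th.
(* Makes the denominator of [c'] positive; [c'] is the amplitude for which [Y0] meets [X2] at 1/3,
   hence by symmetry also at 2/3. *)
have third : cos th < cos (th / 3).
  have [_ k0] := @cos_third_gt th 0 rth ltac:(rewrite normr0; lra).
  lra.
pose c' := X2 (1 / 3) / (cos (th / 3) - cos th).
pose Y0 r := c' * (cos (lam * (r - 1 / 2)) - cos th).
pose Y1 r := - (c' * lam * sin (lam * (r - 1 / 2))).
pose Q r := c' * (sin (lam * (r - 1 / 2)) / lam - r * cos th).
pose k := - (lam ^+ 2 * c' * cos th).
(* [J1] and [J3] are primitives of X2 dX1 and X2 dX3. Since [X2] vanishes at both ends, their final
   values are minus and plus the prescribed areas. *)
pose J1 r := 2^-1 * (X1 r * X2 r) - T3 r.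
pose J3 r := 2^-1 * (X2 r * X3 r) + T1 r.
(* [Z] has nonnegative increments by [L^2 dr + |B|^2 dr >= 2 B . dX] with
   [B = (- kap (X2 - m), Y1 + W (X2 - Y0), h - mu (X2 - m))]; here [Y0] is the
   extremal profile taking the value of [X2] at 1/3 and 2/3, and the Riccati
   function [W], with [W' + W^2 = - lam^2], has no pole on a third of [0, 1]. *)
pose Z r := L ^+ 2 * r
  + 2 * kap * (J1 r - m * X1 r) - 2 * h * X3 r + 2 * mu * (J3 r - m * X3 r)
  + (kap ^+ 2 + mu ^+ 2) * (S2 r - 2 * m * S1 r + m ^+ 2 * r)
  + h ^+ 2 * r - 2 * h * mu * (S1 r - m * r)
  - (2 * (Y1 r * X2 r) - Y0 r * Y1 r + lam ^+ 2 * S2 r - 2 * k * S1 r + k * Q r).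
have lam0 : lam != 0 by rewrite gt_eqF// /lam; lra.
have dY0 (r : R) : is_derive r 1 Y0 (Y1 r).
  by rewrite /Y0; apply: is_derive_eq; rewrite /GRing.scale /= /Y1; ring.
have dY1 (r : R) : is_derive r 1 Y1 (- lam ^+ 2 * Y0 r + k).
  by rewrite /Y1; apply: is_derive_eq; rewrite /GRing.scale /= /Y0 /k; ring.
have dQ (r : R) : is_derive r 1 Q (Y0 r).
  by rewrite /Q; apply: is_derive_eq; rewrite /GRing.scale /= /Y0; field.
have bY0 (r : R) : `|Y0 r| <= `|c'| * 2.
  rewrite normrM ler_wpM2l//; apply: le_trans (ler_normB _ _) _.
  by have := cos_max (lam * (r - 1 / 2)); have := cos_max th; lra.
have bY1 (r : R) : `|Y1 r| <= `|c' * lam|.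
  by rewrite normrN normrM -[leRHS]mulr1 ler_wpM2l// sin_max.
have bY2 (r : R) : `|- lam ^+ 2 * Y0 r + k| <= `|- lam ^+ 2| * (`|c'| * 2) + `|k|.
  by apply: le_trans (ler_normD _ _) _; rewrite lerD2r normrM ler_wpM2l.
have eY0 : expansion 0 1 Y0 (fun a b => Y1 a * (b - a)).
  exact: (expansion_derive h01 (fun r _ => dY0 r) (fun r _ => dY1 r) (fun r _ => bY2 r)).
have eY1 : expansion 0 1 Y1 (fun a b => (- lam ^+ 2 * Y0 a + k) * (b - a)).
  have dY2 (r : R) : is_derive r 1 (fun r => - lam ^+ 2 * Y0 r + k) (- lam ^+ 2 * Y1 r).
    by apply: is_derive_eq; rewrite /GRing.scale /=; ring.
  apply: (expansion_derive h01 (fun r _ => dY1 r) (fun r _ => dY2 r)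
    (K := `|- lam ^+ 2| * `|c' * lam|)).
  by move=> r _; rewrite normrM ler_wpM2l.
have eQ : expansion 0 1 Q (fun a b => Y0 a * (b - a)).
  exact: (expansion_derive h01 (fun r _ => dQ r) (fun r _ => dY0 r) (fun r _ => bY1 r)).
have step mid : 1 / 6 <= mid -> mid <= 5 / 6 ->
    X2 (mid - 1 / 6) = Y0 (mid - 1 / 6) -> X2 (mid + 1 / 6) = Y0 (mid + 1 / 6) ->
    Z (mid - 1 / 6) <= Z (mid + 1 / 6).
  move=> m1 m2 E1 E2; set al := mid - 1 / 6; set be := mid + 1 / 6.
  have al0 : 0 <= al by rewrite /al; clear - m1; lra.
  have be1 : be <= 1 by rewrite /be; clear - m2; lra.
  have hab : be - al <= 1 by clear - al0 be1; lra.
  pose W r := - (2 * th) * tan (2 * th * (r - mid)).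
  have eW : expansion al be W _ := expansion_tan rth hab (lexx _) (lexx _).
  (* The correction vanishes at both ends of the third, where [X2 = Y0], and turns the increment of
     [Z] into exactly the expression of [speed_bound]. *)
  pose ZW r := Z r - W r * ((X2 r - Y0 r) * (X2 r - Y0 r)).
  have ZWE r : X2 r = Y0 r -> ZW r = Z r by move=> E; rewrite /ZW E; ring.
  rewrite -(ZWE al E1) -(ZWE be E2).
  have r1 := expansionS al0 be1 eX1; have r2 := expansionS al0 be1 eX2.
  have r3 := expansionS al0 be1 eX3; have r4 := expansionS al0 be1 eT3.
  have r5 := expansionS al0 be1 eT1; have r6 := expansionS al0 be1 eS1.
  have r7 := expansionS al0 be1 eS2; have r8 := expansionS al0 be1 eY0.
  have r9 := expansionS al0 be1 eY1; have r10 := expansionS al0 be1 eQ.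
  eapply expansion_nondecreasing.
  - by rewrite /al /be; clear; lra.
  - rewrite /ZW /Z /J1 /J3.
    repeat expansion_tac hab.
  move=> a b ha ab hb /=; rewrite -/(W a).
  have a0 : 0 <= a by clear - ha al0; lra.
  have b1 : b <= 1 by clear - hb be1; lra.
  have d0 : 0 <= b - a by clear - ab; lra.
  have := speed_bound (- kap * (X2 a - m)) (Y1 a + W a * (X2 a - Y0 a))
    (h - mu * (X2 a - m)) d0 (arc_speed A a0 ab b1).
  congr (0 <= _).
  have -> : 1 + tan (2 * th * (a - mid)) ^+ 2 = 1 + (W a / lam) ^+ 2.
    by rewrite /W -/lam; field.
  by rewrite -/lam; field.
have Y00 : Y0 0 = 0.
  rewrite /Y0 (_ : lam * (0 - 1 / 2) = - th); last by rewrite /lam; field.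
  by rewrite cosN subrr mulr0.
have Y01 : Y0 1 = 0.
  rewrite /Y0 (_ : lam * (1 - 1 / 2) = th); last by rewrite /lam; field.
  by rewrite subrr mulr0.
have Y013 : Y0 (1 / 3) = X2 (1 / 3).
  rewrite /Y0 (_ : lam * (1 / 3 - 1 / 2) = - (th / 3)); last by rewrite /lam; field.
  by rewrite cosN /c' divfK// gt_eqF// subr_gt0.
have Y023 : Y0 (2 / 3) = X2 (2 / 3).
  rewrite -Xthird -Y013 /Y0 (_ : lam * (2 / 3 - 1 / 2) = - (lam * (1 / 3 - 1 / 2))).
    by rewrite cosN.
  by field.
have st1 : Z 0 <= Z (1 / 3).
  have := step (1 / 6); rewrite (_ : 1 / 6 + 1 / 6 = 1 / 3); last by field.
  by rewrite subrr; apply; rewrite ?Y00 ?(arc_X2 A)//; clear; lra.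
have st2 : Z (1 / 3) <= Z (2 / 3).
  have := step (1 / 2); rewrite (_ : 1 / 2 + 1 / 6 = 2 / 3); last by field.
  rewrite (_ : 1 / 2 - 1 / 6 = 1 / 3); last by field.
  by apply; rewrite ?Y013//; clear; lra.
have st3 : Z (2 / 3) <= Z 1.
  have := step (5 / 6); rewrite (_ : 5 / 6 + 1 / 6 = 1); last by field.
  rewrite (_ : 5 / 6 - 1 / 6 = 2 / 3); last by field.
  by apply; rewrite ?Y01 ?X21//; clear; lra.
have : Z 0 <= Z 1 by exact: le_trans st1 (le_trans st2 st3).
have Q01 : Q 1 - Q 0 = c' * (cutM th / th).
  rewrite /Q (_ : lam * (1 - 1 / 2) = th); last by rewrite /lam; field.
  rewrite (_ : lam * (0 - 1 / 2) = - th); last by rewrite /lam; field.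
  by rewrite sinN /cutM /lam; field; rewrite gt_eqF//; lra.
rewrite /Z /J1 /J3 Y00 Y01 X11 X21 X31 T31 T11 (arc_X1 A) (arc_X2 A) (arc_X3 A)
  (arc_T3 A) (arc_T1 A) S10 S20 -/m.
have S2E : S2 1 = v + m ^+ 2 by rewrite /v; ring.
rewrite S2E.
(* The amplitude [c'] survives only in this square, nonnegative because [cos th <= 0]. It vanishes
   when [Y0] has mean [m]; dropping it leaves the coefficient [sin th / cutM th]. *)
have : 0 <= - (4 * th * cos th) / cutM th * (th * m - cutM th * c') ^+ 2.
  rewrite mulr_ge0 ?sqr_ge0// divr_ge0 ?(ltW M0)// oppr_ge0 mulr_ge0_le0//; lra.
have -> : - (4 * th * cos th) / cutM th * (th * m - cutM th * c') ^+ 2 =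
   lam ^+ 2 * m ^+ 2 - 2 * k * m + k * (Q 1 - Q 0)
   - 4 * th ^+ 2 * (sin th / cutM th * m ^+ 2).
  rewrite Q01 /k /lam.
  have sE : sin th = cutM th + th * cos th by rewrite /cutM; ring.
  by rewrite [in RHS]sE; field; rewrite !gt_eqF//; lra.
rewrite /lam; lra.
Qed.

Lemma arc_length_bound (th0 L h tau : R) X1 X2 X3 T1 T3 : cut_range th0 -> 0 <= L ->
  arc3 L X1 X2 X3 T1 T3 ->
  X1 1 = 0 -> X2 1 = 0 -> X3 1 = h -> T3 1 = tau -> T1 1 = 0 ->
  X2 (1 / 3) = X2 (2 / 3) -> tau != 0 -> h ^+ 2 = 2 * `|tau| * cutB th0 ->
  h ^+ 2 * (1 + cutq th0) + 2 * `|tau| * Num.sqrt (cutg th0) <= L ^+ 2.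
Proof.
move=> r0 L0 A X11 X21 X31 T31 T11 Xthird tau0 hB.
have [m [v H]] := arc_quadratic_bound L0 A X11 X21 X31 T31 T11 Xthird.
(* With [v <= 0] the bound would grow at least linearly in [kap], with slope [2 * tau != 0]. The
   angle [pi] removes the [m ^+ 2] term. *)
have v0 : 0 < v.
  rewrite ltNge; apply/negP => v0.
  pose K := L ^+ 2 - h ^+ 2 - 4 * pi ^+ 2 * v.
  have key kap : 2 * kap * tau <= K.
    have := H pi kap 0 cut_range_pi; rewrite sinpi !mul0r expr0n /=.
    have : 0 <= kap ^+ 2 * - v by rewrite mulr_ge0 ?sqr_ge0//; lra.
    by rewrite /K; lra.
  have := key ((K + 1) / (2 * tau)).
  have -> : 2 * ((K + 1) / (2 * tau)) * tau = K + 1 by field.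
  lra.
apply: (reduced_min r0 v0 (normr_ge0 _) hB (m := m)) => th rth.
(* These multipliers maximize the two concave quadratics. *)
have := H th (tau / v) (m * h / v) rth; apply: le_trans.
rewrite lerD2r real_normK ?num_real// le_eqVlt; apply/orP; left; apply/eqP.
by field; rewrite gt_eqF.
Qed.
End LowerBound.

(** * Inner product and exterior square *)

Section LinearMaps.
Context {R : realType}.
Implicit Types U V : vectType R.

Lemma lfun_exists V U (f : V -> U) :
  (forall a x y, f (a *: x + y) = a *: f x + f y) ->
  exists phi : 'Hom(V, U), forall x, phi x = f x.
Proof.
move=> lf; pose F : {linear V -> U} := HB.pack f (GRing.isLinear.Build R V U *:%R f lf).
by exists (linfun F) => x; rewrite lfunE.
Qed.

Lemma bilinear_exists V U (B : V -> V -> U) :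
  (forall a x y z, B (a *: x + y) z = a *: B x z + B y z) ->
  (forall a x y z, B z (a *: x + y) = a *: B z x + B z y) ->
  exists B' : {bilinear V -> V -> U}, forall x y, B' x y = B x y.
Proof.
move=> ll lr.
have lB : bilinear_for *:%R *:%R B by split => [u a x y|u a x y]; [exact: ll|exact: lr].
pose B' : {bilinear V -> V -> U} :=
  HB.pack B (bilinear_isBilinear.Build R V V U *:%R *:%R B lB).
by exists B'.
Qed.

Lemma functionalP V (t : 'Hom(V, R^o)) a x y : t (a *: x + y) = a * t x + t y :> R.
Proof. by rewrite linearP. Qed.

End LinearMaps.

Section InnerProduct.
Context {R : realType} {V : vectType R} (ip : {dot V for idfun}).
Implicit Types x y z : V.

Lemma ipC x y : ip x y = ip y x.
Proof. by have := hermC (ip : {dot V for idfun}) x y; rewrite /= expr0 mul1r. Qed.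

Lemma ipDr x y z : ip x (y + z) = ip x y + ip x z. Proof. exact: linearDr. Qed.
Lemma ipBr x y z : ip x (y - z) = ip x y - ip x z. Proof. exact: linearBr. Qed.
Lemma ipNr x y : ip x (- y) = - ip x y. Proof. exact: linearNr. Qed.
Lemma ipZr (a : R) x y : ip x (a *: y) = a * ip x y. Proof. exact: linearZr_LR. Qed.
Lemma ip0r x : ip x 0 = 0. Proof. exact: linear0r. Qed.
Lemma ipDl x y z : ip (y + z) x = ip y x + ip z x. Proof. by rewrite !(ipC _ x) ipDr. Qed.
Lemma ipBl x y z : ip (y - z) x = ip y x - ip z x. Proof. by rewrite !(ipC _ x) ipBr. Qed.
Lemma ipNl x y : ip (- y) x = - ip y x. Proof. by rewrite !(ipC _ x) ipNr. Qed.
Lemma ipZl (a : R) x y : ip (a *: y) x = a * ip y x. Proof. by rewrite !(ipC _ x) ipZr. Qed.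
Lemma ip0l x : ip 0 x = 0. Proof. by rewrite ipC ip0r. Qed.

Definition ipE := (ipDr, ipBr, ipNr, ipZr, ip0r, ipDl, ipBl, ipNl, ipZl, ip0l).

Lemma ip_gt0 x : x != 0 -> 0 < ip x x.
Proof. exact: neq0_dnorm_gt0. Qed.

Lemma ip_ge0 x : 0 <= ip x x.
Proof. by have [->|/ip_gt0/ltW//] := eqVneq x 0; rewrite ip0l. Qed.

Lemma ip_eq0 x : ip x x = 0 -> x = 0.
Proof. by have [//|/ip_gt0 + E] := eqVneq x 0; rewrite E ltxx. Qed.

Lemma vnorm_ge0 x : 0 <= vnorm ip x. Proof. exact: sqrtr_ge0. Qed.

Lemma vnorm_sqr x : vnorm ip x ^+ 2 = ip x x.
Proof. by rewrite sqr_sqrtr ?ip_ge0. Qed.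

Lemma ip_le_vnorm x y : `|ip x y| <= vnorm ip x * vnorm ip y.
Proof.
rewrite -(@ler_pXn2r _ 2) ?nnegrE ?mulr_ge0 ?vnorm_ge0//.
rewrite real_normK ?num_real// exprMn !vnorm_sqr.
have [->|x0] := eqVneq x 0; first by rewrite !ip0l expr0n mul0r.
have := ip_ge0 (ip x x *: y - ip x y *: x).
rewrite !ipE (ipC y x).
have -> : ip x x * (ip x x * ip y y - ip x y * ip x y) -
  ip x y * (ip x x * ip x y - ip x y * ip x x) =
  ip x x * (ip x x * ip y y - ip x y ^+ 2) by ring.
by rewrite pmulr_rge0 ?ip_gt0// subr_ge0.
Qed.

Definition orthonormal3 (e f n : V) :=
  [/\ ip e e = 1, ip f f = 1, ip n n = 1 & [/\ ip e f = 0, ip e n = 0 & ip f n = 0]].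

Hypothesis dimV : \dim {:V} = 3%N.

(** A linear map from a space of dimension 3 to a plane has a nonzero kernel, whatever [p] and [q]
    are. *)
Lemma orthogonal_unit_exists (p q : V) :
  exists e, [/\ ip e e = 1, ip e p = 0 & ip e q = 0].
Proof.
have [|phi phiE] := @lfun_exists _ V (R^o * R^o)%type (fun x => (ip x p : R^o, ip x q : R^o)).
  by move=> a x y; rewrite !ipE.
have : \dim (lker phi) != 0%N.
  have := limg_ker_dim phi fullv; rewrite capfv dimV => E.
  apply/negP => /eqP k0; move: E; rewrite k0 add0n => E.
  have := dimvS (subvf (phi @: fullv)%VS); rewrite E.
  by rewrite dimvf /dim /= .
rewrite dimv_eq0 -vpick0.
set x := vpick _ => x0.
have : x \in lker phi by exact: memv_pick.
rewrite memv_ker phiE => /eqP [xp xq].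
exists ((vnorm ip x)^-1 *: x); rewrite !ipE xp xq !mulr0; split => //.
have := ip_gt0 x0; rewrite -vnorm_sqr => n0; field.
by apply: contraTneq n0 => ->; rewrite expr0n ltxx.
Qed.

(** The coordinate map along the frame is onto a space of dimension 3, hence injective, and both
    sides have the same coordinates. *)
Lemma orthonormal3_expand e f n : orthonormal3 e f n ->
  forall x, x = ip x e *: e + ip x f *: f + ip x n *: n.
Proof.
move=> [ee ff nn [ef en fn]] x.
have fe : ip f e = 0 by rewrite ipC.
have ne : ip n e = 0 by rewrite ipC.
have nf : ip n f = 0 by rewrite ipC.
have [|phi phiE] := @lfun_exists _ V (R^o * (R^o * R^o))%type
  (fun x => (ip x e : R^o, (ip x f : R^o, ip x n : R^o))).
  by move=> a y z; rewrite !ipE.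
have img : (phi @: fullv = fullv)%VS.
  apply/eqP; rewrite eqEsubv subvf /=; apply/subvP => -[a [b c]] _.
  have -> : (a, (b, c)) = phi (a *: e + b *: f + c *: n).
    rewrite phiE !ipE ee ff nn ef en fn fe ne nf.
    by congr (_, (_, _)); ring.
  by rewrite memv_img ?memvf.
have := limg_ker_dim phi fullv; rewrite img capfv dimV dimvf /dim /=.
move=> E; have /eqP : \dim (lker phi) = 0%N by move: E => /eqP; rewrite -[X in _ == X]add0n eqn_add2r => /eqP.
rewrite dimv_eq0 => /lker0P inj; apply: inj.
rewrite !phiE !ipE ee ff nn ef en fn fe ne nf.
by congr (_, (_, _)); ring.
Qed.

Lemma bessel3 e f n : orthonormal3 e f n -> forall x,
  ip x x = ip x e ^+ 2 + ip x f ^+ 2 + ip x n ^+ 2.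
Proof.
move=> O x; rewrite {1 2}(orthonormal3_expand O x) !ipE.
case: O => ee ff nn [ef en fn].
by rewrite ee ff nn (ipC f e) (ipC n e) (ipC n f) ef en fn; ring.
Qed.

End InnerProduct.

Section ExteriorSquare.
Context {R : realType} {V W : vectType R} (ip : {dot V for idfun}).
Context (w : {bilinear V -> V -> W}).
Hypothesis dimV : \dim {:V} = 3%N.
Hypothesis extW : is_exterior_square w.

Lemma wDl x y z : w (x + y) z = w x z + w y z. Proof. exact: linearDl. Qed.
Lemma wDr x y z : w z (x + y) = w z x + w z y. Proof. exact: linearDr. Qed.
Lemma wBl x y z : w (x - y) z = w x z - w y z. Proof. exact: linearBl. Qed.
Lemma wBr x y z : w z (x - y) = w z x - w z y. Proof. exact: linearBr. Qed.
Lemma wNl y z : w (- y) z = - w y z. Proof. exact: linearNl. Qed.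
Lemma wNr y z : w z (- y) = - w z y. Proof. exact: linearNr. Qed.
Lemma wZl (a : R) x z : w (a *: x) z = a *: w x z. Proof. exact: linearZl_LR. Qed.
Lemma wZr (a : R) x z : w z (a *: x) = a *: w z x. Proof. exact: linearZr_LR. Qed.
Lemma w0l z : w 0 z = 0. Proof. exact: linear0l. Qed.
Lemma w0r z : w z 0 = 0. Proof. exact: linear0r. Qed.
Lemma wxx x : w x x = 0. Proof. by case: extW. Qed.
Lemma wC x y : w y x = - w x y.
Proof.
have := wxx (x + y); rewrite wDl !wDr !wxx addr0 add0r => /eqP.
by rewrite addr_eq0 => /eqP ->; rewrite opprK.
Qed.

Definition wE := (wDl, wDr, wBl, wBr, wNl, wNr, wZl, wZr, w0l, w0r).

Lemma alternating_factor (U : vectType R) (B : V -> V -> U) :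
  (forall a x y z, B (a *: x + y) z = a *: B x z + B y z) ->
  (forall a x y z, B z (a *: x + y) = a *: B z x + B z y) ->
  (forall x, B x x = 0) ->
  exists f : 'Hom(W, U), forall x y, f (w x y) = B x y.
Proof.
move=> ll lr Bxx; have [B' B'E] := bilinear_exists ll lr.
have [|f [fE _]] := (proj2 extW) U B'; first by move=> x; rewrite B'E.
by exists f => x y; rewrite -fE.
Qed.

Lemma wedge_functional (e f : V) : exists tau : 'Hom(W, R^o),
  forall x y, tau (w x y) = ip x e * ip y f - ip x f * ip y e.
Proof.
apply: (@alternating_factor R^o (fun x y => ip x e * ip y f - ip x f * ip y e)).
- by move=> a x y z; rewrite !ipE /GRing.scale /=; ring.
- by move=> a x y z; rewrite !ipE /GRing.scale /=; ring.
- by move=> x; ring.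
Qed.

(** Uniqueness in the universal property, applied to [g] composed with [w]; it plays the part of
    decomposable bivectors spanning [W]. *)
Lemma lfun_wedge_eq (U : vectType R) (g h : 'Hom(W, U)) :
  (forall x y, g (w x y) = h (w x y)) -> g = h.
Proof.
move=> gh.
have [||B BE] := @bilinear_exists _ V U (fun x y => g (w x y)).
- by move=> a x y z; rewrite !wE linearD linearZ.
- by move=> a x y z; rewrite !wE linearD linearZ.
have [|k [_ uk]] := (proj2 extW) U B; first by move=> x; rewrite BE wxx linear0.
by rewrite -(uk g) ?(uk h) // => x y; rewrite BE.
Qed.

Lemma wedge_basis (e f n : V) (t1 t2 t3 : 'Hom(W, R^o)) : orthonormal3 ip e f n ->
  (forall x y, t1 (w x y) = ip x f * ip y n - ip x n * ip y f) ->
  (forall x y, t2 (w x y) = ip x n * ip y e - ip x e * ip y n) ->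
  (forall x y, t3 (w x y) = ip x e * ip y f - ip x f * ip y e) ->
  forall t, t = (t3 t : R) *: w e f + (t1 t : R) *: w f n + (t2 t : R) *: w n e.
Proof.
move=> O t1E t2E t3E.
have [|g gE] := @lfun_exists _ W W (fun t => (t3 t : R) *: w e f + (t1 t : R) *: w f n + (t2 t : R) *: w n e).
  move=> a x y; rewrite !functionalP !scalerDl !scalerDr !scalerA.
  by rewrite [RHS]addrACA [X in _ = X + _]addrACA.
suff : g = \1%VF by move=> E t; rewrite -gE E id_lfunE.
apply: lfun_wedge_eq => x y; rewrite id_lfunE gE t1E t2E t3E.
rewrite [in RHS](orthonormal3_expand dimV O x) [in RHS](orthonormal3_expand dimV O y).
rewrite !wE !wxx (wC e f) (wC f n) (wC n e) !scaler0 !scalerN !scalerA !add0r !addr0.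
rewrite !scalerBl !addrA.
by rewrite [RHS](ACl (1*3*4*6*5*2))%AC.
Qed.

Lemma orthonormal3_exists : exists e f n, orthonormal3 ip e f n.
Proof.
have [e [ee _ _]] := orthogonal_unit_exists ip dimV 0 0.
have [f [ff fe _]] := orthogonal_unit_exists ip dimV e 0.
have [n [nn ne nf]] := orthogonal_unit_exists ip dimV e f.
by exists e, f, n; split => //; split; rewrite (ipC ip).
Qed.

Lemma wedge_decomposable (t : W) : exists y y', t = w y y'.
Proof.
have [e [f [n O]]] := orthonormal3_exists.
have [t1 t1E] := wedge_functional f n; have [t2 t2E] := wedge_functional n e.
have [t3 t3E] := wedge_functional e f.
rewrite (wedge_basis O t1E t2E t3E t).
set c1 : R := t1 t; set c2 : R := t2 t; set c3 : R := t3 t.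
have [->|c30] := eqVneq c3 0.
  exists (c1 *: f - c2 *: e), n.
  by rewrite !wE (wC n e) scalerN opprK scale0r add0r.
(* Both vectors are orthogonal to [c1 *: e + c2 *: f + c3 *: n], the vector dual to [t]. *)
exists (e - (c1 / c3) *: n), (c3 *: f - c2 *: n).
rewrite !wE wxx !scaler0 oppr0 subr0 scalerA divfK// (wC f n) (wC n e).
by rewrite !scalerN !opprK addrAC.
Qed.

Lemma wedge_orthogonalize y y' : w y y' != 0 ->
  exists y2, [/\ w y y2 = w y y', ip y y2 = 0, y != 0, y2 != 0 &
    forall x, ip x y = 0 -> ip x y' = 0 -> ip x y2 = 0].
Proof.
move=> t0.
have y0 : y != 0 by apply: contraNneq t0 => ->; rewrite w0l.
have E : w y (y' - (ip y y' / ip y y) *: y) = w y y'.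
  by rewrite !wE wxx scaler0 subr0.
exists (y' - (ip y y' / ip y y) *: y); split => //.
- by rewrite !ipE; field; rewrite gt_eqF// ip_gt0.
- by apply: contraNneq t0 => E0; rewrite -E E0 w0r.
- by move=> x xy xy'; rewrite !ipE xy xy' mulr0 subr0.
Qed.

(** The decomposition selected by [supp] is opaque; what can be used is that some decomposition of
    [t] spans the support. *)
Lemma suppP (t : W) : exists y y',
  [/\ t = w y y' & forall v, v \in supp w t -> exists a b, v = a *: y + b *: y'] /\
  (y \in supp w t) /\ (y' \in supp w t).
Proof.
rewrite /supp; set P := [set y : V * V | t = w y.1 y.2]; set z := xget (0, 0) P.
have Pz : P z.
  by have [y [y' E]] := wedge_decomposable t; apply: (@xgetI _ (0, 0) P (y, y')).
exists z.1, z.2; rewrite span_cons span_seq1; split; first split => //.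
  by move=> v /memv_addP[a /vlineP[k ->]] [b /vlineP[l ->]] ->; exists k, l.
split; first by rewrite (subvP (addvSl _ _))// memv_line.
by rewrite (subvP (addvSr _ _))// memv_line.
Qed.

(* Factor [(p, q) |-> <x, p> q - <x, q> p] through the exterior square. *)
Lemma supp_orthogonal x y y' : w y y' != 0 -> ip x y = 0 -> ip x y' = 0 ->
  forall v, v \in supp w (w y y') -> ip x v = 0.
Proof.
move=> t0 xy xy' v; have [p [q [[E span] _]]] := suppP (w y y').
move=> /span [a [b ->]]; rewrite !ipE.
have [|||g gE] := @alternating_factor V (fun p q => ip x p *: q - ip x q *: p).
- move=> k p1 p2 q1; rewrite !ipE scalerDl scalerDr scalerBr !scalerA opprD !addrA.
  by rewrite [ip x q1 * k]mulrC [RHS](ACl (1*3*2*4))%AC.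
- move=> k p1 p2 q1; rewrite !ipE scalerDl scalerDr scalerBr !scalerA opprD !addrA.
  by rewrite [ip x q1 * k]mulrC [RHS](ACl (1*3*2*4))%AC.
- by move=> p1; rewrite subrr.
have : g (w y y') = 0 by rewrite gE xy xy' !scale0r subrr.
rewrite E gE => /eqP; rewrite subr_eq0 => /eqP H.
have pq0 : w p q != 0 by rewrite -E.
have xp : ip x p = 0.
  have : w p (ip x p *: q) = 0 by rewrite H wZr wxx scaler0.
  by rewrite wZr => /eqP; rewrite scaler_eq0 (negbTE pq0) orbF => /eqP.
have xq : ip x q = 0.
  have : w (ip x q *: p) q = 0 by rewrite -H wZl wxx scaler0.
  by rewrite wZl => /eqP; rewrite scaler_eq0 (negbTE pq0) orbF => /eqP.
by rewrite xp xq !mulr0 addr0.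
Qed.

(** Lagrange's identity in the plane orthogonal to [n]. The square hides a sign that depends on the
    orientation of the frame. *)
Lemma wedge_area_sqr e f n (tau : 'Hom(W, R^o)) y y' : orthonormal3 ip e f n ->
  (forall x y, tau (w x y) = ip x e * ip y f - ip x f * ip y e) ->
  ip y n = 0 -> ip y' n = 0 -> ip y y' = 0 ->
  (tau (w y y') : R) ^+ 2 = ip y y * ip y' y'.
Proof.
move=> O tauE yn y'n yy'; rewrite tauE (bessel3 dimV O y) (bessel3 dimV O y') yn y'n.
move: yy'; rewrite {1}(orthonormal3_expand dimV O y) !ipE yn mul0r addr0.
rewrite (ipC ip e y') (ipC ip f y') => E.
have -> : (ip y e * ip y' f - ip y f * ip y' e) ^+ 2 =
  (ip y e ^+ 2 + ip y f ^+ 2) * (ip y' e ^+ 2 + ip y' f ^+ 2) -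
  (ip y e * ip y' e + ip y f * ip y' f) ^+ 2 by ring.
by rewrite E; ring.
Qed.

End ExteriorSquare.

(** * Horizontal curves as primitives *)

Section Primitives.
Context {R : realType}.
Local Notation mu := (@lebesgue_measure R).
Implicit Types (f g d : R -> R) (T s : R).

Lemma integrable_sub f T s : s <= T -> mu.-integrable `[0, T] (EFin \o f) ->
  mu.-integrable `[0, s] (EFin \o f).
Proof.
move=> sT; apply: integrableS => //; apply: subset_itvl.
by rewrite bnd_simp.
Qed.

Lemma integrable_scale f T k : mu.-integrable `[0, T] (EFin \o f) ->
  mu.-integrable `[0, T] (EFin \o (fun r => k * f r)).
Proof. by move=> i; have := integrableZl _ k i; apply. Qed.

Lemma integrable_sub_fun f g T : mu.-integrable `[0, T] (EFin \o f) ->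
  mu.-integrable `[0, T] (EFin \o g) ->
  mu.-integrable `[0, T] (EFin \o (fun r => f r - g r)).
Proof. by move=> i j; have := integrableB _ i j; apply. Qed.

Lemma square_integrable f T : measurable_fun `[0, T] f ->
  (\int[mu]_(s in `[0%R, T]) ((f s) ^+ 2)%:E < +oo)%E ->
  mu.-integrable `[0, T] (EFin \o f).
Proof.
move=> mf foo.
have i2 : mu.-integrable `[0, T] (EFin \o (fun s => f s ^+ 2)).
  apply/integrableP; split; first by apply/measurable_EFinP; exact: measurable_funX.
  under eq_integral do rewrite /= ger0_norm ?sqr_ge0//.
  exact: foo.
have i1 : mu.-integrable `[0, T] (EFin \o (fun s => (1 + f s ^+ 2))).
  have i1 : mu.-integrable `[0, T] (EFin \o (fun=> 1 : R)).
    by apply: continuous_compact_integrable; [exact: segment_compact | move=> x; exact: cst_continuous].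
  exact: (integrableD _ i1 i2).
apply: le_integrable i1 => //; first exact/measurable_EFinP.
move=> x _ /=; rewrite lee_fin (ger0_norm (_ : 0 <= 1 + _)) ?addr_ge0 ?sqr_ge0//.
rewrite -(real_normK (num_real (f x))).
have := sqr_ge0 (`|f x| - 1); have := normr_ge0 (f x); nra.
Qed.

Lemma ae_neq (a : R) : {ae mu, forall x, x <> a}.
Proof.
exists [set a]; split => //; first exact: lebesgue_measure_set1.
by move=> x /= /contrapT.
Qed.

Lemma ae_imply (P Q : R -> Prop) : (forall x, P x -> Q x) ->
  {ae mu, forall x, P x} -> {ae mu, forall x, Q x}.
Proof. by move=> PQ; apply: filterS; first exact: (ae_filter_ringOfSetsType mu). Qed.

(* Lebesgue differentiation: the a.e. derivative of a primitive is its
   integrand. *)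
Lemma primitive_of_ae_derivative f g d T : 0 < T ->
  mu.-integrable `[0, T] (EFin \o g) ->
  (forall s, 0 <= s <= T -> f s = f 0 + (\int[mu]_(r in `[0%R, s]) g r)%R) ->
  measurable_fun `[0, T] d ->
  {ae mu, forall s, 0 < s < T -> is_derive s 1 f (d s)} ->
  mu.-integrable `[0, T] (EFin \o d) /\
  (forall s, 0 <= s <= T -> f s = f 0 + (\int[mu]_(r in `[0%R, s]) d r)%R).
Proof.
move=> T0 ig fE md dae.
(* Cut off by zero so that Lebesgue differentiation applies on the line; for 0 < s < T the
   truncation is invisible. *)
pose G := g \_ `[0, T].
have iG y : mu.-integrable `[0, y] (EFin \o G).
  rewrite -restrict_EFin; apply/integrable_restrict => //=.
  by apply: integrableS ig => //; exact: measurableI.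
have lG : locally_integrable [set: R] G by apply: integrable_locally.
have gd : {ae mu, forall s, 0 < s < T -> g s = d s}.
  have := @FTC1 R G (BLeft 0) iG lG; move: dae.
  apply: filterS2; first exact: (ae_filter_ringOfSetsType mu).
  move=> s ds Gs /[dup] sT /andP[s0 sT'].
  have [dF F's] := Gs s0.
  have := ds sT => dfs.
  have dfs' : is_derive s 1 f (g s).
    have -> : g s = G s by rewrite /G patchE mem_set//= in_itv /= !ltW.
    rewrite -F's derive1E.
    apply: (@near_eq_is_derive R R^o R^o (fun x => (\int[mu]_(t in `[0%R, x]) G t)%R + f 0) f).
      near=> x.
      rewrite addrC (fE x); last first.
        by apply/andP; split; apply: ltW; near: x; [exact: lt_nbhsr | exact: lt_nbhsl].
      congr (_ + _); apply: eq_Rintegral => t; rewrite inE /= in_itv /= => /andP[t0 tx].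
      rewrite /G patchE mem_set//= in_itv /= t0 /= (le_trans tx)//.
      by apply: ltW; near: x; exact: lt_nbhsl.
    have dA := derivableP dF; apply: is_derive_eq; by rewrite addr0.
  have [_ <-] := dfs'; by have [_ <-] := dfs.
have ae_gd s : s <= T -> ae_eq mu [set` `[0, s]] (EFin \o g) (EFin \o d).
  move=> sT; move: gd (ae_neq 0) (ae_neq T).
  apply: filterS3; first exact: (ae_filter_ringOfSetsType mu).
  move=> x xgd x0 xT.
  rewrite /= in_itv /= => /andP[x1 x2]; congr EFin; apply: xgd.
  rewrite !lt_neqAle x1 (le_trans x2 sT) !andbT eq_sym.
  by apply/andP; split; apply/eqP.
have mg : measurable_fun `[0, T] g by have /integrableP[/measurable_EFinP] := ig.
have sub s : s <= T -> [set` `[0, s]] `<=` [set` `[0, T]].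
  by move=> sT; apply: subset_itvl; rewrite bnd_simp.
split.
  apply/integrableP; split; first exact/measurable_EFinP.
  have /integrableP[_] := ig; congr (_ < _)%E.
  apply: ge0_ae_eq_integral => //.
  - by apply/measurableT_comp => //; exact/measurable_EFinP.
  - by apply/measurableT_comp => //; exact/measurable_EFinP.
  - move: (ae_gd T (lexx _)); apply: filterS.
    by move=> x E /E /= [->].
move=> s /[dup] s0T /andP[s0 sT]; rewrite fE//; congr (_ + fine _).
apply: ae_eq_integral => //.
- by apply/measurable_EFinP; apply: measurable_funS mg => //; exact: sub.
- by apply/measurable_EFinP; apply: measurable_funS md => //; exact: sub.
- exact: ae_gd.
Unshelve. all: by end_near. Qed.

Lemma Rintegral_le_increment f g T (K : R) : 0 <= K ->
  mu.-integrable `[0, T] (EFin \o f) -> mu.-integrable `[0, T] (EFin \o g) ->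
  forall a b, 0 <= a -> a <= b -> b <= T ->
  (forall r, a <= r <= b -> `|f r| <= K * g r) ->
  `|(\int[mu]_(r in `[0%R, b]) f r)%R - (\int[mu]_(r in `[0%R, a]) f r)%R| <=
  K * ((\int[mu]_(r in `[0%R, b]) g r)%R - (\int[mu]_(r in `[0%R, a]) g r)%R).
Proof.
move=> K0 iF iG a b a0 ab bT fg.
have ifb := integrable_sub bT iF; have igb := integrable_sub bT iG.
have sub : [set` `]a, b]] `<=` [set` `[0, b]].
  by move=> x /=; rewrite !in_itv /= => /andP[ax ->]; rewrite (le_trans a0 (ltW ax)).
have ifab : mu.-integrable `]a, b] (EFin \o f) by apply: integrableS ifb.
have igab : mu.-integrable `]a, b] (EFin \o g) by apply: integrableS igb.
rewrite !Rintegral_itvB ?bnd_simp//.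
apply: le_trans (le_normr_Rintegral _ ifab) _ => //.
rewrite -RintegralZl//; apply: le_Rintegral => //.
- exact: integrable_norm.
- by have := integrableZl _ K igab; apply.
- move=> x; rewrite /= in_itv /= => /andP[ax xb]; apply: fg.
  by rewrite ltW.
Qed.

End Primitives.

Section HorizontalCurves.
Context {R : realType} {V W : vectType R} (ip : {dot V for idfun}).
Context (w : {bilinear V -> V -> W}).
Local Notation mu := (@lebesgue_measure R).

Lemma functional_fst (phi : 'Hom(V, R^o)) :
  exists Phi : 'Hom((V * W)%type, R^o), forall p, Phi p = phi p.1.
Proof. by apply: lfun_exists => a x y; rewrite /= linearP. Qed.

Lemma functional_snd (phi : 'Hom(W, R^o)) :
  exists Phi : 'Hom((V * W)%type, R^o), forall p, Phi p = phi p.2.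
Proof. by apply: lfun_exists => a x y; rewrite /= linearP. Qed.

Lemma functional_ip (v : V) : exists phi : 'Hom(V, R^o), forall x, phi x = ip x v.
Proof. by apply: lfun_exists => a x y; rewrite ipDl ipZl. Qed.

Section OneCurve.
Variables (T : R) (gamma : R -> V * W) (u : R -> V).
Hypothesis T0 : 0 < T.
Hypothesis hor : horizontal w T gamma u.

(** [W12] supplies some density and horizontality an almost everywhere derivative; the two agree.
    Measurability is assumed because it is bootstrapped: the control gives the base curve, and the
    base curve gives the integrand of the second layer. *)
Lemma horizontal_primitive (phi : 'Hom((V * W)%type, R^o)) :
  measurable_fun `[0, T] (fun s => phi (horizontal_field w (u s) (gamma s)) : R) ->
  mu.-integrable `[0, T]
    (EFin \o (fun s => phi (horizontal_field w (u s) (gamma s)) : R)) /\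
  (forall s, 0 <= s <= T -> phi (gamma s) = phi (gamma 0) +
    (\int[mu]_(r in `[0%R, s]) (phi (horizontal_field w (u r) (gamma r)) : R))%R :> R).
Proof.
move=> md; case: hor => _ [g gL2 gE] ae.
have [mg g2] := gL2 phi.
apply: (@primitive_of_ae_derivative _ (fun s => phi (gamma s)) (fun s => phi (g s))) => //.
- exact: square_integrable.
- by move=> s hs; rewrite gE.
by apply: ae_imply ae => s H /H.
Qed.

Lemma control_integrable (phi : 'Hom(V, R^o)) :
  mu.-integrable `[0, T] (EFin \o (fun s => phi (u s) : R)).
Proof. by case: hor => uL2 _ _; have [? ?] := uL2 phi; exact: square_integrable. Qed.

Lemma control_measurable (phi : 'Hom(V, R^o)) :
  measurable_fun `[0, T] (fun s => phi (u s) : R).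
Proof. by case: hor => uL2 _ _; have [] := uL2 phi. Qed.

Lemma horizontal_fst (phi : 'Hom(V, R^o)) s : 0 <= s <= T ->
  phi (gamma s).1 = phi (gamma 0).1 + (\int[mu]_(r in `[0%R, s]) (phi (u r) : R))%R :> R.
Proof.
move=> hs; have [Phi PhiE] := functional_fst phi.
have [|_ /(_ s hs)] := @horizontal_primitive Phi.
  have -> : (fun s => Phi (horizontal_field w (u s) (gamma s)) : R) = (fun s => phi (u s)).
    by apply/funext => r; rewrite PhiE.
  exact: control_measurable.
rewrite !PhiE => ->; congr (_ + _).
by apply: eq_Rintegral => r _; rewrite PhiE.
Qed.

Lemma base_measurable (phi : 'Hom(V, R^o)) :
  measurable_fun `[0, T] (fun s => phi (gamma s).1 : R).
Proof.
have /(measurable_funD (measurable_cst (phi (gamma 0).1 : R))) :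
    measurable_fun `[0, T] (fun s => (\int[mu]_(r in `[0%R, s]) (phi (u r) : R))%R).
  apply: subspace_continuous_measurable_fun => //.
  exact: parameterized_integral_continuous (ltW T0) (control_integrable phi).
apply: eq_measurable_fun => s; rewrite inE /= in_itv /= => hs.
by rewrite (horizontal_fst phi hs).
Qed.

Lemma horizontal_snd (phi : 'Hom(W, R^o)) :
  measurable_fun `[0, T] (fun s => phi (w (gamma s).1 (u s)) : R) ->
  mu.-integrable `[0, T] (EFin \o (fun s => 2^-1 * (phi (w (gamma s).1 (u s)) : R))) /\
  (forall s, 0 <= s <= T -> phi (gamma s).2 = phi (gamma 0).2 +
    (\int[mu]_(r in `[0%R, s]) (2^-1 * (phi (w (gamma r).1 (u r)) : R)))%R :> R).
Proof.
move=> mphi; have [Phi PhiE] := functional_snd phi.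
have E : (fun s => Phi (horizontal_field w (u s) (gamma s)) : R) =
    (fun s => 2^-1 * (phi (w (gamma s).1 (u s)) : R)).
  by apply/funext => r; rewrite PhiE /= linearZ.
have [|iP HP] := @horizontal_primitive Phi.
  by rewrite E; apply: measurable_funM.
split; first by rewrite -E.
by move=> s /HP; rewrite !PhiE => ->; rewrite E.
Qed.

Lemma horizontal_area (e f : V) (tau : 'Hom(W, R^o)) :
  (forall x y, tau (w x y) = ip x e * ip y f - ip x f * ip y e) ->
  let F r := 2^-1 * (ip (gamma r).1 e * ip (u r) f - ip (gamma r).1 f * ip (u r) e) in
  mu.-integrable `[0, T] (EFin \o F) /\
  (forall s, 0 <= s <= T -> tau (gamma s).2 = tau (gamma 0).2 +
    (\int[mu]_(r in `[0%R, s]) F r)%R :> R).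
Proof.
move=> tauE F.
have E : F = (fun s => 2^-1 * (tau (w (gamma s).1 (u s)) : R)).
  by apply/funext => r; rewrite tauE.
rewrite E; apply: horizontal_snd.
have [pe peE] := functional_ip e; have [pf pfE] := functional_ip f.
have := measurable_funB (measurable_funM (base_measurable pe) (control_measurable pf))
  (measurable_funM (base_measurable pf) (control_measurable pe)).
by apply: eq_measurable_fun => s _; rewrite /= tauE peE pfE peE pfE.
Qed.

Hypothesis dimV : \dim {:V} = 3%N.

Lemma speed_integrable : mu.-integrable `[0, T] (EFin \o (fun s => vnorm ip (u s))).
Proof.
have [e [f [n O]]] := orthonormal3_exists ip dimV.
have [pe peE] := functional_ip e; have [pf pfE] := functional_ip f.
have [pn pnE] := functional_ip n.
have E s : vnorm ip (u s) =
    Num.sqrt ((pe (u s) : R) ^+ 2 + (pf (u s) : R) ^+ 2 + (pn (u s) : R) ^+ 2).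
  by rewrite /vnorm peE pfE pnE -(bessel3 dimV O).
have me := control_measurable pe; have mf := control_measurable pf.
have mn := control_measurable pn.
have ie := integrable_norm (control_integrable pe).
have jf := integrable_norm (control_integrable pf).
have jn := integrable_norm (control_integrable pn).
have := integrableD _ (integrableD _ ie jf) jn; move=> /(_ _ _)H.
apply: le_integrable (H _ _) => //.
  apply/measurable_EFinP; rewrite (funext E).
  apply: measurableT_comp => //.
    by apply: continuous_measurable_fun; exact: sqrt_continuous.
  by apply: measurable_funD; [apply: measurable_funD|]; exact: measurable_funX.
move=> s _ /=; rewrite lee_fin ger0_norm ?vnorm_ge0// ger0_norm ?addr_ge0//.
rewrite E; set a : R := pe (u s); set b : R := pf (u s); set c : R := pn (u s).
rewrite -(@ler_pXn2r _ 2) ?nnegrE ?sqrtr_ge0 ?addr_ge0// sqr_sqrtr ?addr_ge0 ?sqr_ge0//.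
rewrite -(real_normK (num_real a)) -(real_normK (num_real b)) -(real_normK (num_real c)).
have := normr_ge0 a; have := normr_ge0 b; have := normr_ge0 c; nra.
Qed.

End OneCurve.
End HorizontalCurves.

(** * Arc length and the lower bound for competitors *)

Section LengthBound.
Context {R : realType} {V W : vectType R} (ip : {dot V for idfun}).
Context (w : {bilinear V -> V -> W}).
Local Notation mu := (@lebesgue_measure R).
Hypothesis dimV : \dim {:V} = 3%N.

Section OneCurve.
Variables (T : R) (gamma : R -> V * W) (u : R -> V).
Hypothesis T0 : 0 < T.
Hypothesis hor : horizontal w T gamma u.

Let arclen s : R := (\int[mu]_(r in `[0%R, s]) vnorm ip (u r))%R.

Lemma length_arclen : length ip T u = (arclen T)%:E.
Proof.
rewrite /length /arclen /Rintegral fineK//.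
apply: integrable_fin_num => //; exact: (speed_integrable ip hor dimV).
Qed.

Lemma arclen0 : arclen 0 = 0.
Proof. by rewrite /arclen set_itv1 Rintegral_set1. Qed.

Lemma arclen_le a b : 0 <= a -> a <= b -> b <= T -> arclen a <= arclen b.
Proof.
move=> a0 ab bT; rewrite -subr_ge0.
have i := speed_integrable ip hor dimV.
rewrite /arclen Rintegral_itvB ?bnd_simp//; last exact: integrable_sub i.
by apply: Rintegral_ge0 => *; exact: vnorm_ge0.
Qed.

Lemma base_increment (v : V) a b : 0 <= a -> a <= b -> b <= T ->
  `|ip ((gamma b).1 - (gamma a).1) v| <= vnorm ip v * (arclen b - arclen a).
Proof.
move=> a0 ab bT; have [phi phiE] := functional_ip ip v.
rewrite ipBl -!phiE.
rewrite (horizontal_fst T0 hor phi (s := b)) ?(le_trans a0)//.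
rewrite (horizontal_fst T0 hor phi (s := a)) ?a0 ?(le_trans ab)//.
rewrite opprD addrACA subrr add0r.
apply: (@Rintegral_le_increment _ _ _ T) => //.
- exact: vnorm_ge0.
- exact: (control_integrable hor).
- exact: (speed_integrable ip hor dimV).
- by move=> r _; rewrite phiE mulrC ip_le_vnorm.
Qed.

(** Test [base_increment] against the displacement itself and cancel one factor. *)
Lemma base_lipschitz a b : 0 <= a -> a <= b -> b <= T ->
  vnorm ip ((gamma b).1 - (gamma a).1) <= arclen b - arclen a.
Proof.
move=> a0 ab bT; set x := _ - _.
have := base_increment x a0 ab bT; rewrite ger0_norm ?ip_ge0// -vnorm_sqr expr2.
have := vnorm_ge0 ip x; rewrite le_eqVlt => /predU1P[<- _|x0].
  by rewrite subr_ge0 arclen_le.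
by rewrite ler_pM2l.
Qed.

Lemma area_increment (e f : V) (tau : 'Hom(W, R^o)) a b :
  (forall x y, tau (w x y) = ip x e * ip y f - ip x f * ip y e) ->
  ip e e = 1 -> ip f f = 1 -> 0 <= a -> a <= b -> b <= T ->
  `|(tau (gamma b).2 : R) - (tau (gamma a).2 : R) - 2^-1 *
     (ip (gamma a).1 e * (ip (gamma b).1 f - ip (gamma a).1 f) -
      ip (gamma a).1 f * (ip (gamma b).1 e - ip (gamma a).1 e))| <=
  (arclen b - arclen a) ^+ 2.
Proof.
move=> tauE ee ff a0 ab bT.
have hb : 0 <= b <= T by rewrite (le_trans a0).
have ha : 0 <= a <= T by rewrite a0 (le_trans ab).
have [pe peE] := functional_ip ip e; have [pf pfE] := functional_ip ip f.
have ve : vnorm ip e = 1 by rewrite /vnorm ee sqrtr1.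
have vf : vnorm ip f = 1 by rewrite /vnorm ff sqrtr1.
pose F r := 2^-1 * (ip (gamma r).1 e * ip (u r) f - ip (gamma r).1 f * ip (u r) e).
have [iF FE] : mu.-integrable `[0, T] (EFin \o F) /\
  (forall s, 0 <= s <= T -> tau (gamma s).2 = tau (gamma 0).2 +
    (\int[mu]_(r in `[0%R, s]) F r)%R :> R) := horizontal_area T0 hor tauE.
have ie := control_integrable hor pe; have jf := control_integrable hor pf.
have ispeed := speed_integrable ip hor dimV.
set xa := (gamma a).1.
(* The area integrand with the base point frozen at time [a]. What remains is at most displacement
   times speed, which produces the quadratic error required by [arc3]. *)
pose G r := 2^-1 * (ip xa e * (pf (u r) : R) - ip xa f * (pe (u r) : R)).
have iG : mu.-integrable `[0, T] (EFin \o G).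
  exact: (integrable_scale 2^-1 (integrable_sub_fun
    (integrable_scale (ip xa e) jf) (integrable_scale (ip xa f) ie))).
have GE s : 0 <= s <= T -> (\int[mu]_(r in `[0%R, s]) G r)%R =
    2^-1 * (ip xa e * (ip (gamma s).1 f - ip (gamma 0).1 f) -
            ip xa f * (ip (gamma s).1 e - ip (gamma 0).1 e)).
  move=> /[dup] hs /andP[s0 sT].
  have ie' := integrable_sub sT ie; have jf' := integrable_sub sT jf.
  have ce := integrable_scale (ip xa f) ie'; have cf := integrable_scale (ip xa e) jf'.
  rewrite RintegralZl//; last exact: integrable_sub_fun cf ce.
  rewrite (RintegralB _ cf ce)//.
  rewrite !RintegralZl// -!peE -!pfE.
  rewrite (horizontal_fst T0 hor pe hs) (horizontal_fst T0 hor pf hs).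
  by congr (_ * (_ * _ - _ * _)); rewrite addrC addKr.
pose H r := F r - G r.
have iH : mu.-integrable `[0, T] (EFin \o H) by exact: integrable_sub_fun iF iG.
have HE s : 0 <= s <= T -> (\int[mu]_(r in `[0%R, s]) H r)%R =
    (\int[mu]_(r in `[0%R, s]) F r)%R - (\int[mu]_(r in `[0%R, s]) G r)%R.
  by move=> /andP[_ sT]; rewrite (RintegralB _ (integrable_sub sT iF) (integrable_sub sT iG)).
have E : (tau (gamma b).2 : R) - (tau (gamma a).2 : R) - 2^-1 *
     (ip xa e * (ip (gamma b).1 f - ip xa f) - ip xa f * (ip (gamma b).1 e - ip xa e))
   = (\int[mu]_(r in `[0%R, b]) H r)%R - (\int[mu]_(r in `[0%R, a]) H r)%R.
  by rewrite !HE// !GE// (FE b)// (FE a)//; rewrite -/xa; ring.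

rewrite E.
rewrite expr2; apply: (@Rintegral_le_increment _ _ _ T) => //.
  by rewrite subr_ge0 arclen_le.
move=> r /andP[ar rb].
have rT : r <= T by rewrite (le_trans rb).
have r0 : 0 <= r by rewrite (le_trans a0).
have HrE : H r = 2^-1 * (ip ((gamma r).1 - xa) e * ip (u r) f -
     ip ((gamma r).1 - xa) f * ip (u r) e).
  by rewrite /H /F /G peE pfE !ipBl; ring.
have rb' : arclen r - arclen a <= arclen b - arclen a.
  by rewrite lerD2r arclen_le.
have xe : `|ip ((gamma r).1 - xa) e| <= arclen b - arclen a.
  by apply: le_trans rb'; have := base_increment e a0 ar rT; rewrite ve mul1r.
have xf : `|ip ((gamma r).1 - xa) f| <= arclen b - arclen a.
  by apply: le_trans rb'; have := base_increment f a0 ar rT; rewrite vf mul1r.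
have ue : `|ip (u r) e| <= vnorm ip (u r) by have := ip_le_vnorm ip (u r) e; rewrite ve mulr1.
have uf : `|ip (u r) f| <= vnorm ip (u r) by have := ip_le_vnorm ip (u r) f; rewrite vf mulr1.
rewrite HrE normrM ger0_norm ?invr_ge0// ler_pdivrMl//.
apply: le_trans (ler_normB _ _) _; rewrite !normrM mulr_natl mulr2n.
by apply: lerD; apply: ler_pM.
Qed.

(** [arclen] may be constant on intervals, so a preimage is selected by the intermediate value
    theorem, with the two ends pinned to 0 and [T]. Increments of the curve are controlled by
    [arclen], whose values along the selection are prescribed. *)
Lemma arclength_parameter : exists s : R -> R, [/\ s 0 = 0, s 1 = T,
  (forall r, 0 <= r -> r <= 1 -> [/\ 0 <= s r, s r <= T & arclen (s r) = arclen T * r]) &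
  (forall a b, 0 <= a -> a <= b -> b <= 1 -> s a <= s b)].
Proof.
have L0 : 0 <= arclen T by rewrite -arclen0; apply: arclen_le => //; exact: ltW.
have [LE|Lneq] := eqVneq (arclen T) 0.
  exists (fun r => T * r); split; rewrite ?mulr0 ?mulr1//.
  - move=> r r0 r1; have h0 : 0 <= T * r by rewrite mulr_ge0// ltW.
    have h1 : T * r <= T by rewrite -[leRHS]mulr1 ler_wpM2l// ltW.
    split => //; rewrite LE mul0r; apply/eqP; rewrite eq_le.
    by rewrite -{1}LE arclen_le//= -arclen0 arclen_le.
  - by move=> a b a0 ab b1; rewrite ler_wpM2l// ltW.
have Lgt : 0 < arclen T by rewrite lt_neqAle eq_sym Lneq.
have ex r : exists s, 0 <= r -> r <= 1 -> [/\ 0 <= s, s <= T, arclen s = arclen T * r,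
    (r = 0 -> s = 0) & (r = 1 -> s = T)].
  have [->|r0] := eqVneq r 0.
    exists 0 => _ _; rewrite mulr0 arclen0; split => //; first exact: ltW.
    by move=> /eqP; rewrite eq_sym oner_eq0.
  have [->|r1] := eqVneq r 1.
    exists T => _ _; rewrite mulr1; split => //; first exact: ltW.
    by move=> /eqP; rewrite oner_eq0.
  have [h0|h0] := leP 0 r; last by exists 0.
  have [h1|h1] := leP r 1; last by exists 0.
  have cA : {within `[0, T], continuous arclen}.
    apply: parameterized_integral_continuous (ltW T0) _.
    exact: (speed_integrable ip hor dimV).
  have [|s] := @IVT _ arclen 0 T (arclen T * r) (ltW T0) cA.
    rewrite arclen0 ge_min le_max mulr_ge0//= -[X in _ || (_ <= X)]mulr1.
    by rewrite ler_wpM2l// orbT.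
  rewrite in_itv /= => /andP[s0 sT] E; exists s => _ _; split => //.
  - by move=> r00; rewrite r00 eqxx in r0.
  - by move=> r11; rewrite r11 eqxx in r1.
have [s sP] := choice ex.
exists s; split.
- by have [_ _ _ h _] := sP 0 (lexx _) ler01; exact: h.
- by have [_ _ _ _ h] := sP 1 ler01 (lexx _); exact: h.
- by move=> r r0 r1; have [] := sP r r0 r1.
- move=> a b a0 ab b1.
  have [sa0 saT sa _ _] := sP a a0 (le_trans ab b1).
  have [sb0 sbT sb _ _] := sP b (le_trans a0 ab) b1.
  move: ab; rewrite le_eqVlt => /predU1P[-> //|ab].
  rewrite leNgt; apply/negP => /ltW sba.
  have := arclen_le sb0 sba saT; rewrite sa sb ler_pM2l// => ba.
  by move: ab; rewrite ltNge ba.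
Qed.

Hypothesis gamma0 : gamma 0 = 0.

(** The parameter [s] is fixed before the frame is quantified, so the frame may depend on the points
    reached at one third and two thirds. *)
Lemma arc_of_horizontal : exists (L : R) (s : R -> R),
  [/\ length ip T u = L%:E, 0 <= L, s 0 = 0, s 1 = T &
    forall e f n (t1 t3 : 'Hom(W, R^o)), orthonormal3 ip e f n ->
    (forall x y, t3 (w x y) = ip x e * ip y f - ip x f * ip y e) ->
    (forall x y, t1 (w x y) = ip x f * ip y n - ip x n * ip y f) ->
    arc3 L (fun r => ip (gamma (s r)).1 e) (fun r => ip (gamma (s r)).1 f)
      (fun r => ip (gamma (s r)).1 n) (fun r => t1 (gamma (s r)).2)
      (fun r => t3 (gamma (s r)).2)].
Proof.
have [s [s0 s1 sP smono]] := arclength_parameter.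
exists (arclen T), s; split => //.
- exact: length_arclen.
- by rewrite -arclen0; apply: arclen_le => //; exact: ltW.
move=> e f n t1 t3 O t3E t1E.
have [ee ff nn _] := O.
have inc a b : 0 <= a -> a <= b -> b <= 1 -> [/\ 0 <= s a, s a <= s b, s b <= T &
    arclen (s b) - arclen (s a) = arclen T * (b - a)].
  move=> a0 ab b1; have [sa0 saT sa] := sP a a0 (le_trans ab b1).
  have [sb0 sbT sb] := sP b (le_trans a0 ab) b1.
  by split => //; [exact: smono | rewrite sa sb -mulrBr].
split; rewrite ?s0 ?gamma0 ?ip0l ?linear0//.
- move=> a b a0 ab b1; have [h1 h2 h3 hE] := inc a b a0 ab b1.
  rewrite -!ipBl -(bessel3 dimV O) -vnorm_sqr -exprMn -hE.
  rewrite ler_pXn2r ?nnegrE ?vnorm_ge0//; first exact: base_lipschitz.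
  by rewrite subr_ge0 arclen_le.
- exists (arclen T ^+ 2) => a b a0 ab b1; have [h1 h2 h3 hE] := inc a b a0 ab b1.
  by rewrite -exprMn -hE; exact: area_increment.
- exists (arclen T ^+ 2) => a b a0 ab b1; have [h1 h2 h3 hE] := inc a b a0 ab b1.
  by rewrite -exprMn -hE; exact: area_increment.
Qed.

Lemma length_ge_displacement :
  ((vnorm ip (gamma T).1)%:E <= length ip T u)%E.
Proof.
rewrite length_arclen lee_fin.
have := base_lipschitz (lexx _) (ltW T0) (lexx T).
by rewrite gamma0 arclen0 !subr0.
Qed.

End OneCurve.

Hypothesis extW : is_exterior_square w.

(* The axis [f] of the moving frame is chosen orthogonal to the chord between
   the times at one third and two thirds of the length: this is the constraint
   under which the extremals are optimal up to the cut time. *)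
Lemma length_lower_bound th0 T gamma u (y y' n : V) (h : R) :
  cut_range th0 -> 0 < T -> horizontal w T gamma u -> gamma 0 = 0 ->
  y != 0 -> y' != 0 -> ip y y' = 0 -> ip n n = 1 -> ip y n = 0 -> ip y' n = 0 ->
  gamma T = (h *: n, w y y') ->
  h ^+ 2 = 2 * (vnorm ip y * vnorm ip y') * cutB th0 ->
  ((Num.sqrt (h ^+ 2 * (1 + cutq th0) +
     2 * (vnorm ip y * vnorm ip y') * Num.sqrt (cutg th0)))%:E <= length ip T u)%E.
Proof.
move=> r0 T0 hor g0 y0 y'0 yy' nn yn y'n gT hB.
have [L [s [-> L0 s0 s1 A]]] := arc_of_horizontal T0 hor g0.
have [f [ff fn fx]] := orthogonal_unit_exists ip dimV n
  ((gamma (s (1 / 3))).1 - (gamma (s (2 / 3))).1).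
have [e [ee en ef]] := orthogonal_unit_exists ip dimV n f.
have O : orthonormal3 ip e f n by split.
have [t1 t1E] := wedge_functional ip extW f n.
have [t3 t3E] := wedge_functional ip extW e f.
have nE : ip n e = 0 by rewrite ipC.
have nf : ip n f = 0 by rewrite ipC.
have E := wedge_area_sqr dimV O t3E yn y'n yy'.
set tau : R := t3 (w y y').
have tauE : `|tau| = vnorm ip y * vnorm ip y'.
  apply/eqP; rewrite -(@eqrXn2 _ 2) ?mulr_ge0 ?vnorm_ge0//.
  by rewrite real_normK ?num_real// exprMn !vnorm_sqr E.
have tau0 : tau != 0.
  by rewrite -normr_eq0 tauE mulf_neq0// sqrtr_eq0 -ltNge ip_gt0.
rewrite -tauE in hB *.
have LE : L = Num.sqrt (L ^+ 2) by rewrite sqrtr_sqr ger0_norm.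
rewrite lee_fin LE ler_sqrt ?sqr_ge0//.
apply: (arc_length_bound r0 L0 (A e f n t1 t3 O t3E t1E)) => //.
- by rewrite s1 gT /= !ipE nE mulr0.
- by rewrite s1 gT /= !ipE nf mulr0.
- by rewrite s1 gT /= !ipE nn mulr1.
- by rewrite s1 gT.
- by rewrite s1 gT /= t1E yn y'n; ring.
- by apply/eqP; rewrite -subr_eq0 -ipBl ipC fx.
Qed.

End LengthBound.

(** * Piecewise smooth horizontal curves *)

Section PiecewisePrimitives.
Context {R : realType}.
Local Notation mu := (@lebesgue_measure R).
Implicit Types (f d : R -> R).

Lemma continuous_integrable d (a b : R) : continuous d ->
  mu.-integrable `[a, b] (EFin \o d).
Proof.
move=> cd; apply: continuous_compact_integrable; first exact: segment_compact.
exact: continuous_subspaceT.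
Qed.

Lemma smooth_FTC f d (a b : R) : a <= b -> continuous d ->
  (forall s : R, is_derive s 1 f (d s)) ->
  (\int[mu]_(r in `[a, b]) d r)%R = f b - f a.
Proof.
move=> + cd df; rewrite le_eqVlt => /predU1P[->|ab].
  by rewrite set_itv1 Rintegral_set1 subrr.
rewrite /Rintegral (@continuous_FTC2 _ d f)//.
- exact: continuous_subspaceT.
- have cf s : {for s, continuous f} by apply: is_derive_continuous (df s).
  split; first by move=> s _; have [] := df s.
  + by apply: cvg_at_right_filter; exact: cf.
  + by apply: cvg_at_left_filter; exact: cf.
- by move=> s _; rewrite derive1E; have [_ ->] := df s.
Qed.

Definition paste {A : Type} (s0 : R) (f g : R -> A) (s : R) : A :=
  if s <= s0 then f s else g s.

Lemma measurable_paste (d1 d2 : R -> R) (s0 T : R) : continuous d1 -> continuous d2 ->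
  measurable_fun `[0, T] (paste s0 d1 d2).
Proof.
move=> c1 c2; apply: (@measurable_funS _ _ _ _ setT) => //.
apply: measurable_fun_ifT.
- by apply: measurable_fun_ler.
- exact: continuous_measurable_fun.
- exact: continuous_measurable_fun.
Qed.

Lemma integrable_paste (d1 d2 : R -> R) (s0 T : R) : continuous d1 -> continuous d2 ->
  mu.-integrable `[0, T] (EFin \o paste s0 d1 d2).
Proof.
move=> c1 c2.
have i1 := integrable_norm (continuous_integrable 0 T c1).
have i2 := integrable_norm (continuous_integrable 0 T c2).
have := integrableD _ i1 i2; move=> /(_ _)H; apply: le_integrable (H _) => //.
  by apply/measurable_EFinP; exact: measurable_paste.
move=> s _ /=; rewrite lee_fin (ger0_norm (_ : 0 <= `|d1 s| + `|d2 s|)) ?addr_ge0//.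
by rewrite /paste; case: ifP => _; rewrite ?lerDl ?lerDr.
Qed.

Lemma paste_primitive (f1 f2 d1 d2 : R -> R) (s0 : R) :
  continuous d1 -> continuous d2 ->
  (forall s : R, is_derive s 1 f1 (d1 s)) -> (forall s : R, is_derive s 1 f2 (d2 s)) ->
  0 <= s0 -> f1 s0 = f2 s0 -> forall s, 0 <= s ->
  (\int[mu]_(r in `[0%R, s]) paste s0 d1 d2 r)%R = paste s0 f1 f2 s - f1 0.
Proof.
move=> c1 c2 df1 df2 s00 E s hs.
have before s' : 0 <= s' -> s' <= s0 -> (\int[mu]_(r in `[0%R, s']) paste s0 d1 d2 r)%R = f1 s' - f1 0.
  move=> h0 h1; rewrite -(smooth_FTC h0 c1 df1); apply: eq_Rintegral => r.
  rewrite inE /= in_itv /= => /andP[_ rs]; rewrite /paste ifT//.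
  exact: le_trans rs h1.
rewrite {2}/paste; case: ifPn => [/before -> //|]; rewrite -ltNge => s0s.
have ig := integrable_paste s0 s c1 c2.
have := @Rintegral_itvB _ (paste s0 d1 d2) (BLeft 0) (BRight s) s0 ig.
rewrite !bnd_simp => /(_ s00 (ltW s0s)) /eqP; rewrite subr_eq => /eqP ->.
rewrite before//.
have -> : (\int[mu]_(r in `]s0, s]) paste s0 d1 d2 r)%R = (\int[mu]_(r in `]s0, s]) d2 r)%R.
  apply: eq_Rintegral => r; rewrite inE /= in_itv /= => /andP[rs _].
  by rewrite /paste ifF// leNgt rs.
rewrite Rintegral_itv_obnd_cbnd; last first.
  by apply: integrableS (continuous_integrable s0 s c2) => //; exact: subset_itv_oc_cc.
rewrite (smooth_FTC (ltW s0s) c2 df2) E; ring.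
Qed.

Lemma paste_derive (f1 f2 d1 d2 : R -> R) (s0 s : R) :
  (forall s : R, is_derive s 1 f1 (d1 s)) -> (forall s : R, is_derive s 1 f2 (d2 s)) ->
  s <> s0 -> is_derive s 1 (paste s0 f1 f2) (paste s0 d1 d2 s).
Proof.
move=> df1 df2 /eqP; rewrite neq_lt => /orP[h|h].
  rewrite {2}/paste (ltW h); apply: (@near_eq_is_derive R R^o R^o f1) (df1 s).
  near=> r; rewrite /paste ifT//; apply: ltW; near: r; exact: lt_nbhsl.
rewrite {2}/paste leNgt h /=; apply: (@near_eq_is_derive R R^o R^o f2) (df2 s).
near=> r; rewrite /paste leNgt ifF//; apply/negbF; near: r; exact: lt_nbhsr.
Unshelve. all: by end_near. Qed.

End PiecewisePrimitives.

Section SmoothCurves.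
Context {R : realType} {V W : vectType R} (ip : {dot V for idfun}).
Context (w : {bilinear V -> V -> W}).
Local Notation mu := (@lebesgue_measure R).

Lemma functional_eq (U : vectType R) (p q : U) :
  (forall phi : 'Hom(U, R^o), phi p = phi q) -> p = q.
Proof.
move=> H; rewrite (coord_vbasis (memvf p)) (coord_vbasis (memvf q)).
apply: eq_bigr => i _; congr (_ *: _).
have [|phi phiE] := @lfun_exists _ U R^o (coord (vbasis fullv) i).
  by move=> a x y; rewrite linearP.
by rewrite -!phiE H.
Qed.

(** Classical counterpart of [horizontal]: derivatives exist at every real time and are continuous,
    so pieces can be pasted anywhere and the fundamental theorem applies to each. *)
Definition smooth_horizontal (x : R -> V) (t : R -> W) (u : R -> V) : Prop :=
  [/\ forall phi : 'Hom(V, R^o), continuous (fun s => phi (u s) : R),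
      forall (phi : 'Hom(V, R^o)) (s : R),
        is_derive s (1 : R) (fun r => phi (x r) : R) (phi (u s)),
      forall psi : 'Hom(W, R^o), continuous (fun s => psi (w (x s) (u s)) : R) &
      forall (psi : 'Hom(W, R^o)) (s : R),
        is_derive s (1 : R) (fun r => psi (t r) : R) (2^-1 * psi (w (x s) (u s)))].

Lemma functional_pair (Phi : 'Hom((V * W)%type, R^o)) :
  exists (phi : 'Hom(V, R^o)) (psi : 'Hom(W, R^o)),
    forall p, Phi p = phi p.1 + psi p.2.
Proof.
have [|phi phiE] := @lfun_exists _ V R^o (fun x => Phi (x, 0)).
  move=> a x y; rewrite -linearP; congr (Phi (_, _)).
  by rewrite /= scaler0 addr0.
have [|psi psiE] := @lfun_exists _ W R^o (fun t => Phi (0, t)).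
  move=> a x y; rewrite -linearP; congr (Phi (_, _)).
  by rewrite /= scaler0 addr0.
exists phi, psi => -[x t]; rewrite phiE psiE -linearD /=; congr (Phi (_, _)).
  by rewrite /= addr0.
by rewrite /= add0r.
Qed.

Lemma smooth_horizontal_functional x t u (Phi : 'Hom((V * W)%type, R^o)) :
  smooth_horizontal x t u ->
  continuous (fun s => Phi (horizontal_field w (u s) (x s, t s)) : R) /\
  (forall s : R, is_derive s (1 : R) (fun r => Phi (x r, t r) : R)
    (Phi (horizontal_field w (u s) (x s, t s)))).
Proof.
move=> [cu dx cw dt]; have [phi [psi E]] := functional_pair Phi.
have FE s : Phi (horizontal_field w (u s) (x s, t s)) =
    phi (u s) + 2^-1 * (psi (w (x s) (u s)) : R) :> R.
  by rewrite E /= linearZ.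
split.
  under eq_fun do rewrite FE.
  by move=> s; exact: (cvgD (cu phi s) (cvgM (cvg_cst _) (cw psi s))).
move=> s; rewrite FE; under eq_fun do rewrite E /=.
have := dx phi s; have := dt psi s => d1 d2.
by apply: is_derive_eq.
Qed.

Lemma paste_pair (s0 : R) (x1 x2 : R -> V) (t1 t2 : R -> W) s :
  (paste s0 x1 x2 s, paste s0 t1 t2 s) = paste s0 (fun r => (x1 r, t1 r)) (fun r => (x2 r, t2 r)) s.
Proof. by rewrite /paste; case: ifP. Qed.

Lemma continuous_square (d : R -> R) : continuous d -> continuous (fun s => d s ^+ 2).
Proof. by move=> cd s; exact: (cvgM (cd s) (cd s)). Qed.

Lemma paste_L2 (U : vectType R) (s0 T : R) (g1 g2 : R -> U) :
  (forall phi : 'Hom(U, R^o), continuous (fun s => phi (g1 s) : R)) ->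
  (forall phi : 'Hom(U, R^o), continuous (fun s => phi (g2 s) : R)) ->
  L2 T (paste s0 g1 g2).
Proof.
move=> c1 c2 phi.
have E : (fun s => phi (paste s0 g1 g2 s) : R) = paste s0 (fun s => phi (g1 s)) (fun s => phi (g2 s)).
  by apply/funext => s; rewrite /paste; case: ifP.
rewrite E; split; first exact: measurable_paste.
have E2 s : (paste s0 (fun s => phi (g1 s) : R) (fun s => phi (g2 s)) s ^+ 2) =
   paste s0 (fun s => (phi (g1 s) : R) ^+ 2) (fun s => (phi (g2 s) : R) ^+ 2) s.
  by rewrite /paste; case: ifP.
have /integrableP[_] := integrable_paste s0 T (continuous_square (c1 phi)) (continuous_square (c2 phi)).
congr (_ < _)%E; apply: eq_integral => s _.
by rewrite /= -E2 ger0_norm ?sqr_ge0// (congr1 (fun f => f s) E).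
Qed.

Lemma paste_horizontal (s0 T : R) x1 t1 u1 x2 t2 u2 :
  smooth_horizontal x1 t1 u1 -> smooth_horizontal x2 t2 u2 ->
  0 <= s0 -> x1 s0 = x2 s0 -> t1 s0 = t2 s0 ->
  horizontal w T (fun s => (paste s0 x1 x2 s, paste s0 t1 t2 s)) (paste s0 u1 u2).
Proof.
move=> h1 h2 s00 Ex Et.
pose f1 s := horizontal_field w (u1 s) (x1 s, t1 s).
pose f2 s := horizontal_field w (u2 s) (x2 s, t2 s).
have fE s : paste s0 f1 f2 s =
    horizontal_field w (paste s0 u1 u2 s) (paste s0 x1 x2 s, paste s0 t1 t2 s).
  by rewrite /paste; case: ifP.
split.
- by case: h1 h2 => [c1 _ _ _] [c2 _ _ _]; exact: paste_L2.
- exists (paste s0 f1 f2).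
    by apply: paste_L2 => Phi; [have [] := smooth_horizontal_functional Phi h1
                              |have [] := smooth_horizontal_functional Phi h2].
  move=> Phi s /andP[hs _].
  have [c1 d1] := smooth_horizontal_functional Phi h1.
  have [c2 d2] := smooth_horizontal_functional Phi h2.
  have := paste_primitive c1 c2 d1 d2 s00 _ hs; rewrite Ex Et => /(_ erefl).
  have -> : (\int[mu]_(r in `[0%R, s]) paste s0 (fun s => Phi (f1 s) : R) (fun s => Phi (f2 s)) r)%R =
    (\int[mu]_(r in `[0%R, s]) (Phi (paste s0 f1 f2 r) : R))%R.
    by apply: eq_Rintegral => r _; rewrite /paste; case: ifP.
  move=> ->.
  have -> : Phi (paste s0 x1 x2 s, paste s0 t1 t2 s) =
     paste s0 (fun r => Phi (x1 r, t1 r) : R) (fun r => Phi (x2 r, t2 r)) s.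
    by rewrite paste_pair /paste; case: ifP.
  have -> : Phi (paste s0 x1 x2 0, paste s0 t1 t2 0) = Phi (x1 0, t1 0).
    by rewrite /paste s00.
  by rewrite addrC subrK.
- apply: ae_imply (ae_neq s0) => s ss0 _ Phi.
  have [c1 d1] := smooth_horizontal_functional Phi h1.
  have [c2 d2] := smooth_horizontal_functional Phi h2.
  rewrite -fE; have := paste_derive d1 d2 ss0.
  have -> : paste s0 (fun r => Phi (x1 r, t1 r) : R) (fun r => Phi (x2 r, t2 r)) =
    (fun r => Phi (paste s0 x1 x2 r, paste s0 t1 t2 r)).
    by apply/funext => r; rewrite paste_pair /paste; case: ifP.
  by rewrite [X in is_derive _ _ _ X -> _](_ : _ = Phi (paste s0 f1 f2 s))// /paste; case: ifP.
Qed.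

Lemma paste_same {A : Type} (s0 : R) (f : R -> A) : paste s0 f f = f.
Proof. by apply/funext => s; rewrite /paste; case: ifP. Qed.

Lemma smooth_is_horizontal (T : R) x t u : smooth_horizontal x t u ->
  horizontal w T (fun s => (x s, t s)) u.
Proof.
by move=> h; have := paste_horizontal T h h (lexx 0) erefl erefl; rewrite !paste_same.
Qed.

Hypothesis dimV : \dim {:V} = 3%N.

(** [d1] and [d2] majorize the speeds and have known antiderivatives, so the length estimate reduces
    to end values. *)
Lemma paste_length_le (s0 T : R) gamma u1 u2 (b1 b2 d1 d2 : R -> R) :
  horizontal w T gamma (paste s0 u1 u2) -> 0 <= s0 -> s0 <= T ->
  continuous d1 -> continuous d2 ->
  (forall s : R, is_derive s 1 b1 (d1 s)) -> (forall s : R, is_derive s 1 b2 (d2 s)) ->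
  (forall s, 0 <= s <= s0 -> vnorm ip (u1 s) <= d1 s) ->
  (forall s, s0 <= s <= T -> vnorm ip (u2 s) <= d2 s) ->
  (length ip T (paste s0 u1 u2) <= (b1 s0 - b1 0 + (b2 T - b2 s0))%:E)%E.
Proof.
move=> hor s00 s0T c1 c2 db1 db2 h1 h2.
rewrite (length_arclen ip dimV hor) lee_fin.
pose b2' s := b2 s + (b1 s0 - b2 s0).
have db2' s : is_derive s (1 : R) b2' (d2 s).
  by have := db2 s => d; apply: is_derive_eq; rewrite addr0.
have E : b1 s0 = b2' s0 by rewrite /b2'; ring.
have := paste_primitive c1 c2 db1 db2' s00 E (le_trans s00 s0T).
rewrite [X in _ = X - _ -> _](_ : _ = b2' T); last first.
  rewrite /paste; case: ifP => // Ts0.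
  by rewrite (_ : T = s0) ?E//; apply/eqP; rewrite eq_le Ts0.
move=> I; apply: (@le_trans _ _ (b2' T - b1 0)); last by rewrite /b2'; lra.
rewrite -I; apply: le_Rintegral => //.
- exact: (speed_integrable ip hor dimV).
- exact: integrable_paste.
move=> s; rewrite /= in_itv /= => /andP[hs0 hsT]; rewrite /paste; case: ifPn => hs.
  by apply: h1; rewrite hs0.
by apply: h2; rewrite hsT ltW// ltNge.
Qed.

(* The velocity determines the control almost everywhere. *)
Lemma length_control_unique (T : R) gamma u u' : 0 < T ->
  horizontal w T gamma u -> horizontal w T gamma u' -> length ip T u = length ip T u'.
Proof.
move=> T0 h h'.
have mn v : horizontal w T gamma v -> measurable_fun `[0, T] (EFin \o (fun s => vnorm ip (v s))).
  by move=> hv; have /integrableP[] := speed_integrable ip hv dimV.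
rewrite /length; apply: ae_eq_integral => //; [exact: (mn _ h) | exact: (mn _ h') |].
have [_ _ ae] := h; have [_ _ ae'] := h'.
have uu' : {ae mu, forall s, 0 < s < T -> u s = u' s}.
  move: ae ae'; apply: filterS2; first exact: (ae_filter_ringOfSetsType mu).
  move=> s vs vs' sT; apply: functional_eq => phi.
  have [Phi PhiE] : exists Phi : 'Hom((V * W)%type, R^o), forall p, Phi p = phi p.1 :=
    functional_fst phi.
  have [_ E] := vs sT Phi; have [_] := vs' sT Phi; rewrite E !PhiE /=.
  by [].
have uu'c : {ae mu, forall s, 0 <= s <= T -> u s = u' s}.
  move: uu' (ae_neq (0 : R)) (ae_neq T).
  apply: filterS3; first exact: (ae_filter_ringOfSetsType mu).
  move=> s us s0 sT /andP[h1 h2]; apply: us.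
  by rewrite !lt_neqAle h1 h2 !andbT eq_sym; apply/andP; split; apply/eqP.
apply: ae_imply uu'c => s us; rewrite /= in_itv /= => hs.
by rewrite us.
Qed.

(** Two quadratures: the base is a primitive of the control, and then the second layer is a
    primitive of an expression in the base and the control. *)
Lemma smooth_horizontal_unique (T : R) gamma x t u : 0 < T ->
  smooth_horizontal x t u -> gamma 0 = (x 0, t 0) -> horizontal w T gamma u ->
  forall s, 0 <= s <= T -> gamma s = (x s, t s).
Proof.
move=> T0 sh g0 hor; have hor' := smooth_is_horizontal T sh.
have [cu dx cw dt] := sh.
have xE s : 0 <= s <= T -> (gamma s).1 = x s.
  move=> hs; apply: functional_eq => phi.
  rewrite (horizontal_fst T0 hor phi hs) g0 /=.
  by have := horizontal_fst T0 hor' phi hs => /= ->.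
move=> s hs; rewrite [LHS]surjective_pairing xE//; congr (_, _).
apply: functional_eq => psi.
have [|_ ->] := horizontal_snd T0 hor (phi := psi) => //.
  apply: (@eq_measurable_fun _ _ _ _ _ (fun s => psi (w (x s) (u s)) : R)).
    by move=> r; rewrite inE /= in_itv /= => hr; rewrite xE.
  apply: measurable_funTS; exact: continuous_measurable_fun.
rewrite g0 /=; have /andP[s0 sT] := hs.
have dt' r : is_derive r (1 : R) (fun r => psi (t r) : R) (2^-1 * psi (w (x r) (u r))) := dt psi r.
have cd : continuous (fun r => 2^-1 * psi (w (x r) (u r)) : R).
  by move=> r; exact: (cvgM (cvg_cst _) (cw psi r)).
rewrite (_ : (\int[mu]_(r in `[0%R, s]) _)%R =
   (\int[mu]_(r in `[0%R, s]) (2^-1 * psi (w (x r) (u r)) : R))%R).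
  by rewrite (smooth_FTC s0 cd dt') addrC subrK.
apply: eq_Rintegral => r; rewrite inE /= in_itv /= => /andP[r0 rs].
by rewrite xE// r0 (le_trans rs).
Qed.

End SmoothCurves.

Section Perturbation.
Context {R : realType} {V W : vectType R} (ip : {dot V for idfun}).
Context (w : {bilinear V -> V -> W}).
Hypothesis extW : is_exterior_square w.

Lemma functionalD (U : vectType R) (t : 'Hom(U, R^o)) x y : t (x + y) = t x + t y :> R.
Proof. by rewrite linearD. Qed.
Lemma functionalB (U : vectType R) (t : 'Hom(U, R^o)) x y : t (x - y) = t x - t y :> R.
Proof. by rewrite linearB. Qed.
Lemma functionalN (U : vectType R) (t : 'Hom(U, R^o)) x : t (- x) = - t x :> R.
Proof. by rewrite linearN. Qed.
Lemma functionalZ (U : vectType R) (t : 'Hom(U, R^o)) a x : t (a *: x) = a * t x :> R.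
Proof. by rewrite linearZ. Qed.
Definition functionalE := (functionalD, functionalB, functionalN, functionalZ).

Lemma wedge_left (psi : 'Hom(W, R^o)) v :
  exists phi : 'Hom(V, R^o), forall x, phi x = psi (w x v).
Proof. by apply: lfun_exists => a x y; rewrite wDl wZl linearP. Qed.

Lemma wedge_right (psi : 'Hom(W, R^o)) v :
  exists phi : 'Hom(V, R^o), forall x, phi x = psi (w v x).
Proof. by apply: lfun_exists => a x y; rewrite wDr wZr linearP. Qed.

Lemma smooth_horizontal_lfun (rot : 'Hom(V, V)) (rotW : 'Hom(W, W)) x t u :
  (forall p q, rotW (w p q) = w (rot p) (rot q)) -> smooth_horizontal w x t u ->
  smooth_horizontal w (fun s => rot (x s)) (fun s => rotW (t s)) (fun s => rot (u s)).
Proof.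
move=> rotE [cu dx cw dt]; split.
- by move=> phi; have := cu (phi \o rot)%VF; under eq_fun do rewrite comp_lfunE.
- move=> phi s; have := dx (phi \o rot)%VF s; rewrite comp_lfunE.
  by under eq_fun do rewrite comp_lfunE.
- move=> psi; have := cw (psi \o rotW)%VF.
  by under eq_fun do rewrite comp_lfunE rotE.
- move=> psi s; have := dt (psi \o rotW)%VF s; rewrite comp_lfunE rotE.
  by under eq_fun do rewrite comp_lfunE.
Qed.

(* The closed variation [eps phi w0] of the base curve changes the second layer
   by [eps w0 /\ int phi u] only, since [w0 /\ w0 = 0]. *)
Lemma smooth_horizontal_perturb x t u (phi phi1 : R -> R) (Th : R -> V) (eps : R) (w0 : V) :
  smooth_horizontal w x t u -> continuous phi1 ->
  (forall s : R, is_derive s 1 phi (phi1 s)) ->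
  (forall (f : 'Hom(V, R^o)) (s : R),
    is_derive s (1 : R) (fun r => f (Th r) : R) (phi s * f (u s))) ->
  smooth_horizontal w (fun s => x s + (eps * phi s) *: w0)
    (fun s => t s + (2^-1 * eps * phi s) *: w (x s) w0 + eps *: w w0 (Th s))
    (fun s => u s + (eps * phi1 s) *: w0).
Proof.
move=> [cu dx cw dt] cphi1 dphi dTh.
have cphi s : {for s, continuous phi} := is_derive_continuous (dphi s).
have cx (f : 'Hom(V, R^o)) (s : R) : {for s, continuous (fun s => f (x s) : R)}.
  exact: is_derive_continuous (dx f s).
split.
- move=> f s; under eq_fun do rewrite !functionalE.
  exact: (cvgD (cu f s) (cvgM (cvgM (cvg_cst _) (cphi1 s)) (cvg_cst _))).
- move=> f s; rewrite !functionalE; under eq_fun do rewrite !functionalE.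
  have := dx f s; have := dphi s => d1 d2.
  by apply: is_derive_eq; rewrite /GRing.scale /=; ring.
- move=> psi s.
  have [f fE] := wedge_left psi w0; have [g gE] := wedge_right psi w0.
  have E r : psi (w (x r + (eps * phi r) *: w0) (u r + (eps * phi1 r) *: w0)) =
     psi (w (x r) (u r)) + (eps * phi1 r) * f (x r) + (eps * phi r) * g (u r) :> R.
    rewrite fE gE !(wE w) (wxx extW) !scaler0 addr0 !functionalE.
    by ring.
  under eq_fun do rewrite E.
  exact: (cvgD (cvgD (cw psi s) (cvgM (cvgM (cvg_cst _) (cphi1 s)) (cx f s)))
    (cvgM (cvgM (cvg_cst _) (cphi s)) (cu g s))).
- move=> psi s.
  have [f fE] := wedge_left psi w0; have [g gE] := wedge_right psi w0.
  have -> : 2^-1 * psi (w (x s + (eps * phi s) *: w0) (u s + (eps * phi1 s) *: w0)) =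
     2^-1 * (psi (w (x s) (u s)) + (eps * phi1 s) * f (x s) + (eps * phi s) * g (u s)) :> R.
    congr (_ * _); rewrite fE gE !(wE w) (wxx extW) !scaler0 addr0 !functionalE.
    by ring.
  under eq_fun do rewrite !functionalE -fE -gE.
  have := dt psi s; have := dx f s; have := dTh g s; have := dphi s => d1 d2 d3 d4.
  apply: is_derive_eq; rewrite /GRing.scale /=.
  have -> : f (u s) = - g (u s) :> R by rewrite fE gE (wC extW) functionalE.
  by field.
Qed.

End Perturbation.

(** * Extremals and their cut time *)

Section ExplicitExtremal.
Context {R : realType} {V W : vectType R} (ip : {dot V for idfun}).
Context (w : {bilinear V -> V -> W}).
Hypothesis extW : is_exterior_square w.
Variables (lam : R) (a b z : V).

Definition ext_u s : V := cos (lam * s) *: a + sin (lam * s) *: b + z.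
Definition ext_u1 s : V := (- lam * sin (lam * s)) *: a + (lam * cos (lam * s)) *: b.
Definition ext_x s : V :=
  (sin (lam * s) / lam) *: a + ((1 - cos (lam * s)) / lam) *: b + s *: z.
Definition ext_t s : W :=
  ((lam * s - sin (lam * s)) / (2 * lam ^+ 2)) *: w a b
  + ((1 - cos (lam * s)) / lam ^+ 2 - s * sin (lam * s) / (2 * lam)) *: w a z
  + (s * (1 + cos (lam * s)) / (2 * lam) - sin (lam * s) / lam ^+ 2) *: w b z.

Lemma wedge3 (p1 p2 p3 q1 q2 q3 : R) :
  w (p1 *: a + p2 *: b + p3 *: z) (q1 *: a + q2 *: b + q3 *: z) =
  (p1 * q2 - p2 * q1) *: w a b + (p1 * q3 - p3 * q1) *: w a z
  + (p2 * q3 - p3 * q2) *: w b z.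
Proof.
apply: functional_eq => psi.
rewrite !(wE w) !(wxx extW) (wC extW a b) (wC extW a z) (wC extW b z).
rewrite !scaler0 !functionalE !linear0; ring.
Qed.

Lemma ext_smooth : lam != 0 -> smooth_horizontal w ext_x ext_t ext_u.
Proof.
move=> l0; split.
- move=> phi s; apply: (is_derive_continuous (d := phi (ext_u1 s))).
  rewrite /ext_u; under eq_fun do rewrite !functionalE.
  by apply: is_derive_eq; rewrite /ext_u1 !functionalE /GRing.scale /=; ring.
- move=> phi s; rewrite /ext_x; under eq_fun do rewrite !functionalE.
  by apply: is_derive_eq; rewrite /ext_u !functionalE /GRing.scale /=; field.
- move=> psi s.
  have wu r : w (ext_x r) (ext_u r) = w (ext_x r)
     (cos (lam * r) *: a + sin (lam * r) *: b + 1 *: z) by rewrite scale1r.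
  under eq_fun do rewrite wu /ext_x wedge3 !functionalE.
  set f := fun r : R => _.
  have [d df] : exists d : R, is_derive s (1 : R) f d.
    by eexists; rewrite /f; apply: is_derive_eq.
  exact: is_derive_continuous df.
- move=> psi s.
  have -> : w (ext_x s) (ext_u s) = w (ext_x s)
     (cos (lam * s) *: a + sin (lam * s) *: b + 1 *: z) by rewrite scale1r.
  rewrite /ext_x wedge3 /ext_t; under eq_fun do rewrite !functionalE.
  rewrite !functionalE.
  apply: is_derive_eq; rewrite /GRing.scale /=.
  have := cos2Dsin2 (lam * s) => E.
  have -> : sin (lam * s) / lam * sin (lam * s) - (1 - cos (lam * s)) / lam * cos (lam * s) =
     (1 - cos (lam * s)) / lam.
    have -> : sin (lam * s) / lam * sin (lam * s) = (1 - cos (lam * s) ^+ 2) / lam.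
      by rewrite -E; field.
    by field.
  by field.
Qed.

Lemma ext_x0 : ext_x 0 = 0.
Proof. by rewrite /ext_x mulr0 sin0 cos0 !(subrr, mul0r, scale0r, addr0). Qed.

Lemma ext_t0 : ext_t 0 = 0.
Proof. by rewrite /ext_t mulr0 sin0 cos0 !(subrr, mul0r, scale0r, addr0). Qed.

(** [a'] is the rotating part of the control at half time and [b'] its quarter-turn. In this frame
    [b'] drops out of the base point and factors out of the second layer. *)
Lemma ext_endpoint s0 : lam != 0 -> s0 != 0 -> let th := lam * s0 / 2 in
  let a' := cos th *: a + sin th *: b in let b' := - sin th *: a + cos th *: b in
  [/\ ext_u s0 = cos th *: a' + sin th *: b' + z,
      ext_x s0 = s0 *: ((sin th / th) *: a' + z) &
      ext_t s0 = (s0 ^+ 2 / (4 * th ^+ 2)) *: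
         w (cutp th *: a' + (2 * cutM th) *: z) b'].
Proof.
move=> l0 s00 th a' b'.
have E2 : lam * s0 = th *+ 2 by rewrite /th mulr2n; field.
have lE : lam = 2 * th / s0 by rewrite /th; field.
have th0 : th != 0 by rewrite /th !mulf_neq0.
have cs := cos2Dsin2 th.
have sE : sin (lam * s0) = 2 * sin th * cos th by rewrite E2 sin_mulr2n mulr2n; ring.
have cE : cos (lam * s0) = 1 - 2 * sin th ^+ 2.
  by rewrite E2 cos_mulr2n mulr2n; lra.
split.
- apply: functional_eq => phi; rewrite /ext_u sE cE /a' /b' !functionalE.
  have -> : 1 - 2 * sin th ^+ 2 = cos th ^+ 2 - sin th ^+ 2 by lra.
  by ring.
- apply: functional_eq => phi; rewrite /ext_x sE cE /a' !functionalE lE.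
  by field; rewrite th0.
- have -> : cutp th *: a' + (2 * cutM th) *: z =
     (cutp th * cos th) *: a + (cutp th * sin th) *: b + (2 * cutM th) *: z.
    by rewrite /a' scalerDr !scalerA.
  have -> : b' = (- sin th) *: a + cos th *: b + 0 *: z by rewrite scale0r addr0.
  rewrite wedge3 /ext_t sE cE.
  apply: functional_eq => psi; rewrite !functionalE lE /cutp /cutM.
  have -> : 1 + (1 - 2 * sin th ^+ 2) = 2 * cos th ^+ 2 by lra.
  have -> : (th - sin th * cos th) * cos th * cos th - (th - sin th * cos th) * sin th * - sin th
    = th - sin th * cos th.
    rewrite -[RHS]mul1r -cs; ring.
  by field; rewrite s00 th0.
Qed.

Hypothesis orth : [/\ ip a b = 0, ip a z = 0 & ip b z = 0].
Hypothesis ab : ip a a = ip b b.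

Lemma ext_speed s : ip (ext_u s) (ext_u s) = ip a a + ip z z.
Proof.
case: orth => hab az bz.
rewrite /ext_u !ipE (ipC ip b a) (ipC ip z a) (ipC ip z b) hab az bz -ab.
rewrite -[ip a a in RHS]mul1r -(cos2Dsin2 (lam * s)); ring.
Qed.

Lemma ext_speed0 s : vnorm ip (ext_u s) = Num.sqrt (ip a a + ip z z).
Proof. by rewrite /vnorm ext_speed. Qed.

End ExplicitExtremal.

(** * Shortening a corner with the endpoint fixed *)

Section CornerCutting.
Context {R : realType} {V W : vectType R} (ip : {dot V for idfun}).
Context (w : {bilinear V -> V -> W}).
Hypothesis dimV : \dim {:V} = 3%N.
Hypothesis extW : is_exterior_square w.
Variables (lam : R) (a b z : V).
Hypothesis lam0 : lam != 0.
Hypothesis orth : [/\ ip a b = 0, ip a z = 0 & ip b z = 0].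
Hypothesis ab : ip a a = ip b b.
Let kap := Num.sqrt (ip a a + ip z z).
Hypothesis kap0 : 0 < kap.

Local Notation u := (ext_u lam a b z).
Local Notation u1 := (ext_u1 lam a b).
Local Notation x := (ext_x lam a b z).
Local Notation t := (ext_t w lam a b z).

Section Bump.
Variable P : {poly R}.
Let D1 := P^`(). Let D2 := D1^`(). Let D3 := D2^`(). Let D4 := D3^`().

(* [chi''' + lam^2 chi'] with [chi = P]: this operator annihilates constants
   and the trigonometric functions of frequency [lam] when moved to the other
   factor, so that the antiderivative of [bump * u] is explicit. *)
Definition bump s := D3.[s] + lam ^+ 2 * D1.[s].
Definition bump' s := D4.[s] + lam ^+ 2 * D2.[s].

Lemma is_derive_bump (s : R) : is_derive s 1 bump (bump' s).
Proof. by apply: is_derive_eq. Qed.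

Lemma bump'_continuous : continuous bump'.
Proof.
by move=> s; apply: (is_derive_continuous (d := D4^`().[s] + lam ^+ 2 * D3.[s])).
Qed.

Definition bump_u s : V := D2.[s] *: u s - D1.[s] *: u1 s + (lam ^+ 2 * P.[s]) *: z.

Lemma is_derive_bump_u (f : 'Hom(V, R^o)) (s : R) :
  is_derive s (1 : R) (fun r => f (bump_u r) : R) (bump s * f (u s)).
Proof.
rewrite /bump_u /ext_u /ext_u1 !functionalE.
under eq_fun do rewrite !functionalE.
by apply: is_derive_eq; rewrite /GRing.scale /= /bump -/D1 -/D2 -/D3; ring.
Qed.

Definition bump'_u (f : 'Hom(V, R^o)) s : R :=
  bump s * f (u s) - D2.[s] * f (u1 s) - lam ^+ 2 * D1.[s] * (f (u s) - f z).

Lemma is_derive_bump'_u (f : 'Hom(V, R^o)) (s : R) :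
  is_derive s (1 : R) (bump'_u f) (bump' s * f (u s)).
Proof.
have := is_derive_bump s => db.
rewrite /bump'_u /ext_u /ext_u1 !functionalE.
under eq_fun do rewrite !functionalE.
by apply: is_derive_eq; rewrite /GRing.scale /= /bump /bump' -/D1 -/D2 -/D3; ring.
Qed.

Lemma deriv_factor k (c : R) (Q : {poly R}) :
  (('X - c%:P) ^+ k.+1 * Q)^`()%R =
  ('X - c%:P) ^+ k * (Q *+ k.+1 + ('X - c%:P) * Q^`()%R).
Proof.
rewrite derivM deriv_exp derivXsubC mul1r /= mulrDr mulrnAl mulrnAr.
by rewrite mulrA -exprSr.
Qed.

(** A triple zero kills [P] and its first two derivatives at [c] and leaves the third equal to 3!
    [Q.[c]]. *)
Lemma bump_vanish (c : R) (Q : {poly R}) : P = ('X - c%:P) ^+ 3 * Q ->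
  [/\ bump_u c = 0, bump c = 6 * Q.[c] &
      forall f, bump'_u f c = bump c * f (u c)].
Proof.
move=> PE.
have h0 : P.[c] = 0 by rewrite PE !hornerE subrr expr0n mul0r.
have D1E := deriv_factor 2 c Q; rewrite -PE -/D1 in D1E.
have D2E := deriv_factor 1 c (Q *+ 3 + ('X - c%:P) * Q^`()); rewrite -D1E -/D2 in D2E.
move: D2E; set Q1 := Q *+ 3 + _; move=> D2E.
have D3E := deriv_factor 0 c (Q1 *+ 2 + ('X - c%:P) * Q1^`()); rewrite -D2E -/D3 in D3E.
have h1 : D1.[c] = 0 by rewrite D1E hornerM horner_exp hornerXsubC subrr expr0n mul0r.
have h2 : D2.[c] = 0 by rewrite D2E hornerM horner_exp hornerXsubC subrr expr0n mul0r.
have h3 : D3.[c] = 6 * Q.[c].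
  rewrite D3E expr0 mul1r mulr1n hornerD hornerM hornerXsubC subrr mul0r addr0.
  rewrite hornerD hornerM hornerXsubC subrr mul0r addr0 hornerMn.
  rewrite /Q1 hornerD hornerM hornerXsubC subrr mul0r addr0 hornerMn.
  by rewrite -mulrnA mulr_natl.
split; first by rewrite /bump_u h0 h1 h2 !mulr0 !scale0r subrr addr0.
  by rewrite /bump h1 h3 mulr0 addr0.
by move=> f; rewrite /bump'_u h1 h2; ring.
Qed.

End Bump.

Lemma sqrt_le_linear (k d : R) (v : V) : 0 < k -> ip v v = k ^+ 2 + 2 * d ->
  vnorm ip v <= k + d / k.
Proof.
move=> k0 E; have := ip_ge0 ip v; rewrite E => h.
have kd : 0 <= k + d / k.
  rewrite -(pmulr_lge0 _ k0) mulrDl divfK ?gt_eqF//.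
  by have := sqr_ge0 k; nra.
rewrite -(@ler_pXn2r _ 2) ?nnegrE ?vnorm_ge0// vnorm_sqr E.
have -> : (k + d / k) ^+ 2 = k ^+ 2 + 2 * d + (d / k) ^+ 2 by field; rewrite gt_eqF.
by rewrite lerDl sqr_ge0.
Qed.

Lemma corner_shortcut (s0 s1 : R) (rot : 'Hom(V, V)) (rotW : 'Hom(W, W)) :
  0 < s0 -> s0 < s1 ->
  (forall p q, rotW (w p q) = w (rot p) (rot q)) ->
  (forall v, ip (rot v) (rot v) = ip v v) ->
  rot (x s0) = x s0 -> rotW (t s0) = t s0 -> rot (u s0) != u s0 ->
  (dist ip w 0%R (x s1, t s1) < (kap * s1)%:E)%E.
Proof.
move=> s00 s01 rotE iso rx rt ru.
(* Order 4 at 0 and [s1] makes both the variation and its integral against the control vanish there,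
   preserving the ends. Order 3 at [s0] keeps the integral zero, so the two pieces still meet, but
   lets the corner move. The even exponents make [bump P s0] positive. *)
pose P : {poly R} := ('X - 0%:P) ^+ 4 * ('X - s0%:P) ^+ 3 * ('X - s1%:P) ^+ 4.
have vanish c Q : P = ('X - c%:P) ^+ 3 * (('X - c%:P) * Q) ->
    [/\ bump_u P c = 0, bump P c = 0 & forall f, bump'_u P f c = 0].
  move=> /bump_vanish[-> E E'].
  have {}E : bump P c = 0 by rewrite E hornerM hornerXsubC subrr mul0r mulr0.
  by split => // f; rewrite E' E mul0r.
have [b0u b0 b0'] : [/\ bump_u P 0 = 0, bump P 0 = 0 & forall f, bump'_u P f 0 = 0].
  by apply: (vanish _ (('X - s0%:P) ^+ 3 * ('X - s1%:P) ^+ 4)); rewrite /P; ring.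
have [b1u b1 b1'] : [/\ bump_u P s1 = 0, bump P s1 = 0 & forall f, bump'_u P f s1 = 0].
  by apply: (vanish _ (('X - 0%:P) ^+ 4 * ('X - s0%:P) ^+ 3)); rewrite /P; ring.
have [bsu bs bs'] := @bump_vanish P s0 (('X - 0%:P) ^+ 4 * ('X - s1%:P) ^+ 4)
  ltac:(rewrite /P; ring).
have bs0 : 0 < bump P s0.
  rewrite bs hornerM !horner_exp !hornerXsubC subr0.
  apply: mulr_gt0 => //; apply: mulr_gt0; first exact: exprn_gt0.
  by rewrite exprn_even_gt0//= subr_eq0 lt_eqF.
pose J := rot (u s0) - u s0.
have J0 : 0 < ip J J by rewrite ip_gt0// subr_eq0.
(* The first variation of length is proportional to [ip J w0], with [J] the incoming minus the
   outgoing velocity; moving the corner along [- J] shortens. *)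
have [w0 w0E] : exists w0, w0 = - J by exists (- J).
have [C C0 CP] : exists2 C, 0 <= C & forall s, 0 <= s <= s1 -> bump' P s ^+ 2 <= C.
  have cb : {within `[0, s1], continuous (fun s => bump' P s ^+ 2)}.
    by apply: continuous_subspaceT; exact: (continuous_square (@bump'_continuous P)).
  have [c _ cP] := @EVT_max _ _ 0 s1 (ltW (lt_trans s00 s01)) cb.
  exists (bump' P c ^+ 2); first exact: sqr_ge0.
  by move=> s hs; apply: cP; rewrite in_itv.
(* Small enough that [eps * (C * s1) < bump P s0]: the second-order cost is then less than half of
   the first-order gain. *)
pose eps := bump P s0 / (C * s1 + 1).
have s10 : 0 < s1 by rewrite (lt_trans s00).
have Cs : 0 <= C * s1 by rewrite mulr_ge0// ltW.
have eps0 : 0 < eps by rewrite divr_gt0//; lra.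
have sm := ext_smooth extW a b z lam0.
have smr := smooth_horizontal_lfun rotE sm.
have dbu (f : 'Hom(V, R^o)) (s : R) := is_derive_bump_u P f s.
have dbur (f : 'Hom(V, R^o)) (s : R) :
    is_derive s (1 : R) (fun r => f (rot (bump_u P r)) : R) (bump P s * f (rot (u s))).
  have := is_derive_bump_u P (f \o rot)%VF s; rewrite comp_lfunE.
  by under eq_fun do rewrite comp_lfunE.
have sm2 := smooth_horizontal_perturb extW eps w0 sm (@bump'_continuous P) (@is_derive_bump P) dbu.
have sm1 := smooth_horizontal_perturb extW eps w0 smr (@bump'_continuous P) (@is_derive_bump P) dbur.
have hor := paste_horizontal s1 sm1 sm2 (ltW s00).
have {}hor := hor ltac:(by rewrite rx) ltac:(by rewrite rx rt bsu linear0).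
have [f fE] := functional_ip ip w0.
have speed (v : V) s : ip v v = kap ^+ 2 -> 0 <= s <= s1 ->
    vnorm ip (v + (eps * bump' P s) *: w0) <=
    kap + eps / kap * (bump' P s * ip v w0) + eps ^+ 2 * (C * ip w0 w0 / (2 * kap)).
  move=> vv hs.
  pose d := eps * bump' P s * ip v w0 + 2^-1 * (eps * bump' P s) ^+ 2 * ip w0 w0.
  apply: (@le_trans _ _ (kap + d / kap)).
    by apply: sqrt_le_linear => //; rewrite !ipE vv (ipC ip w0 v) /d; field.
  rewrite -addrA lerD2l.
  have -> : eps / kap * (bump' P s * ip v w0) + eps ^+ 2 * (C * ip w0 w0 / (2 * kap)) =
     (eps * bump' P s * ip v w0 + 2^-1 * eps ^+ 2 * C * ip w0 w0) / kap.
    by field; rewrite gt_eqF.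
  rewrite ler_pM2r ?invr_gt0// lerD2l ler_wpM2r ?ip_ge0//.
  rewrite exprMn mulrA; apply: ler_wpM2l; last exact: CP.
  by rewrite mulr_ge0 ?sqr_ge0 ?invr_ge0.
pose K := eps ^+ 2 * (C * ip w0 w0 / (2 * kap)).
pose dd (g : 'Hom(V, R^o)) s := kap + eps / kap * (bump' P s * g (u s)) + K.
pose bb (g : 'Hom(V, R^o)) s := kap * s + eps / kap * bump'_u P g s + K * s.
have dbb g (s : R) : is_derive s 1 (bb g) (dd g s).
  have := is_derive_bump'_u P g s => d.
  by rewrite /bb /dd; apply: is_derive_eq; rewrite /GRing.scale /=; ring.
have cdd g : continuous (dd g).
  case: sm => cu _ _ _ s.
  exact: (cvgD (cvgD (cvg_cst _) (cvgM (cvg_cst _) (cvgM (@bump'_continuous P s) (cu g s)))) (cvg_cst _)).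
have kap2 : kap ^+ 2 = ip a a + ip z z by rewrite sqr_sqrtr ?addr_ge0 ?ip_ge0.
have uu s : ip (u s) (u s) = kap ^+ 2 by rewrite (ext_speed _ orth ab) kap2.
have L := @paste_length_le _ _ _ ip w dimV s0 s1 _ _ _ (bb (f \o rot)%VF) (bb f)
  (dd (f \o rot)%VF) (dd f) hor (ltW s00) (ltW s01) (cdd _) (cdd _) (dbb _) (dbb _).
have {}L := L _ _.
apply: (@le_lt_trans _ _ (length ip s1 (paste s0 (fun s => rot (u s) + (eps * bump' P s) *: w0)
    (fun s => u s + (eps * bump' P s) *: w0)))).
  apply: ereal_inf_lbound; exists s1.
  eexists; eexists; split; [exact: s10 | exact: hor | | | by []].
  - rewrite /paste (ltW s00) b0 b0u ext_x0 ext_t0.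
    by rewrite !(linear0, mulr0, scale0r, w0r, scaler0, addr0).
  - rewrite /paste leNgt s01 /= b1 b1u.
    by rewrite !(mulr0, scale0r, w0r, scaler0, addr0).
apply: le_lt_trans (L _ _) _.
- move=> s /andP[hs0 hs1]; rewrite /dd comp_lfunE fE.
  apply: speed; first by rewrite iso.
  by rewrite hs0 (le_trans hs1)// ltW.
- move=> s /andP[hs0 hs1]; rewrite /dd fE.
  by apply: speed => //; rewrite hs1 andbT (le_trans _ hs0)// ltW.
rewrite lte_fin /bb !b0' !b1' !bs' comp_lfunE !fE.
have -> : kap * s0 + eps / kap * (bump P s0 * ip (rot (u s0)) w0) + K * s0 -
  (kap * 0 + eps / kap * 0 + K * 0) +
  (kap * s1 + eps / kap * 0 + K * s1 -
   (kap * s0 + eps / kap * (bump P s0 * ip (u s0) w0) + K * s0)) =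
  kap * s1 + (eps / kap * bump P s0 * ip J w0 + K * s1) by rewrite /J ipBl; ring.
have Jw : ip J w0 = - ip J J by rewrite w0E ipNr.
have ww : ip w0 w0 = ip J J by rewrite w0E ipNl ipNr opprK.
rewrite gtrDl /K Jw ww.
have -> : eps / kap * bump P s0 * - ip J J + eps ^+ 2 * (C * ip J J / (2 * kap)) * s1 =
  (eps * ip J J / kap) * (eps * (C * s1) / 2 - bump P s0) by field; rewrite gt_eqF.
have c0 : 0 < eps * ip J J / kap by apply: divr_gt0 => //; exact: mulr_gt0.
rewrite (pmulr_rlt0 _ c0) subr_lt0.
have : eps * (C * s1) + eps = bump P s0 by rewrite /eps; field; lra.
have : 0 <= eps * (C * s1) by rewrite mulr_ge0// ltW.
lra.
Qed.
End CornerCutting.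

(** * Cut time of a nonstraight extremal *)

Section CutTime.
Context {R : realType} {V W : vectType R} (ip : {dot V for idfun}).
Context (w : {bilinear V -> V -> W}).
Local Notation mu := (@lebesgue_measure R).
Hypothesis dimV : \dim {:V} = 3%N.
Hypothesis extW : is_exterior_square w.

Lemma length_constant_speed (T k : R) (u : R -> V) : 0 <= T ->
  (forall s, vnorm ip (u s) = k) -> length ip T u = (k * T)%:E.
Proof.
move=> T0 uk; rewrite /length; under eq_integral do rewrite uk.
rewrite integral_cst//= lebesgue_measure_itv /= lte_fin.
case: ifPn => [_|]; first by rewrite oppr0 adde0 -EFinM.
rewrite -leNgt => T0'; have -> : T = 0 by apply/eqP; rewrite eq_le T0'.
by rewrite mulr0 mule0.
Qed.

Lemma ext_horizontal_unique (lam : R) (a b z : V) (gamma : R -> V * W) :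
  lam != 0 -> gamma 0 = 0 ->
  (forall T, 0 < T -> horizontal w T gamma (ext_u lam a b z)) ->
  forall s, 0 <= s -> gamma s = (ext_x lam a b z s, ext_t w lam a b z s).
Proof.
move=> l0 g0 hor s s0.
have T0 : 0 < s + 1 by lra.
apply: (smooth_horizontal_unique T0 (ext_smooth extW a b z l0) _ (hor _ T0)).
  by rewrite g0 ext_x0 ext_t0.
by lra.
Qed.

Section OneExtremal.
Variables (lam : R) (a b z : V) (th : R).
Hypothesis lam0 : 0 < lam.
Hypothesis orth : [/\ ip a b = 0, ip a z = 0 & ip b z = 0].
Hypothesis ab : ip a a = ip b b.
Hypothesis a0 : 0 < ip a a.
Hypothesis rth : cut_range th.
(** The left side is [th] times [ip X Y] for the vectors below: the base point is orthogonal to the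
    support. *)
Hypothesis cut_eq : sin th * cutp th * ip a a + 2 * th * cutM th * ip z z = 0.

(** Tied by equations rather than defined, so that the construction of an extremal from a given
    point can supply its own vectors. *)
Variables (s0 : R) (a' b' X Y y : V).
Hypothesis s0E : s0 = 2 * th / lam.
Hypothesis a'E : a' = cos th *: a + sin th *: b.
Hypothesis b'E : b' = - sin th *: a + cos th *: b.
Hypothesis XE : X = (sin th / th) *: a' + z.
Hypothesis YE : Y = cutp th *: a' + (2 * cutM th) *: z.
Hypothesis yE : y = (s0 ^+ 2 / (4 * th ^+ 2)) *: Y.

Lemma cut_angle_gt0 : 0 < th.
Proof. by have [? _ _ _ _] := cut_bounds (cut_rangeW rth); lra. Qed.

Lemma cut_time_gt0 : 0 < s0.
Proof. by rewrite s0E divr_gt0// mulr_gt0// cut_angle_gt0. Qed.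

Lemma cut_frame : [/\ ip a' a' = ip a a, ip b' b' = ip a a, ip a' b' = 0,
  ip a' z = 0 & ip b' z = 0].
Proof.
have [hab az bz] := orth; have cs := cos2Dsin2 th.
have ba : ip b a = 0 by rewrite ipC.
rewrite a'E b'E !ipE hab ba az bz -ab; split; try ring.
- by rewrite -[RHS]mul1r -cs; ring.
- by rewrite -[RHS]mul1r -cs; ring.
Qed.

Lemma cut_point : ext_u lam a b z s0 = cos th *: a' + sin th *: b' + z /\
  (ext_x lam a b z s0, ext_t w lam a b z s0) =
  (s0 *: X, w y b').
Proof.
have := ext_endpoint extW a b z (lt0r_neq0 lam0) (lt0r_neq0 cut_time_gt0).
have -> : lam * s0 / 2 = th by rewrite s0E; field; rewrite gt_eqF.
by cbv zeta; rewrite -a'E -b'E -XE -YE; move=> [-> -> ->]; split => //; rewrite yE (wZl w).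
Qed.

Lemma cut_orthogonal : [/\ ip X Y = 0, ip X b' = 0, ip Y b' = 0 & 0 < ip Y Y].
Proof.
have [aa bb hab az bz] := cut_frame.
have za : ip z a' = 0 by rewrite ipC.
have zb : ip z b' = 0 by rewrite ipC.
have t0 := cut_angle_gt0.
rewrite XE YE !ipE aa az za hab zb; split; try ring.
- rewrite !(mulr0, addr0, add0r).
  have -> : cutp th * (sin th / th * ip a a) + 2 * cutM th * ip z z =
    (sin th * cutp th * ip a a + 2 * th * cutM th * ip z z) / th.
    by field; rewrite gt_eqF.
  by rewrite cut_eq mul0r.
- have p0 := cutp_gt0 (cut_rangeW rth).
  have : 0 < cutp th * (cutp th * ip a a) by rewrite !mulr_gt0.
  have : 0 <= 2 * cutM th * (2 * cutM th * ip z z).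
    by rewrite mulrA mulr_ge0 ?ip_ge0// -expr2 sqr_ge0.
  lra.
Qed.

Lemma cut_axis : exists n, [/\ ip n n = 1, ip Y n = 0, ip b' n = 0 & X = ip X n *: n].
Proof.
have [XY Xb Yb Y0] := cut_orthogonal; have [_ bb _ _ _] := cut_frame.
have [n [nn nY nb]] := orthogonal_unit_exists ip dimV Y b'.
exists n; rewrite (ipC ip Y) (ipC ip b'); split => //.
have nzY : vnorm ip Y != 0 by rewrite /vnorm sqrtr_eq0 -ltNge.
have nzb : vnorm ip b' != 0 by rewrite /vnorm sqrtr_eq0 -ltNge bb.
have O : orthonormal3 ip ((vnorm ip Y)^-1 *: Y) ((vnorm ip b')^-1 *: b') n.
  split => //.
  - by rewrite !ipE -vnorm_sqr; field.
  - by rewrite !ipE -vnorm_sqr; field.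
  - by split; rewrite !ipE ?Yb ?(ipC ip Y) ?(ipC ip b') ?nY ?nb ?mulr0.
by rewrite {1}(orthonormal3_expand dimV O X) !ipE XY Xb !mulr0 !scale0r !add0r.
Qed.

Let kap2 := ip a a + ip z z.

(** With [tau] the norm of the second layer and [h2] the squared norm of the base, the extremal
    satisfies the relation required by the lower bound, and the bound equals its squared length. *)
Lemma cut_values (tau h2 : R) : 0 <= tau ->
  tau ^+ 2 = (s0 ^+ 2 / (4 * th ^+ 2)) ^+ 2 * ip Y Y * ip b' b' ->
  h2 = s0 ^+ 2 * ip X X ->
  h2 = 2 * tau * cutB th /\
  h2 * (1 + cutq th) + 2 * tau * Num.sqrt (cutg th) = kap2 * s0 ^+ 2.
Proof.
move=> tau0 tauE h2E; have t0 := cut_angle_gt0; have /and3P[_ _ M0] := rth.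
have p0 := cutp_gt0 (cut_rangeW rth); have V0 := cutV_gt0 (cut_rangeW rth).
have g0 := cutg_gt0 (cut_rangeW rth).
have [aa bb hab az bz] := cut_frame.
have za : ip z a' = 0 by rewrite ipC.
(* [cut_eq] fixes the ratio of [ip a a] to [ip z z]; the common factor [k] expresses both through
   functions of [th]. *)
pose k := ip a a / (2 * th * cutM th).
have k0 : 0 < k by rewrite divr_gt0// !mulr_gt0.
have AE : ip a a = 2 * th * cutM th * k by rewrite /k; field; rewrite !gt_eqF.
have ZE : ip z z = - (sin th * cutp th * k).
  apply: (mulfI (lt0r_neq0 (mulr_gt0 (mulr_gt0 (ltr0n R 2) t0) M0))).
  by move: cut_eq; rewrite AE => ?; lra.
have sg0 : 0 < Num.sqrt (cutg th) by rewrite sqrtr_gt0.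
have sgE : Num.sqrt (cutg th) ^+ 2 = 4 * th ^+ 3 * cutp th / cutV th by rewrite sqr_sqrtr ?ltW.
have pE : th * cutp th = cutV th + 2 * cutM th * sin th by rewrite cutVE; ring.
have XX : ip X X = - (sin th * k * cutV th / th).
  rewrite XE !ipE aa az za AE ZE cutVE; field; rewrite gt_eqF//.
have YY : ip Y Y = 2 * cutM th * cutp th * k * cutV th.
  by rewrite YE !ipE aa az za AE ZE cutVE; ring.
have tauV : tau = s0 ^+ 2 * k * cutM th * cutV th * Num.sqrt (cutg th) / (4 * th ^+ 3).
  apply/eqP; rewrite -(@eqrXn2 _ 2)//; last first.
    apply: divr_ge0; last by apply: mulr_ge0 => //; exact: exprn_ge0 (ltW t0).
    apply: mulr_ge0 (sqrtr_ge0 _); apply: mulr_ge0 (ltW V0).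
    apply: mulr_ge0 (ltW M0); apply: mulr_ge0 (ltW k0); exact: sqr_ge0.
  rewrite tauE YY bb AE; apply/eqP; rewrite [RHS]expr_div_n.
  rewrite [in RHS]exprMn sgE.
  by field; rewrite !gt_eqF.
rewrite h2E XX tauV /kap2 AE ZE; split.
  by rewrite /cutB; field; rewrite !gt_eqF.
have -> : 2 * (s0 ^+ 2 * k * cutM th * cutV th * Num.sqrt (cutg th) / (4 * th ^+ 3)) *
    Num.sqrt (cutg th) = s0 ^+ 2 * k * cutM th * cutV th * Num.sqrt (cutg th) ^+ 2 / (2 * th ^+ 3).
  by field; rewrite gt_eqF.
rewrite sgE /cutq.
have -> : s0 ^+ 2 * - (sin th * k * cutV th / th) * (1 + 2 * cutM th ^+ 2 / cutV th) =
  - (s0 ^+ 2 * k * sin th * (cutV th + 2 * cutM th ^+ 2) / th) by field; rewrite !gt_eqF.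
have -> : s0 ^+ 2 * k * cutM th * cutV th * (4 * th ^+ 3 * cutp th / cutV th) / (2 * th ^+ 3)
  = 2 * s0 ^+ 2 * k * cutM th * cutp th by field; rewrite !gt_eqF.
rewrite /cutV /cutM /cutp; field; rewrite gt_eqF//.
Qed.

Variable gamma : R -> V * W.
Hypothesis gamma0 : gamma 0 = 0.
Hypothesis hor : forall T, 0 < T -> horizontal w T gamma (ext_u lam a b z).

Lemma gamma_cut_point : gamma s0 = (s0 *: X, w y b').
Proof.
by rewrite (ext_horizontal_unique (lt0r_neq0 lam0) gamma0 hor (ltW cut_time_gt0)); case: cut_point.
Qed.

Lemma cut_vectors_neq0 : [/\ ip y b' = 0, y != 0 & b' != 0].
Proof.
have [_ _ Yb Y0] := cut_orthogonal; have [_ bb _ _ _] := cut_frame.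
split; first by rewrite yE ipZl Yb mulr0.
- rewrite yE scaler_eq0 negb_or mulf_neq0 ?invr_eq0 ?mulf_neq0 ?expf_neq0 ?gt_eqF ?cut_time_gt0 ?cut_angle_gt0//.
  by apply: contraTneq Y0 => ->; rewrite ip0l ltxx.
- by apply: contraTneq a0 => E; rewrite -bb E ip0l ltxx.
Qed.

Lemma cut_wedge_neq0 : w y b' != 0.
Proof.
have [yb y0 b0] := cut_vectors_neq0; have [n [nn nY nb _]] := cut_axis.
have [tau tauE] := wedge_functional ip extW y b'.
apply/eqP => E; have := tauE y b'; rewrite E linear0 yb mul0r subr0 => /esym/eqP.
by rewrite mulf_eq0 !gt_eqF ?ip_gt0.
Qed.

Lemma cut_point_in_locus : (gamma s0).2 <> 0 /\
  (forall v, v \in supp w (gamma s0).2 -> ip (gamma s0).1 v = 0).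
Proof.
have [XY Xb _ _] := cut_orthogonal.
rewrite gamma_cut_point /=; split; first by apply/eqP; exact: cut_wedge_neq0.
apply: (supp_orthogonal dimV extW cut_wedge_neq0).
  by rewrite yE !ipE XY !mulr0.
by rewrite ipZl Xb mulr0.
Qed.

Lemma extremal_speed s : vnorm ip (ext_u lam a b z s) = Num.sqrt kap2.
Proof. exact: (ext_speed0 _ orth ab). Qed.

Lemma extremal_speed_gt0 : 0 < Num.sqrt kap2.
Proof. by rewrite sqrtr_gt0 ltr_pwDl ?ip_ge0. Qed.

Lemma minimizer_at_cut : minimizer ip w s0 gamma.
Proof.
exists (ext_u lam a b z); first exact: hor cut_time_gt0.
apply/eqP; rewrite eq_le; apply/andP; split; last first.
  apply: ereal_inf_lbound; exists s0, gamma, (ext_u lam a b z).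
  by split => //; [exact: cut_time_gt0 | exact: hor cut_time_gt0].
rewrite (length_constant_speed (ltW cut_time_gt0) extremal_speed).
apply: le_ereal_inf_tmp => _ [T [delta [u [T0 hd d0 dT ->]]]].
have [yb y0 b0] := cut_vectors_neq0; have [n [nn nY nb Xn]] := cut_axis.
have [_ _ Yb _] := cut_orthogonal.
have tau0 : 0 <= vnorm ip y * vnorm ip b' by rewrite mulr_ge0 ?vnorm_ge0.
have [||hB val] := cut_values tau0 (h2 := (s0 * ip X n) ^+ 2).
- by rewrite exprMn !vnorm_sqr yE !ipE; ring.
- by rewrite exprMn {2 3}Xn !ipE nn mulr1 -expr2.
have := length_lower_bound dimV extW rth T0 hd _ y0 b0 yb nn _ nb _ hB.
rewrite val => H; apply: le_trans (H _ _ _).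
- rewrite lee_fin sqrtrM ?addr_ge0 ?ip_ge0// sqrtr_sqr ger0_norm//.
  exact: ltW cut_time_gt0.
- by rewrite d0 gamma0.
- by rewrite yE ipZl nY mulr0.
- by rewrite dT gamma_cut_point {1}Xn scalerA.
Qed.

(* The half-turn [rot] about the axis [n] fixes the cut point but not the
   velocity of the extremal there. *)
Lemma not_minimizer_after_cut s : s0 < s -> ~ minimizer ip w s gamma.
Proof.
move=> s0s [u hu lu].
have sp : 0 < s by apply: lt_trans s0s; exact: cut_time_gt0.
have := length_control_unique ip dimV sp hu (hor sp).
rewrite lu (length_constant_speed (ltW sp) extremal_speed) gamma0.
rewrite (ext_horizontal_unique (lt0r_neq0 lam0) gamma0 hor (ltW sp)) => D.
have [yb y0 b0] := cut_vectors_neq0; have [n [nn nY nb Xn]] := cut_axis.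
have [uE ptE] := cut_point; case: ptE => xE tE.
have [|rot rotE] := @lfun_exists _ V V (fun v => (2 * ip v n) *: n - v).
  by move=> k p q; rewrite !ipE; apply: functional_eq => phi; rewrite !functionalE; ring.
have [||| rotW rotWE] := alternating_factor extW (B := fun p q => w (rot p) (rot q)).
- by move=> k p q v; rewrite linearP (wDl w) (wZl w).
- by move=> k p q v; rewrite linearP (wDr w) (wZr w).
- by move=> p; rewrite (wxx extW).
have iso v : ip (rot v) (rot v) = ip v v.
  by rewrite rotE !ipE nn (ipC ip n v); ring.
have := corner_shortcut dimV extW (lt0r_neq0 lam0) orth ab extremal_speed_gt0 cut_time_gt0 s0s rotWE iso.
move=> H; have {}H := H _ _ _.
have : ((dist ip w 0%R (ext_x lam a b z s, ext_t w lam a b z s)) < (Num.sqrt kap2 * s)%:E)%E.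
  apply: H.
  - rewrite xE rotE ipZl; move: Xn; set c := ip X n => ->.
    by apply: functional_eq => phi; rewrite !functionalE; ring.
  - rewrite tE rotWE !rotE yE !ipE nY nb !mulr0 !scale0r !sub0r.
    by rewrite (wNl w) (wNr w) opprK.
  (* A velocity fixed by the half-turn lies along [n]. Orthogonality to [b'] gives [sin th = 0],
     then [cut_eq] gives [z = 0], and orthogonality to [Y] gives [cos th = 0], which is absurd. *)
  apply/eqP => ru; have := rotE (ext_u lam a b z s0); rewrite ru => uu.
  have un v : ip v n = 0 -> ip (ext_u lam a b z s0) v = 0.
    move=> vn; have nv : ip n v = 0 by rewrite ipC.
    have : ip (ext_u lam a b z s0) v = - ip (ext_u lam a b z s0) v.
      by rewrite {1}uu ipBl ipZl nv mulr0 sub0r.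
    lra.
  have [aa bb hab az bz] := cut_frame.
  have za : ip z a' = 0 by rewrite ipC.
  have zb : ip z b' = 0 by rewrite ipC.
  have t0 := cut_angle_gt0; have /and3P[_ _ M0] := rth.
  have := un b' nb; rewrite uE !ipDl !ipZl hab bb zb mulr0 add0r addr0 => /eqP.
  rewrite mulf_eq0 (gt_eqF a0) orbF => /eqP sin0.
  have z0 : z = 0.
    apply: (@ip_eq0 _ _ ip); have := cut_eq; rewrite sin0 !mul0r add0r => /eqP.
    by rewrite mulf_eq0 gt_eqF ?mulr_gt0//= => /eqP.
  have := un Y nY; rewrite uE YE z0 scaler0 !addr0 sin0 scale0r addr0 ipZl ipZr aa => /eqP.
  rewrite !mulf_eq0 (gt_eqF a0) (gt_eqF (cutp_gt0 (cut_rangeW rth))) !orbF => /eqP cos0.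
  by have := cos2Dsin2 th; rewrite sin0 cos0 expr0n addr0 => /eqP; rewrite eq_sym oner_eq0.
by rewrite D ltxx.
Qed.

Lemma cut_time_extremal : cut_time ip w gamma = s0%:E.
Proof.
apply/eqP; rewrite eq_le; apply/andP; split.
  apply: ge_ereal_sup => _ [s [sp ms] <-]; rewrite lee_fin leNgt.
  by apply/negP => ss; exact: not_minimizer_after_cut ss ms.
apply: ereal_sup_ubound; exists s0 => //; split; first exact: cut_time_gt0.
exact: minimizer_at_cut.
Qed.

End OneExtremal.

(** At [pi] the first term vanishes and the second is nonnegative; at [phi] the second vanishes and
    the first is negative, which also keeps the zero away from [phi]. *)
Lemma cut_parameter_exists (A Z : R) : 0 < A -> 0 <= Z ->
  exists2 th, cut_range th & sin th * cutp th * A + 2 * th * cutM th * Z = 0.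
Proof.
move=> A0 Z0; have [phi [/andP[p1 p2] Mphi sphi rng]] := @cut_phi_exists R.
have pi0 := pi_gt0 R.
have hphi : pi <= phi <= 3 / 2 * pi by lra.
have [|||th /andP[t1 t2] E] := @zero_of_sign_change _
  (fun t => sin t * cutp t * A + 2 * t * cutM t * Z)
  (fun t => cos t * cutp t * A + sin t * (2 * sin t ^+ 2) * A
            + 2 * cutM t * Z + 2 * t * (t * sin t) * Z) pi phi (ltW p1).
- by move=> t _; apply: is_derive_eq; rewrite /GRing.scale /=; ring.
- by rewrite sinpi cutM_pi !mul0r add0r !mulr_ge0//; lra.
- by rewrite Mphi mulr0 mul0r addr0 -mulrA nmulr_rle0// mulr_ge0 ?ltW// cutp_gt0.
exists th => //; rewrite rng t1 lt_neqAle t2 andbT; apply/negP => /eqP tphi.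
move: E; rewrite tphi Mphi mulr0 mul0r addr0 => /eqP.
by rewrite !mulf_eq0 (lt_eqF sphi) (gt_eqF (cutp_gt0 hphi)) (gt_eqF A0).
Qed.
End CutTime.

Section CutLocus.
Context {R : realType} {V W : vectType R} (ip : {dot V for idfun}).
Context (w : {bilinear V -> V -> W}).
Local Notation mu := (@lebesgue_measure R).
Hypothesis dimV : \dim {:V} = 3%N.
Hypothesis extW : is_exterior_square w.

Lemma vnorm_eq_ip (a b : V) : vnorm ip a = vnorm ip b -> ip a a = ip b b.
Proof. by move=> E; rewrite -!vnorm_sqr E. Qed.

(** A competitor is at least as long as its displacement in [V], which the segment attains. *)
Lemma line_minimizer (v : V) gamma s : 0 < s -> gamma 0 = 0 ->
  horizontal w s gamma (fun=> v) -> minimizer ip w s gamma.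
Proof.
move=> s0 g0 hor; exists (fun=> v) => //.
rewrite (@length_constant_speed _ _ ip s (vnorm ip v)) ?ltW//.
apply/eqP; rewrite eq_le; apply/andP; split; last first.
  apply: ereal_inf_lbound; exists s, gamma, (fun=> v); split => //.
  by rewrite (@length_constant_speed _ _ ip s (vnorm ip v)) ?ltW.
apply: le_ereal_inf_tmp => _ [T [delta [u [T0 hd d0 dT ->]]]].
have gs : (gamma s).1 = s *: v.
  apply: functional_eq => phi.
  rewrite (horizontal_fst s0 hor phi) ?lexx ?ltW// g0 linear0 add0r.
  rewrite Rintegral_cst//= lebesgue_measure_itv /= lte_fin s0 /= subr0.
  by rewrite functionalZ mulrC.
have := length_ge_displacement ip dimV T0 hd; rewrite d0 g0 => /(_ erefl).
rewrite dT gs; congr (_%:E <= _)%E.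
by rewrite /vnorm ipZl ipZr mulrA -expr2 sqrtrM ?sqr_ge0// sqrtr_sqr gtr0_norm// mulrC.
Qed.

Lemma cut_locus_forward (p : V * W) : cut_locus ip w p ->
  p.2 <> 0 /\ (forall y, y \in supp w p.2 -> ip p.1 y = 0).
Proof.
move=> [gamma [T [[lam [a [b [z [lam_ge0 orth ab a0 hor]]]]] g0 cutT <-]]].
have [l0|l0] := eqVneq lam 0.
  have all_min s : 0 < s -> minimizer ip w s gamma.
    move=> s0; apply: (@line_minimizer (a + z)) => //.
    have := hor s s0; congr (horizontal _ _ _ _); apply/funext => r.
    by rewrite l0 mul0r cos0 sin0 scale1r scale0r addr0.
  (* The sign of [T] is unknown at this point, so [s] is made both positive and larger than [T]. *)
  pose s := Num.max 1 (T + 1).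
  have s1 : 1 <= s by rewrite le_max lexx.
  have sT : T + 1 <= s by rewrite le_max lexx orbT.
  have : (s%:E <= cut_time ip w gamma)%E.
    by apply: ereal_sup_ubound; exists s => //; split; [|apply: all_min]; lra.
  by rewrite cutT lee_fin => ?; exfalso; lra.
have lam0 : 0 < lam by rewrite lt_neqAle eq_sym l0.
have a0' : 0 < ip a a by rewrite -vnorm_sqr exprn_gt0.
have [th rth cut_eq] := cut_parameter_exists a0' (ip_ge0 ip z).
have := cut_time_extremal dimV extW lam0 orth (vnorm_eq_ip ab) a0' rth cut_eq
  erefl erefl erefl erefl erefl erefl g0 hor.
rewrite cutT => -[->].
exact: (cut_point_in_locus dimV extW lam0 orth (vnorm_eq_ip ab) a0' rth cut_eq
  erefl erefl erefl erefl erefl erefl g0 hor).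
Qed.

(** The equation is [X = 2 * tau * cutB th], squared and cleared of denominators so that it can be
    evaluated at [phi], where [cutB] blows up. *)
Lemma cut_ratio_exists (X tau : R) : 0 <= X -> 0 < tau ->
  exists2 th, cut_range th &
    cutM th ^+ 2 * X ^+ 2 * cutp th = 4 * sin th ^+ 2 * tau ^+ 2 * (th * cutV th).
Proof.
move=> X0 tau0; have [phi [/andP[p1 p2] Mphi sphi rng]] := @cut_phi_exists R.
have pi0 := pi_gt0 R.
have hphi : pi <= phi <= 3 / 2 * pi by lra.
have hpi := cut_rangeW (@cut_range_pi R).
have [|||th /andP[t1 t2] E] := @zero_of_sign_change _
  (fun t => cutM t ^+ 2 * X ^+ 2 * cutp t - 4 * sin t ^+ 2 * tau ^+ 2 * (t * cutV t))
  (fun t => 2 * cutM t * (t * sin t) * X ^+ 2 * cutp t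
     + cutM t ^+ 2 * X ^+ 2 * (2 * sin t ^+ 2)
     - 8 * sin t * cos t * tau ^+ 2 * (t * cutV t)
     - 4 * sin t ^+ 2 * tau ^+ 2 * (cutV t + t * (3 * cutp t - 2 * t * sin t ^+ 2)))
  pi phi (ltW p1).
- by move=> t _; apply: is_derive_eq; rewrite /GRing.scale /=; ring.
- rewrite sinpi expr0n /= mulr0 !mul0r subr0.
  by apply: mulr_ge0 (ltW (cutp_gt0 hpi)); apply: mulr_ge0; exact: sqr_ge0.
- rewrite Mphi expr0n /= !mul0r sub0r oppr_le0.
  apply: mulr_ge0; last by apply: mulr_ge0 (ltW (cutV_gt0 hphi)); lra.
  by apply: mulr_ge0 (sqr_ge0 _); apply: mulr_ge0 (sqr_ge0 _).
exists th; last by lra.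
rewrite rng t1 lt_neqAle t2 andbT; apply/negP => /eqP tphi.
move: E; rewrite tphi Mphi expr0n /= !mul0r sub0r => /eqP.
have phi0 : phi != 0 by rewrite gt_eqF//; lra.
rewrite oppr_eq0 !mulf_eq0 ?expf_eq0 /= (lt_eqF sphi) (gt_eqF tau0) (negbTE phi0).
by rewrite (gt_eqF (cutV_gt0 hphi)) pnatr_eq0.
Qed.

Lemma cut_locus_backward (x : V) (t : W) : t <> 0 ->
  (forall y, y \in supp w t -> ip x y = 0) -> cut_locus ip w (x, t).
Proof.
move=> /eqP t0 perp.
have [y1 [y3 [[tE _] [sy1 sy3]]]] := suppP ip dimV extW t.
have xy1 := perp _ sy1; have xy3 := perp _ sy3; rewrite tE in t0.
have [y2 [wE y12 y10 y20 /(_ x xy1 xy3) xy2]] := wedge_orthogonalize ip extW t0.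
rewrite -wE in tE.
set n1 := vnorm ip y1; set n2 := vnorm ip y2.
have n10 : 0 < n1 by rewrite sqrtr_gt0 ip_gt0.
have n20 : 0 < n2 by rewrite sqrtr_gt0 ip_gt0.
have n1E : ip y1 y1 = n1 ^+ 2 by rewrite vnorm_sqr.
have n2E : ip y2 y2 = n2 ^+ 2 by rewrite vnorm_sqr.
pose tau := n1 * n2; have tau0 : 0 < tau by rewrite mulr_gt0.
have [th rth thE] := cut_ratio_exists (ip_ge0 ip x) tau0.
have hth := cut_rangeW rth; have /and3P[_ _ M0] := rth.
have [th2 s0 _ _ _] := cut_bounds hth.
have p0 := cutp_gt0 hth; have V0 := cutV_gt0 hth.
have th0 : 0 < th by lra.
(* The unknowns are [m], the norm of [Y], and [al], the common norm of [a'] and [b']. Reaching [t]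
   at time 1 needs [m * al = 4 th^2 tau], and orthogonality of [x] and [Y] needs [m / al = r]. *)
pose r := Num.sqrt (cutV th * cutp th / th).
have r0 : 0 < r by rewrite sqrtr_gt0 divr_gt0// mulr_gt0.
have rE : r ^+ 2 = cutV th * cutp th / th.
  by rewrite sqr_sqrtr// ltW// divr_gt0// mulr_gt0.
pose m := Num.sqrt (4 * th ^+ 2 * tau * r).
have m0' : 0 < 4 * th ^+ 2 * tau * r.
  by apply: mulr_gt0 => //; apply: mulr_gt0 => //; apply: mulr_gt0 => //; exact: exprn_gt0.
have m0 : 0 < m by rewrite sqrtr_gt0.
have mE : m ^+ 2 = 4 * th ^+ 2 * tau * r by rewrite sqr_sqrtr ?ltW.
pose al := Num.sqrt (th * m ^+ 2 / (cutV th * cutp th)).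
have al0' : 0 < th * m ^+ 2 / (cutV th * cutp th).
  by apply: divr_gt0; apply: mulr_gt0 => //; exact: exprn_gt0.
have al0 : 0 < al by rewrite sqrtr_gt0.
have alE : al ^+ 2 = th * m ^+ 2 / (cutV th * cutp th) by rewrite sqr_sqrtr ?ltW.
have alm : m * al = 4 * th ^+ 2 * tau.
  apply/eqP; rewrite -(@eqrXn2 _ 2)//; last 2 first.
  - by rewrite mulr_ge0 ?ltW.
  - by rewrite mulr_ge0 ?(ltW tau0)// mulr_ge0 ?sqr_ge0.
  rewrite exprMn alE; apply/eqP.
  transitivity ((m ^+ 2) ^+ 2 * (th / (cutV th * cutp th))).
    by field; rewrite !gt_eqF.
  rewrite mE; transitivity (16 * th ^+ 4 * tau ^+ 2 * r ^+ 2 * (th / (cutV th * cutp th))).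
    by ring.
  by rewrite rE; field; rewrite !gt_eqF.
(* The choice of [th] enters here; this value of [ip x x] is what makes [a'] and [z] orthogonal. *)
have xE : ip x x = - (sin th * m ^+ 2 / (2 * th * cutM th * cutp th)).
  apply/eqP; rewrite -(@eqrXn2 _ 2) ?ip_ge0//; last first.
    rewrite oppr_ge0 mulr_le0_ge0 ?invr_ge0//.
      by rewrite mulr_le0_ge0// sqr_ge0.
    by apply: mulr_ge0 (ltW p0); apply: mulr_ge0 (ltW M0); lra.
  apply/eqP; apply: (mulfI (lt0r_neq0 (mulr_gt0 (exprn_gt0 2 M0) p0))).
  have -> : cutM th ^+ 2 * cutp th * ip x x ^+ 2 = cutM th ^+ 2 * ip x x ^+ 2 * cutp th by ring.
  rewrite thE.
  transitivity (sin th ^+ 2 * (m ^+ 2) ^+ 2 / (4 * th ^+ 2 * cutp th)); last first.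
    by field; rewrite !gt_eqF.
  rewrite mE.
  transitivity (sin th ^+ 2 * 4 * th ^+ 2 * tau ^+ 2 * r ^+ 2 / cutp th); last first.
    by field; rewrite !gt_eqF.
  by rewrite rE; field; rewrite !gt_eqF.
(* The frame is found by solving [x = (sin th / th) a' + z] and
   [Y = cutp th a' + 2 cutM th z] for [a'] and [z]. *)
have [Y YE] : exists Y, Y = (m / n1) *: y1 by exists ((m / n1) *: y1).
have [a' a'E] : exists a', a' = (th / cutV th) *: (Y - (2 * cutM th) *: x) by eexists.
have [z zE] : exists z, z = (th / cutV th) *: (cutp th *: x - (sin th / th) *: Y) by eexists.
have [b' b'E] : exists b', b' = (al / n2) *: y2 by exists ((al / n2) *: y2).
have YY : ip Y Y = m ^+ 2 by rewrite YE ipZl ipZr n1E; field; rewrite gt_eqF.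
have xY : ip x Y = 0 by rewrite YE ipZr xy1 mulr0.
have Yx : ip Y x = 0 by rewrite ipC.
have VE : cutV th = th * cutp th - 2 * cutM th * sin th := cutVE th.
have aa : ip a' a' = al ^+ 2.
  rewrite a'E !ipE YY xY Yx xE alE.
  transitivity (th * m ^+ 2 * (th * cutp th - 2 * cutM th * sin th) / (cutV th ^+ 2 * cutp th)).
    by field; rewrite !gt_eqF.
  by rewrite -VE; field; rewrite !gt_eqF.
have bb : ip b' b' = al ^+ 2 by rewrite b'E ipZl ipZr n2E; field; rewrite gt_eqF.
have xb : ip x b' = 0 by rewrite b'E ipZr xy2 mulr0.
have Yb : ip Y b' = 0 by rewrite YE b'E ipZl ipZr y12 !mulr0.
have az : ip a' z = 0.
  by rewrite a'E zE !ipE YY xY Yx xE; field; rewrite !gt_eqF.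
have ab : ip a' b' = 0 by rewrite a'E !ipE Yb xb; ring.
have zb : ip z b' = 0 by rewrite zE !ipE Yb xb; ring.
have ba : ip b' a' = 0 by rewrite ipC.
have za : ip z a' = 0 by rewrite ipC.
have bz : ip b' z = 0 by rewrite ipC.
have YE' : Y = cutp th *: a' + (2 * cutM th) *: z.
  apply: functional_eq => phi; rewrite a'E zE !functionalE.
  transitivity ((th * cutp th - 2 * cutM th * sin th) / cutV th * phi Y).
    by rewrite -VE divff ?mul1r// gt_eqF.
  by field; rewrite !gt_eqF.
have XE : x = (sin th / th) *: a' + z.
  apply: functional_eq => phi; rewrite a'E zE !functionalE.
  transitivity ((th * cutp th - 2 * cutM th * sin th) / cutV th * phi x).
    by rewrite -VE divff ?mul1r// gt_eqF.
  by field; rewrite !gt_eqF.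
have cs := cos2Dsin2 th.
have [a aE] : exists a, a = cos th *: a' - sin th *: b' by eexists.
have [b bE] : exists b, b = sin th *: a' + cos th *: b' by eexists.
have hab : ip a b = 0 by rewrite aE bE !ipE aa bb ab ba; ring.
have haz : ip a z = 0 by rewrite aE !ipE az bz; ring.
have hbz : ip b z = 0 by rewrite bE !ipE az bz; ring.
have haa : ip a a = al ^+ 2.
  by rewrite aE !ipE aa bb ab ba -[RHS]mul1r -cs; ring.
have hbb : ip b b = al ^+ 2.
  by rewrite bE !ipE aa bb ab ba -[RHS]mul1r -cs; ring.
have a'E' : a' = cos th *: a + sin th *: b.
  apply: functional_eq => phi; rewrite aE bE !functionalE.
  by rewrite -[LHS]mul1r -cs; ring.
have b'E' : b' = - sin th *: a + cos th *: b.
  apply: functional_eq => phi; rewrite aE bE !functionalE.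
  by rewrite -[LHS]mul1r -cs; ring.
have orth : [/\ ip a b = 0, ip a z = 0 & ip b z = 0] by [].
have hab' : ip a a = ip b b by rewrite haa hbb.
have a0 : 0 < ip a a by rewrite haa exprn_gt0.
have cut_eq : sin th * cutp th * ip a a + 2 * th * cutM th * ip z z = 0.
  have : ip ((sin th / th) *: a' + z) (cutp th *: a' + (2 * cutM th) *: z) = 0.
    by rewrite -XE -YE'.
  rewrite !ipE aa az za haa => E.
  transitivity (th * (sin th / th * cutp th * al ^+ 2 + 2 * cutM th * ip z z)).
    by field; rewrite gt_eqF.
  by rewrite -[RHS](mulr0 th) -E; ring.
(* Frequency [2 * th] normalizes the cut time to 1. *)
pose gamma s := (ext_x (2 * th) a b z s, ext_t w (2 * th) a b z s).
have lam0 : 0 < 2 * th by rewrite mulr_gt0.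
have hor T : 0 < T -> horizontal w T gamma (ext_u (2 * th) a b z).
  by move=> _; exact: smooth_is_horizontal (ext_smooth extW a b z (lt0r_neq0 lam0)).
have g0 : gamma 0 = 0 by rewrite /gamma ext_x0 ext_t0.
have s0E : 1 = 2 * th / (2 * th) by rewrite divff// gt_eqF.
exists gamma, 1; split => //.
- exists (2 * th), a, b, z; split => //; first exact: ltW.
  + by rewrite /vnorm hab'.
  + by rewrite sqrtr_gt0.
- exact: (cut_time_extremal dimV extW lam0 orth hab' a0 rth cut_eq s0E a'E' b'E' XE YE' erefl g0 hor).
rewrite (gamma_cut_point extW lam0 rth s0E a'E' b'E' XE YE' erefl g0 hor).
rewrite scale1r; congr (_, _); rewrite tE YE b'E !(wZl w) !(wZr w) !scalerA.
rewrite -[RHS]scale1r; congr (_ *: _).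
transitivity (m * al / (4 * th ^+ 2) / tau).
  by rewrite /tau; field; rewrite !gt_eqF.
by rewrite alm; field; rewrite !gt_eqF.
Qed.

End CutLocus.

Theorem theorem1p1 (R : realType) (V W : vectType R)
    (ip : {dot V for idfun}) (w : {bilinear V -> V -> W})
    (dimV : \dim {:V} = 3%N) (extW : is_exterior_square w) :
  cut_locus ip w =
  [set p : V * W |
     p.2 <> 0 /\ (forall y : V, y \in supp w p.2 -> ip p.1 y = 0)].
Proof.
apply/seteqP; split => [p|[x t] [t0 perp]]; first exact: cut_locus_forward.
exact: cut_locus_backward.
Qed.
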